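(* Let $a,b\in\widetilde{\mathbb R}$ with $a<b$, let $F\in\mathcal{GC}^\infty([a,b]\times\widetilde{\mathbb R}^d\times\widetilde{\mathbb R}^d,\widetilde{\mathbb R})$, let $I(u)=\int_a^bF(t,u,\dot u)\,dt$, and let $p,q\in\widetilde{\mathbb R}^d$. Let $r\in\widetilde{\mathbb R}_{>0}$, $m\in\mathbb N$, and let $u\in\mathcal{GC}^\infty_{\mathrm{bd}}(p,q)$ be such that (i) $\delta I(u;\eta)=0$ for all $\eta\in\mathcal{GC}^\infty_0(a,b)$; (ii) $\delta^2I(v;\eta)\ge0$ for all $\eta\in\mathcal{GC}^\infty_0(a,b)$ and all $v\in B^m_r(u)\cap\mathcal{GC}^\infty_{\mathrm{bd}}(p,q)$. Then $u$ is a local minimizer of the functional $I$ in $\mathcal{GC}^\infty_{\mathrm{bd}}(p,q)$. Moreover, if $\delta^2I(v;\eta)>0$ for all $\eta\in\mathcal{GC}^\infty_0(a,b)$ such that $\|\eta\|_m>0$ and for all $v\in B^m_{2r}(u)\cap\mathcal{GC}^\infty_{\mathrm{bd}}(p,q)$, then $I(v)>I(u)$ for all $v\in B^m_r(u)\cap\mathcal{GC}^\infty_{\mathrm{bd}}(p,q)$ such that $\|v-u\|_m>0$.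
   Context: Generalized numbers. Let $I_0=(0,1]\subseteq\mathbb R$; ''for $\varepsilon$ small'' means for all $\varepsilon\in(0,\varepsilon_0]$ for some $\varepsilon_0\in I_0$. Fix a net $\rho=(\rho_\varepsilon)_{\varepsilon\in I_0}$ of reals with $\rho_\varepsilon\to0^+$ as $\varepsilon\to0^+$. A net $(x_\varepsilon)$ in $\mathbb R^n$ is moderate if $|x_\varepsilon|=O(\rho_\varepsilon^{-N})$ for some $N\in\mathbb R_{>0}$; $(x_\varepsilon)\sim(y_\varepsilon)$ if $|x_\varepsilon-y_\varepsilon|=O(\rho_\varepsilon^{N})$ for every $N\in\mathbb R_{>0}$. $\widetilde{\mathbb R}$ is the ring of moderate real nets modulo $\sim$, with classes $[x_\varepsilon]$; $\widetilde{\mathbb R}^n$ is defined analogously. $\mathbb R\subseteq\widetilde{\mathbb R}$ via constant nets. $x\le y$ iff there are representatives with $x_\varepsilon\le y_\varepsilon$ for all $\varepsilon$; $x<y$ iff $y-x\ge0$ and $y-x$ is invertible; $|[x_\varepsilon]|=[|x_\varepsilon|]$ (Euclidean norm); $\max([x_\varepsilon],[y_\varepsilon])=[\max(x_\varepsilon,y_\varepsilon)]$. $[a,b]=\{x\in\widetilde{\mathbb R}:a\le x\le b\}$. The sharp topology on $\widetilde{\mathbb R}^n$ has as base the balls $B_r(c)=\{x:|x-c|<r\}$, $r\in\widetilde{\mathbb R}_{>0}$. Generalized smooth functions (GSF). For open $\Omega_\varepsilon\subseteq\mathbb R^n$, $\langle\Omega_\varepsilon\rangle$ is the set of $[x_\varepsilon]\in\widetilde{\mathbb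 R}^n$ such that for every representative $x_\varepsilon\in\Omega_\varepsilon$ for $\varepsilon$ small. For $X\subseteq\widetilde{\mathbb R}^n$, $Y\subseteq\widetilde{\mathbb R}^k$, $\mathcal{GC}^\infty(X,Y)$ is the set of maps $f:X\to Y$ for which there are $f_\varepsilon\in C^\infty(\Omega_\varepsilon,\mathbb R^k)$ with $X\subseteq\langle\Omega_\varepsilon\rangle$, $f([x_\varepsilon])=[f_\varepsilon(x_\varepsilon)]$ and $(\partial^\alpha f_\varepsilon(x_\varepsilon))$ moderate for all $[x_\varepsilon]\in X$ and all multi-indices $\alpha$. Derivatives are $\partial^\alpha f([x_\varepsilon])=[\partial^\alpha f_\varepsilon(x_\varepsilon)]$ at sharply interior points and one-sided limits at endpoints of intervals. $\int_a^bf(t)\,dt=[\int_{a_\varepsilon}^{b_\varepsilon}f_\varepsilon(t)\,dt]$. Variational notions. $\mathcal{GC}^\infty_0(a,b)=\{\eta\in\mathcal{GC}^\infty(\widetilde{\mathbb R},\widetilde{\mathbb R}^d):\eta(a)=0=\eta(b)\}$ (restricted to $[a,b]$ when needed, in particular in $\|\eta\|_m$). $\mathcal{GC}^\infty_{\mathrm{bd}}(p,q)=\{v\in\mathcal{GC}^\infty([a,b],\widetilde{\mathbb R}^d):v(a)=p,\ v(b)=q\}$. For $m\in\mathbb N$ ($0\in\mathbb N$) and $v\in\mathcal{GC}^\infty([a,b],\widetilde{\mathbb R}^d)$, $\|v\|_m=\max_{n\le m,\,1\le i\le d}\max\left(\left|\frac{d^nv^i}{dt^n}(M_{ni})\right|,\left|\frac{d^nv^i}{dt^n}(m_{ni})\right|\right)\in\widetilde{\mathbb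 R}$, where $m_{ni},M_{ni}\in[a,b]$ are points at which $\frac{d^nv^i}{dt^n}$ attains its minimum resp. maximum over $[a,b]$ (they exist, and the value does not depend on their choice). $B^m_r(u)=\{v\in\mathcal{GC}^\infty([a,b],\widetilde{\mathbb R}^d):\|v-u\|_m<r\}$. $u$ is a local minimizer of $I$ in $\mathcal{GC}^\infty_{\mathrm{bd}}(p,q)$ if $u\in\mathcal{GC}^\infty_{\mathrm{bd}}(p,q)$ and there are $r'\in\widetilde{\mathbb R}_{>0}$, $m'\in\mathbb N$ with $I(v)\ge I(u)$ for all $v\in B^{m'}_{r'}(u)\cap\mathcal{GC}^\infty_{\mathrm{bd}}(p,q)$. $\delta I(u;\eta)=\frac{d}{ds}I(u+s\eta)|_{s=0}$ and $\delta^2I(u;\eta)=\frac{d^2}{ds^2}I(u+s\eta)|_{s=0}$. *)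

(* Defs.v *)
From HB Require Import structures.
From mathcomp Require Import all_boot all_order all_algebra generic_quotient.
From mathcomp Require Import ring_quotient lra.
From mathcomp Require Import all_classical all_reals all_analysis.

Set Implicit Arguments.
Unset Strict Implicit.
Unset Printing Implicit Defensive.

Import Order.TTheory GRing.Theory Num.Theory.
Import numFieldNormedType.Exports.
Local Open Scope classical_set_scope.
Local Open Scope ring_scope.

Record I0 (R : realType) := MkI0 { idx :> R; idxP : 0 < idx <= 1 }.

HB.instance Definition _ (R : realType) := [isSub for @idx R].
HB.instance Definition _ (R : realType) := [Choice of I0 R by <:].

Fact one_in_I0 (R : realType) : 0 < (1 : R) <= 1.
Proof. by rewrite ltr01 lexx. Qed.

HB.instance Definition _ (R : realType) := isPointed.Build (I0 R) (MkI0 (one_in_I0 R)).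

Definition for_small (R : realType) (P : I0 R -> Prop) : Prop :=
  exists e0 : I0 R, forall e : I0 R, idx e <= idx e0 -> P e.

(* rho_e -> 0^+ : in particular rho_e > 0 only for e small. *)
Record gauge (R : realType) := Gauge {
  gauge_fun :> I0 R -> R;
  gauge_cvg : forall r : R, 0 < r -> for_small (fun e => 0 < gauge_fun e < r)
}.

Definition bigO_pow (R : realType) (rho : gauge R) (x : I0 R -> R) (N : R) :=
  exists C : R, for_small (fun e => `|x e| <= C * (rho e `^ N)).

Definition moderate (R : realType) (rho : gauge R) (x : I0 R -> R) : Prop :=
  exists N : R, 0 < N /\ bigO_pow rho x (- N).

Definition negligible_net (R : realType) (rho : gauge R) (x : I0 R -> R) : Prop :=
  forall N : R, 0 < N -> bigO_pow rho x N.

Section SmallTheory.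
Variable R : realType.
Implicit Types (P Q : I0 R -> Prop).

Lemma for_smallI P Q :
  for_small P -> for_small Q -> for_small (fun e => P e /\ Q e).
Proof.
move=> [e1 h1] [e2 h2]; case: (leP (idx e1) (idx e2)) => h.
  by exists e1 => e he; split; [exact: h1|apply: h2; exact: le_trans h].
by exists e2 => e he; split; [apply: h1; exact: le_trans (ltW h)|exact: h2].
Qed.

Lemma for_smallW P Q : (forall e, P e -> Q e) -> for_small P -> for_small Q.
Proof. by move=> h [e0 h0]; exists e0 => e /h0/h. Qed.

Lemma for_smallT P : (forall e, P e) -> for_small P.
Proof. by move=> h; exists point. Qed.

Lemma for_small_ex P : for_small P -> exists e, P e.
Proof. by move=> [e0 h0]; exists e0; apply: h0. Qed.

Variable rho : gauge R.

Lemma gauge_small : for_small (fun e => 0 < rho e < 1).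
Proof. exact: gauge_cvg. Qed.

Lemma bigO_powD (x y : I0 R -> R) (M N K : R) : K <= M -> K <= N ->
  bigO_pow rho x M -> bigO_pow rho y N -> bigO_pow rho (x + y) K.
Proof.
move=> KM KN [C hC] [D hD]; exists (`|C| + `|D|).
apply: for_smallW (for_smallI gauge_small (for_smallI hC hD)) => e.
move=> [/andP[r0 r1] [xC yD]].
have key S A : K <= S -> A * rho e `^ S <= `|A| * rho e `^ K.
  move=> KS; apply: (@le_trans _ _ (`|A| * rho e `^ S)).
    by apply: ler_wpM2r; rewrite ?powR_ge0 ?ler_norm.
  by apply: ler_wpM2l => //; apply: ger_powR => //; rewrite r0 ltW.
rewrite mulrDl; apply: le_trans (ler_normD _ _) _; apply: lerD.
  exact: le_trans xC (key _ _ KM).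
exact: le_trans yD (key _ _ KN).
Qed.

Lemma bigO_powM (x y : I0 R -> R) (M N : R) :
  bigO_pow rho x M -> bigO_pow rho y N -> bigO_pow rho (x * y) (M + N).
Proof.
move=> [C hC] [D hD]; exists (C * D).
apply: for_smallW (for_smallI gauge_small (for_smallI hC hD)) => e.
move=> [/andP[r0 r1] [xC yD]].
have -> : rho e `^ (M + N) = rho e `^ M * rho e `^ N.
  by apply: powRD; rewrite (gt_eqF r0) implybT.
by rewrite [(x * y) e]/(x e * y e) normrM mulrACA; exact: ler_pM.
Qed.

Lemma bigO_powN (x : I0 R -> R) (N : R) :
  bigO_pow rho x N -> bigO_pow rho (- x) N.
Proof.
by move=> [C hC]; exists C; apply: for_smallW hC => e; rewrite normrN.
Qed.

Lemma bigO_pow0 (N : R) : bigO_pow rho 0 N.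
Proof. by exists 0; apply: for_smallT => e; rewrite normr0 mul0r. Qed.

Lemma moderate_cst (c : R) : moderate rho (fun=> c).
Proof.
exists 1; split=> //; exists `|c|.
apply: for_smallW gauge_small => e /andP[r0 r1].
have -> : rho e `^ (- 1) = (rho e)^-1 by rewrite powR_inv1// ltW.
by rewrite ler_peMr// invf_ge1// ltW.
Qed.

Lemma not_negligible1 : ~ negligible_net rho (fun=> 1).
Proof.
move=> /(_ 1 ltr01)[C hC].
have C0 : 0 < (`|C| + 1)^-1 by rewrite invr_gt0 ltr_wpDl.
have [e [h /andP[r0 r1]]] := for_small_ex (for_smallI hC (gauge_cvg rho C0)).
move: h; rewrite normr1 (powRr1 (ltW r0)) => h.
have : C * rho e < 1.
  apply: (@le_lt_trans _ _ (`|C| * rho e)).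
    by apply: ler_wpM2r; rewrite ?ler_norm// ltW.
  apply: (@le_lt_trans _ _ ((`|C| + 1) * rho e)).
    by apply: ler_wpM2r; rewrite ?lerDl// ltW.
  by rewrite -ltr_pdivlMl ?mulr1// ltr_wpDl.
by rewrite ltNge h.
Qed.

End SmallTheory.

Definition moderate_pred (R : realType) (rho : gauge R) : {pred (I0 R -> R)} :=
  fun x => `[< moderate rho x >].

Fact moderate_subring (R : realType) (rho : gauge R) :
  subring_closed (moderate_pred rho).
Proof.
split.
- exact/asboolP/moderate_cst.
- move=> x y /asboolP[M [M0 xM]] /asboolP[N [N0 yN]]; apply/asboolP.
  exists (Num.max M N); split; first by rewrite lt_max M0.
  apply: (bigO_powD _ _ xM (bigO_powN yN)).
    by rewrite lerN2 le_max lexx.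
  by rewrite lerN2 le_max lexx orbT.
- move=> x y /asboolP[M [M0 xM]] /asboolP[N [N0 yN]]; apply/asboolP.
  exists (M + N); split; first exact: addr_gt0.
  by rewrite opprD; exact: bigO_powM.
Qed.

HB.instance Definition _ (R : realType) (rho : gauge R) :=
  GRing.isSubringClosed.Build (I0 R -> R) (moderate_pred rho)
    (moderate_subring rho).

Record mnet (R : realType) (rho : gauge R) :=
  Mnet { mnet_val :> I0 R -> R; mnetP : mnet_val \in moderate_pred rho }.

HB.instance Definition _ (R : realType) (rho : gauge R) :=
  [isSub for @mnet_val R rho].
HB.instance Definition _ (R : realType) (rho : gauge R) :=
  [Choice of mnet rho by <:].
HB.instance Definition _ (R : realType) (rho : gauge R) :=
  [SubChoice_isSubComNzRing of mnet rho by <:].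

Definition negligible_pred (R : realType) (rho : gauge R) : {pred (mnet rho)} :=
  fun x => `[< negligible_net rho x >].
Arguments negligible_pred {R} rho.

Fact negligible_ideal (R : realType) (rho : gauge R) :
  idealr_closed (negligible_pred rho).
Proof.
split.
- by apply/asboolP => N _; exact: bigO_pow0.
- by apply/asboolP; exact: not_negligible1.
- move=> a x y /asboolP hx /asboolP hy; apply/asboolP => N N0.
  have /asboolP[K [K0 aK]] := mnetP a.
  apply: (@bigO_powD _ _ (a * x : I0 R -> R) y N N N) => //; last exact: hy.
  rewrite -[N](addKr K); apply: bigO_powM => //.
  by apply: hx; exact: addr_gt0.
Qed.

HB.instance Definition _ (R : realType) (rho : gauge R) :=
  isIdealr.Build (mnet rho) (negligible_pred rho) (negligible_ideal rho).

Definition gnum (R : realType) (rho : gauge R) : Type :=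
  {ideal_quot (negligible_pred rho)}.

HB.instance Definition _ (R : realType) (rho : gauge R) :=
  GRing.ComNzRing.on (gnum rho).
Section Classes.
Context {R : realType} (rho : gauge R).
Local Notation RT := (gnum rho).

(* [gclass x] is [x_e] for a moderate net x; it is 0 (junk) otherwise. *)
Definition gclass (x : I0 R -> R) : RT := \pi_RT%qT (insubd (0 : mnet rho) x).

Definition gnet (X : RT) : I0 R -> R := mnet_val (repr X).

Definition represents (X : RT) (x : I0 R -> R) : Prop :=
  moderate rho x /\ gclass x = X.

Lemma gclass_eq (x y : I0 R -> R) : moderate rho x -> moderate rho y ->
  gclass x = gclass y <-> negligible_net rho (x - y).
Proof.
move=> mx my; have {}mx : x \in moderate_pred rho by exact/asboolP.
have {}my : y \in moderate_pred rho by exact/asboolP.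
have -> : (x - y : I0 R -> R) = mnet_val (insubd (0 : mnet rho) x - insubd 0 y).
  by rewrite -[in LHS](insubdK (0 : mnet rho) mx)
             -[in LHS](insubdK (0 : mnet rho) my).
rewrite /gclass; split => [/eqP|h].
  by rewrite -Quotient.idealrBE => /asboolP.
by apply/eqP; rewrite -Quotient.idealrBE; exact/asboolP.
Qed.

Lemma gnetP (X : RT) : represents X (gnet X).
Proof.
split; first exact/asboolP/mnetP.
by rewrite /gclass /gnet valKd reprK.
Qed.

(* Order; the strict order is not the strict part of the order, as the ring
   has zero divisors. *)
Definition gle (X Y : RT) : Prop :=
  exists x y : I0 R -> R,
    [/\ represents X x, represents Y y & forall e, x e <= y e].

Definition ginvertible (X : RT) : Prop := exists Z : RT, X * Z = 1.

Definition glt (X Y : RT) : Prop := gle 0 (Y - X) /\ ginvertible (Y - X).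

Definition gabs (X : RT) : RT := gclass (fun e => `|gnet X e|).

Definition gmax (X Y : RT) : RT :=
  gclass (fun e => Num.max (gnet X e) (gnet Y e)).

Definition gitv (a b : RT) : set RT := [set t | gle a t /\ gle t b].

Lemma represents_negligible (X : RT) (x y : I0 R -> R) :
  represents X x -> represents X y -> negligible_net rho (x - y).
Proof. by move=> [mx <-] [my /esym/gclass_eq]; exact. Qed.

Lemma moderate_le (x y : I0 R -> R) :
  (forall e, `|x e| <= `|y e|) -> moderate rho y -> moderate rho x.
Proof.
move=> xy [N [N0 [C hC]]]; exists N; split => //; exists C.
by apply: for_smallW hC => e; exact: le_trans.
Qed.

Lemma negligible_le (x y : I0 R -> R) : (forall e, `|x e| <= `|y e|) ->
  negligible_net rho y -> negligible_net rho x.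
Proof.
move=> xy hy N N0; have [C hC] := hy N N0; exists C.
by apply: for_smallW hC => e; exact: le_trans.
Qed.

Lemma gabs_represents (X : RT) (x : I0 R -> R) :
  represents X x -> represents (gabs X) (fun e => `|x e|).
Proof.
move=> Xx; have Xr := gnetP X.
have mabs y : moderate rho y -> moderate rho (fun e => `|y e|).
  by apply: moderate_le => e; rewrite normr_id.
split; first exact: mabs Xx.1.
apply/gclass_eq; [exact: mabs Xx.1|exact: mabs Xr.1|].
apply: negligible_le (represents_negligible Xx Xr) => e.
exact: ler_dist_dist.
Qed.

Lemma gmax_represents (X Y : RT) (x y : I0 R -> R) :
  represents X x -> represents Y y ->
  represents (gmax X Y) (fun e => Num.max (x e) (y e)).
Proof.
move=> Xx Yy; have Xr := gnetP X; have Yr := gnetP Y.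
have mabs z : moderate rho z -> moderate rho (fun e => `|z e|).
  by apply: moderate_le => e; rewrite normr_id.
have mD z w : moderate rho z -> moderate rho w -> moderate rho (z + w).
  move=> /asboolP mz /asboolP mw; apply/asboolP.
  exact: (@rpredD _ (moderate_pred rho)).
have mmax z w : moderate rho z -> moderate rho w ->
    moderate rho (fun e => Num.max (z e) (w e)).
  move=> /mabs mz /mabs mw; apply: moderate_le (mD _ _ mz mw) => e.
  rewrite [in leRHS]ger0_norm ?addr_ge0// [leRHS]/(`|z e| + `|w e|).
  by case: (leP (z e) (w e)) => _; rewrite ?lerDl ?lerDr.
split; first exact: mmax Xx.1 Yy.1.
apply/gclass_eq; [exact: mmax Xx.1 Yy.1|exact: mmax Xr.1 Yr.1|].
have nX := represents_negligible Xx Xr.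
have nY := represents_negligible Yy Yr.
have nabs (z : I0 R -> R) :
    negligible_net rho z -> negligible_net rho (fun e => `|z e|).
  by apply: negligible_le => e; rewrite normr_id.
have nD N (N0 : 0 < N) := bigO_powD (lexx N) (lexx N) (nabs _ nX N N0) (nabs _ nY N N0).
apply: negligible_le nD => e.
rewrite [in leRHS]ger0_norm ?addr_ge0//.
change (`|Num.max (x e) (y e) - Num.max (gnet X e) (gnet Y e)|
  <= `|x e - gnet X e| + `|y e - gnet Y e|).
have h1 := ler_norm (x e - gnet X e); have h2 := ler_norm (gnet X e - x e).
have h3 := ler_norm (y e - gnet Y e); have h4 := ler_norm (gnet Y e - y e).
rewrite (distrC (gnet X e)) in h2; rewrite (distrC (gnet Y e)) in h4.
have n1 := normr_ge0 (x e - gnet X e); have n2 := normr_ge0 (y e - gnet Y e).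
by rewrite ler_norml; case: (leP (x e) (y e)) => hxy;
  case: (leP (gnet X e) (gnet Y e)) => hXY; apply/andP; split; lra.
Qed.

End Classes.

Notation "X <=~ Y" := (gle X Y) (at level 70, no associativity) : ring_scope.
Notation "X <~ Y" := (glt X Y) (at level 70, no associativity) : ring_scope.

Section Points.
Context {R : realType} (rho : gauge R).
Local Notation RT := (gnum rho).

Definition enorm (n : nat) (x : 'rV[R]_n) : R :=
  Num.sqrt (\sum_(i < n) x 0 i ^+ 2).

Definition vmoderate (n : nat) (x : I0 R -> 'rV[R]_n) : Prop :=
  moderate rho (fun e => enorm (x e)).

(* Moderate nets of R^n modulo negligible ones are identified with rows of
   generalized numbers; see [vclass_eq] and [vclass_surj]. *)
Definition vclass (n : nat) (x : I0 R -> 'rV[R]_n) : 'rV[RT]_n :=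
  \row_i gclass rho (fun e => x e 0 i).

Definition vrepresents (n : nat) (X : 'rV[RT]_n) (x : I0 R -> 'rV[R]_n) : Prop :=
  vmoderate x /\ vclass x = X.

Lemma enorm_ge0 n (x : 'rV[R]_n) : 0 <= enorm x.
Proof. exact: sqrtr_ge0. Qed.

Lemma enorm_coord n (x : 'rV[R]_n) i : `|x 0 i| <= enorm x.
Proof.
rewrite -sqrtr_sqr; apply: ler_wsqrtr; rewrite (bigD1 i)//= lerDl.
by apply: sumr_ge0 => j _; exact: sqr_ge0.
Qed.

Lemma enorm_le_sum n (x : 'rV[R]_n) : enorm x <= \sum_(i < n) `|x 0 i|.
Proof.
have S0 : 0 <= \sum_(i < n) `|x 0 i| by apply: sumr_ge0.
rewrite -(ger0_norm S0) -sqrtr_sqr; apply: ler_wsqrtr.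
rewrite expr2 big_distrl /=; apply: ler_sum => i _.
rewrite -real_normK ?num_real// expr2; apply: ler_wpM2l => //.
by rewrite (bigD1 i)//= lerDl sumr_ge0.
Qed.

Lemma moderate_sum (I : Type) (s : seq I) (f : I -> I0 R -> R) :
  (forall i, moderate rho (f i)) -> moderate rho (fun e => \sum_(i <- s) f i e).
Proof.
move=> mf; apply/asboolP.
have -> : (fun e => \sum_(i <- s) f i e) = \sum_(i <- s) f i.
  by apply/funext => e; rewrite fct_sumE.
by apply: (@rpred_sum _ (moderate_pred rho)) => i _; exact/asboolP/mf.
Qed.

Lemma negligible_sum (I : Type) (s : seq I) (f : I -> I0 R -> R) :
  (forall i, negligible_net rho (f i)) ->
  negligible_net rho (fun e => \sum_(i <- s) f i e).
Proof.
move=> nf N N0; elim: s => [|i s IH].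
  have -> : (fun e => \sum_(i <- [::]) f i e) = 0.
    by apply/funext => e; rewrite big_nil.
  exact: bigO_pow0.
have -> : (fun e => \sum_(j <- i :: s) f j e)
    = (f i + (fun e => \sum_(j <- s) f j e)).
  by apply/funext => e; rewrite big_cons.
exact: (bigO_powD _ _ (nf i N N0) IH).
Qed.

Lemma vmoderateP n (x : I0 R -> 'rV[R]_n) :
  vmoderate x <-> forall i, moderate rho (fun e => x e 0 i).
Proof.
split=> [mx i|mx].
  apply: moderate_le mx => e.
  by rewrite (ger0_norm (enorm_ge0 _)); exact: enorm_coord.
have /moderate_sum ms : forall i, moderate rho (fun e => `|x e 0 i|).
  by move=> i; apply: moderate_le (mx i) => e; rewrite normr_id.
apply: moderate_le (ms (index_enum 'I_n)) => e.
by rewrite !ger0_norm ?enorm_ge0 ?sumr_ge0//; exact: enorm_le_sum.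
Qed.

Lemma vclass_eq n (x y : I0 R -> 'rV[R]_n) : vmoderate x -> vmoderate y ->
  vclass x = vclass y <-> negligible_net rho (fun e => enorm (x e - y e)).
Proof.
move=> /vmoderateP mx /vmoderateP my; split=> [/rowP h|h].
  have /negligible_sum ns : forall i,
      negligible_net rho (fun e => `|(x e - y e) 0 i|).
    move=> i; have := h i; rewrite !mxE => /(gclass_eq (mx i) (my i)).
    by apply: negligible_le => e; rewrite normr_id !mxE.
  apply: negligible_le (ns (index_enum 'I_n)) => e.
  by rewrite !ger0_norm ?enorm_ge0 ?sumr_ge0//; exact: enorm_le_sum.
apply/rowP => i; rewrite !mxE; apply/(gclass_eq (mx i) (my i)).
apply: negligible_le h => e; rewrite (ger0_norm (enorm_ge0 _)).
by have := enorm_coord (x e - y e) i; rewrite !mxE.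
Qed.

Lemma vclass_surj n (X : 'rV[RT]_n) : exists x, vrepresents X x.
Proof.
exists (fun e => \row_i gnet (X 0 i) e); split.
  apply/vmoderateP => i; rewrite (_ : (fun e => _) = gnet (X 0 i)).
    by have [] := gnetP (X 0 i).
  by apply/funext => e; rewrite mxE.
apply/rowP => i; rewrite mxE -[RHS](gnetP (X 0 i)).2; congr gclass.
by apply/funext => e; rewrite mxE.
Qed.

(* Iterated partial derivatives: multi-indices are words of coordinates,
   [:: i1; ...; ik] standing for d_i1 ... d_ik. *)
Definition dpart (n k : nat) (s : seq 'I_n) (f : 'rV[R]_n -> 'rV[R]_k) :
    'rV[R]_n -> 'rV[R]_k :=
  foldr (fun i g => 'D_(delta_mx 0 i) g) f s.

Definition smooth_on (n k : nat) (Om : set 'rV[R]_n)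
    (f : 'rV[R]_n -> 'rV[R]_k) : Prop :=
  forall (s : seq 'I_n) x, Om x ->
    {for x, continuous (dpart s f)} /\
    forall i, derivable (dpart s f) x (delta_mx 0 i).

(* The set <Om_e> of generalized points strongly inside the net Om. *)
Definition strong_int (n : nat) (Om : I0 R -> set 'rV[R]_n) : set 'rV[RT]_n :=
  [set X | forall x, vrepresents X x -> for_small (fun e => Om e (x e))].

(* The net fe on Om defines f on X. The functions fe are total, only their
   restrictions to Om matter. *)
Definition defines (n k : nat) (X : set 'rV[RT]_n)
    (f : 'rV[RT]_n -> 'rV[RT]_k) (Om : I0 R -> set 'rV[R]_n)
    (fe : I0 R -> 'rV[R]_n -> 'rV[R]_k) : Prop :=
  [/\ forall e, open (Om e) /\ smooth_on (Om e) (fe e),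
      X `<=` strong_int Om,
      forall x xe, X x -> vrepresents x xe ->
        vrepresents (f x) (fun e => fe e (xe e)) &
      forall x xe s, X x -> vrepresents x xe ->
        vmoderate (fun e => dpart s (fe e) (xe e))].

(* A map X -> Y is the restriction to X of a total function. *)
Definition GSF (n k : nat) (X : set 'rV[RT]_n) (Y : set 'rV[RT]_k)
    (f : 'rV[RT]_n -> 'rV[RT]_k) : Prop :=
  (forall x, X x -> Y (f x)) /\ exists Om fe, defines X f Om fe.

Definition on_line (A : set RT) : set 'rV[RT]_1 := [set x | A (x 0 0)].

Definition curve (k : nat) (f : RT -> 'rV[RT]_k) : 'rV[RT]_1 -> 'rV[RT]_k :=
  fun x => f (x 0 0).

Definition scalar (g : RT -> RT) : 'rV[RT]_1 -> 'rV[RT]_1 :=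
  fun x => const_mx (g (x 0 0)).

Definition gball (c r : RT) : set RT := [set x | gabs (x - c) <~ r].

Definition sharp_int (A : set RT) : set RT :=
  [set x | exists c r, [/\ 0 <~ r, gball c r x & gball c r `<=` A]].

(* y = [fe^(n)(xe)], for g defined on A by the net fe and x = [xe]. *)
Definition net_derivative (A : set RT) (n : nat) (g : RT -> RT) (x y : RT) :=
  exists Om fe, defines (on_line A) (scalar g) Om fe /\
    exists2 xe, represents x xe &
      represents y (fun e => dpart (nseq n ord0) (fe e) (const_mx (xe e)) 0 0).

(* At a sharply interior point of A the n-th derivative is computed on nets;
   at the remaining points it is the limit, in the sharp topology, along
   sharply interior points (the one-sided limit at an endpoint of an interval). *)
Definition is_gderiv (A : set RT) (n : nat) (g : RT -> RT) (x y : RT) : Prop :=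
  (sharp_int A x /\ net_derivative A n g x y) \/
  (~ sharp_int A x /\
   forall r, 0 <~ r -> exists2 s, 0 <~ s &
     forall x' y', sharp_int A x' -> gball x s x' ->
       net_derivative A n g x' y' -> gball y r y').

Definition gderiv (A : set RT) (n : nat) (g : RT -> RT) (x : RT) : RT :=
  xget 0 [set y | is_gderiv A n g x y].

Definition gcurve_deriv (A : set RT) (n d : nat) (u : RT -> 'rV[RT]_d) (t : RT) :
    'rV[RT]_d :=
  \row_i gderiv A n (fun s => u s 0 i) t.

(* For a < b one has a_e < b_e for e small, so that no orientation is needed. *)
Definition is_gint (a b : RT) (g : RT -> RT) (J : RT) : Prop :=
  exists Om fe, defines (on_line (gitv a b)) (scalar g) Om fe /\
    exists ae be, [/\ represents a ae, represents b be &
      represents J (fun e =>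
        \int[lebesgue_measure]_(t in `[ae e, be e]) fe e (const_mx t) 0 0)].

Definition gint (a b : RT) (g : RT -> RT) : RT :=
  xget 0 [set J | is_gint a b g J].

Section Variational.
Variable d : nat.
Implicit Types (a b p q r : RT) (u v eta : RT -> 'rV[RT]_d).

Definition GC_itv a b : set (RT -> 'rV[RT]_d) :=
  [set v | GSF (on_line (gitv a b)) [set: 'rV[RT]_d] (curve v)].

Definition GC0 a b : set (RT -> 'rV[RT]_d) :=
  [set eta | [/\ GSF (on_line [set: RT]) [set: 'rV[RT]_d] (curve eta),
                 eta a = 0 & eta b = 0]].

Definition GCbd a b (p q : 'rV[RT]_d) : set (RT -> 'rV[RT]_d) :=
  [set v | [/\ GC_itv a b v, v a = p & v b = q]].

Definition argmax_pt a b (w : RT -> RT) : RT :=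
  xget a [set t | gitv a b t /\ forall t', gitv a b t' -> w t' <=~ w t].

Definition argmin_pt a b (w : RT -> RT) : RT :=
  xget a [set t | gitv a b t /\ forall t', gitv a b t' -> w t <=~ w t'].

(* All the terms are nonnegative, so that the iterated maximum may start at 0. *)
Definition GCnorm a b (m : nat) v : RT :=
  \big[@gmax R rho/0]_(n < m.+1) \big[@gmax R rho/0]_(i < d)
    let w := gderiv (gitv a b) n (fun t => v t 0 i) in
    gmax (gabs (w (argmax_pt a b w))) (gabs (w (argmin_pt a b w))).

Definition GCball a b (m : nat) r u : set (RT -> 'rV[RT]_d) :=
  [set v | GC_itv a b v /\ GCnorm a b m (v - u) <~ r].

Definition local_minimizer a b (p q : 'rV[RT]_d)
    (I : (RT -> 'rV[RT]_d) -> RT) u : Prop :=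
  GCbd a b p q u /\
  exists r' m', 0 <~ r' /\
    forall v, GCball a b m' r' u v -> GCbd a b p q v -> I u <=~ I v.

(* d^n/ds^n I(u + s eta) at s = 0. *)
Definition gvariation (n : nat) (I : (RT -> 'rV[RT]_d) -> RT) u eta : RT :=
  gderiv [set: RT] n (fun s => I (fun t => u t + s *: eta t)) 0.

Definition lagrangian_GSF a b (F : RT -> 'rV[RT]_d -> 'rV[RT]_d -> RT) : Prop :=
  GSF [set z : 'rV[RT]_(1 + (d + d)) | gitv a b (lsubmx z 0 0)] [set: 'rV[RT]_1]
    (fun z => const_mx (F (lsubmx z 0 0) (lsubmx (rsubmx z)) (rsubmx (rsubmx z)))).

Definition gfunctional a b (F : RT -> 'rV[RT]_d -> 'rV[RT]_d -> RT) u : RT :=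
  gint a b (fun t => F t (u t) (gcurve_deriv (gitv a b) 1 u t)).

End Variational.

End Points.

(* Main.v *)
Require Import Defs.
From mathcomp Require Import all_boot all_order all_algebra generic_quotient.
From mathcomp Require Import ring_quotient ring lra.
From mathcomp Require Import all_classical all_reals all_analysis.

(** Let [eta] be an extension of [v - u] from [[a, b]] to a generalized smooth function on
    the whole line, and [psi s = I (u + s eta)]. The integral defining [psi] can be
    differentiated under the integral sign at each [e], so [psi] is a generalized smooth
    function of [s], defined by a net [psi_e], with [psi' 0 = 0] by stationarity. Taylor's
    formula with Lagrange remainder at each [e] gives [xi_e] in [[0, 1]] with
    [psi 1 = psi 0 + psi'' xi / 2], [xi = [xi_e]], and [psi'' xi] is the second variation at
    [u + xi eta], which lies in the same ball around [u] as [v]; hence both claims.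

    The extension is the delicate point: the derivatives of the net defining [v - u] are
    moderate on [[a, b]], but there need not be a moderate neighbourhood of [[a, b]] on which
    they all are. So the net is reflected at the endpoints, matching derivatives up to an
    order [n_e] that tends slowly to infinity as [e] goes to 0, and is then glued to the
    original net at a scale which may be chosen as small as one likes for each [e]. *)

Set Implicit Arguments.
Unset Strict Implicit.
Unset Printing Implicit Defensive.

Import Order.TTheory GRing.Theory Num.Theory.
Import numFieldNormedType.Exports.
Local Open Scope classical_set_scope.
Local Open Scope ring_scope.

(** * Nets and generalized numbers *)

(** The definitions quantify over defining nets and representatives, whereas the analysis takes
    place at a fixed [e]. Two principles mediate. First, a property that holds at every generalized
    point of an interval holds uniformly on the real intervals for [e] small, because
    counterexamples chosen one for each [e] would form a generalized point; this plays the role of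
    compactness. Second, the values of a generalized function determine all derivatives of its nets
    up to negligible errors: a function that is negligible on an interval and has a moderate second
    derivative has a negligible first derivative. Hence [gderiv] and [gint], defined by choosing a
    value, can be computed on any net and any representative. The extension has to be moderate at
    each fixed order only, for [e] small depending on that order. This leaves room for constants
    growing arbitrarily fast with the order: at [e] the orders up to [N e] are controlled, and [N]
    grows so slowly that the constant stays below [1 / rho e]. *)

Section Nets.
Variables (R : realType) (rho : gauge R).
Local Notation RT := (gnum rho).
Implicit Types (x y z : I0 R -> R) (X Y Z : RT).

(** [N e] is the largest [n] with [P n e] and [n * e <= 1], or 0 when there is none. The second
    condition makes a largest one exist and, at each fixed [n], holds for [e] small, so that [N]
    tends to infinity. *)
Lemma for_small_diagonal (P : nat -> I0 R -> Prop) :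
  (forall n, for_small (P n)) ->
  exists N : I0 R -> nat, for_small (fun e => P (N e) e) /\
    forall k, for_small (fun e => (k <= N e)%N).
Proof.
move=> hP.
have bnd (e : I0 R) n : `[< P n e >] && (n%:R * idx e <= 1) ->
    (n <= Num.bound (idx e)^-1)%N.
  have /andP[e0 _] := idxP e; move=> /andP[_ h].
  have h1 : n%:R <= (idx e)^-1 by rewrite -div1r ler_pdivlMr.
  have h2 := archi_boundP (le_trans (ler0n R n) h1).
  by rewrite -(@ler_nat R) (le_trans h1)// ltW.
have hN e : exists n, (forall k, P k e -> k%:R * idx e <= 1 -> (k <= n)%N) /\
    (P 0%N e -> P n e).
  case: (pselect (exists n, `[< P n e >] && (n%:R * idx e <= 1))) => [ex|nex].
    have [n /andP[/asboolP Pn _] max] := ex_maxnP ex (bnd e); exists n; split=> // k Pk ke.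
    by apply: max; rewrite ke andbT; exact/asboolP.
  exists 0%N; split=> // k Pk ke; exfalso; apply: nex; exists k.
  by rewrite ke andbT; exact/asboolP.
have [N HN] := choice hN; exists N; split.
  by apply: for_smallW (hP 0%N) => e; have [_] := HN e; exact.
move=> k; have k0 : 0 < (k.+1%:R : R)^-1 <= 1.
  by rewrite invr_gt0 ltr0Sn/= invf_le1 ?ltr0Sn// ler1n.
have hk : for_small (fun e : I0 R => k%:R * idx e <= 1).
  exists (MkI0 k0) => e /= ek; have /andP[e0 _] := idxP e.
  apply: le_trans (_ : k.+1%:R * idx e <= _).
    by rewrite ler_pM2r// ler_nat.
  by rewrite -ler_pdivlMl ?ltr0Sn// mulr1.
by apply: for_smallW (for_smallI hk (hP k)) => e [ke Pk]; have [h _] := HN e; exact: h.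
Qed.

Lemma for_small_forall (I : finType) (P : I -> I0 R -> Prop) :
  (forall i, for_small (P i)) -> for_small (fun e => forall i, P i e).
Proof.
move=> hP.
suff h (s : seq I) : for_small (fun e => forall i, i \in s -> P i e).
  by apply: for_smallW (h (enum I)) => e H i; apply: H; rewrite mem_enum.
elim: s => [|i s IH]; first exact: for_smallT.
apply: for_smallW (for_smallI (hP i) IH) => e [Pi Ps] j.
by rewrite inE => /predU1P[->|/Ps].
Qed.

Lemma gauge_lt (c : R) : 0 < c -> for_small (fun e => 0 < rho e < 1 /\ rho e < c).
Proof.
move=> c0; apply: for_smallW (for_smallI (gauge_small rho) (gauge_cvg rho c0)) => e.
by move=> [h1 /andP[_ h2]].
Qed.

(** One power of [rho] absorbs any constant. Thanks to this, negligibility, moderateness and both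
    orders are expressed below by integer powers without constants. *)
Lemma gauge_powM_le (C : R) n :
  for_small (fun e => 0 < rho e < 1 /\ C * rho e ^+ n.+1 <= rho e ^+ n).
Proof.
have C0 : 0 < (`|C| + 1)^-1 by rewrite invr_gt0 ltr_wpDl.
apply: for_smallW (gauge_lt C0) => e [/andP[r0 r1] rC]; rewrite r0 r1; split=> //.
rewrite exprS mulrA ler_piMl ?exprn_ge0 ?(ltW r0)//.
apply: le_trans (_ : (`|C| + 1) * rho e <= 1); first by rewrite ler_pM2r// ler_wpDr// ler_norm.
by rewrite -ler_pdivlMl ?mulr1 ?ltW// ltr_wpDl.
Qed.

Lemma negligible_netP x :
  negligible_net rho x <-> forall n, for_small (fun e => `|x e| <= rho e ^+ n).
Proof.
split=> [h n|h N N0].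
  have [C hC] := h n.+1%:R (ltr0Sn _ _).
  apply: for_smallW (for_smallI hC (gauge_powM_le C n)) => e [hx [/andP[r0 r1] hr]].
  by rewrite powR_mulrn ?(ltW r0)// in hx; exact: le_trans hx hr.
exists 1; have N1 : N <= (Num.bound N)%:R by rewrite ltW// archi_boundP// ltW.
apply: for_smallW (for_smallI (gauge_small rho) (h (Num.bound N))) => e.
move=> [/andP[r0 r1]] /le_trans; apply; rewrite mul1r -powR_mulrn ?(ltW r0)//.
by apply: ger_powR => //; rewrite r0 ltW.
Qed.

Lemma moderate_netP x :
  moderate rho x <-> exists n, for_small (fun e => `|x e| <= (rho e ^+ n)^-1).
Proof.
split=> [[N [N0 [C hC]]]|[n hn]].
  have N1 : N <= (Num.bound N)%:R by rewrite ltW// archi_boundP// ltW.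
  exists (Num.bound N).+1.
  apply: for_smallW (for_smallI hC (gauge_powM_le `|C| (Num.bound N))) => e.
  move=> [hx [/andP[r0 r1] hr]]; apply: le_trans hx _.
  have k0 k : 0 < rho e ^+ k by rewrite exprn_gt0.
  apply: le_trans (_ : `|C| * (rho e ^+ Num.bound N)^-1 <= _).
    apply: le_trans (_ : `|C| * rho e `^ (- N) <= _).
      by apply: ler_wpM2r; rewrite ?powR_ge0 ?ler_norm.
    apply: ler_wpM2l => //; rewrite -powR_mulrn ?(ltW r0)// -powRN.
    by apply: ger_powR; rewrite ?lerN2// r0 ltW.
  by rewrite -[leRHS]mul1r ler_pdivlMr// mulrAC ler_pdivrMr// mul1r.
exists n.+1%:R; split; first exact: ltr0Sn.
exists 1; apply: for_smallW (for_smallI (gauge_small rho) hn) => e [/andP[r0 r1]].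
move=> /le_trans; apply; rewrite mul1r powRN powR_mulrn ?(ltW r0)//.
by rewrite lef_pV2 ?posrE ?exprn_gt0// exprS ler_piMl ?exprn_ge0 ?ltW.
Qed.

Lemma fctBE x y e : (x - y) e = x e - y e.
Proof. by []. Qed.

Lemma moderate_rpred x : moderate rho x <-> x \in moderate_pred rho.
Proof. by split=> /asboolP. Qed.

Lemma moderateD x y : moderate rho x -> moderate rho y -> moderate rho (fun e => x e + y e).
Proof. by move=> /moderate_rpred mx /moderate_rpred my; apply/moderate_rpred; exact: rpredD. Qed.

Lemma moderateM x y : moderate rho x -> moderate rho y -> moderate rho (fun e => x e * y e).
Proof. by move=> /moderate_rpred mx /moderate_rpred my; apply/moderate_rpred; exact: rpredM. Qed.

Lemma moderateN x : moderate rho x -> moderate rho (fun e => - x e).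
Proof. by move=> /moderate_rpred mx; apply/moderate_rpred; rewrite -[X in X \in _]/(- x) rpredN. Qed.

Lemma moderate_small_le x y : for_small (fun e => `|x e| <= `|y e|) ->
  moderate rho y -> moderate rho x.
Proof.
move=> h /moderate_netP[n hn]; apply/moderate_netP; exists n.
by apply: for_smallW (for_smallI h hn) => e [/le_trans]; exact.
Qed.

Lemma negligible_moderate x : negligible_net rho x -> moderate rho x.
Proof.
move=> /negligible_netP h; apply/moderate_netP; exists 0%N.
by apply: for_smallW (h 0%N) => e; rewrite expr0 invr1.
Qed.

Lemma negligibleD x y : negligible_net rho x -> negligible_net rho y ->
  negligible_net rho (fun e => x e + y e).
Proof. by move=> hx hy N N0; exact: bigO_powD (lexx _) (lexx _) (hx _ N0) (hy _ N0). Qed.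

Lemma negligibleN x : negligible_net rho x -> negligible_net rho (fun e => - x e).
Proof. by apply: negligible_le => e; rewrite normrN. Qed.

Lemma negligible_small_le x y : for_small (fun e => `|x e| <= `|y e|) ->
  negligible_net rho y -> negligible_net rho x.
Proof.
move=> h /negligible_netP hy; apply/negligible_netP => n.
by apply: for_smallW (for_smallI h (hy n)) => e [/le_trans]; exact.
Qed.

Lemma negligibleM x y : moderate rho x -> negligible_net rho y ->
  negligible_net rho (fun e => x e * y e).
Proof.
move=> /moderate_netP[k hk] /negligible_netP hy; apply/negligible_netP => n.
apply: for_smallW (for_smallI (gauge_small rho) (for_smallI hk (hy (n + k)%N))) => e.
move=> [/andP[r0 _] [xe ye]]; rewrite normrM.
apply: le_trans (ler_pM _ _ xe ye) _ => //.
by rewrite exprD mulrA mulrAC mulVf ?mul1r// gt_eqF// exprn_gt0.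
Qed.

Lemma negligible_eq_small x y : for_small (fun e => x e = y e) ->
  negligible_net rho (x - y).
Proof.
move=> h; apply/negligible_netP => n.
apply: for_smallW (for_smallI (gauge_small rho) h) => e [/andP[r0 _] xy].
by rewrite fctBE xy subrr normr0 exprn_ge0 ?ltW.
Qed.

Lemma represents_gclass x : moderate rho x -> represents (gclass rho x) x.
Proof. by []. Qed.

Lemma represents_close X x y : represents X x -> negligible_net rho (x - y) -> represents X y.
Proof.
move=> [mx <-] nxy; have my : moderate rho y.
  apply: moderate_le (moderateD mx (moderateN (negligible_moderate nxy))) => e.
  by rewrite fctBE subKr.
by split=> //; apply/esym/gclass_eq.
Qed.

Lemma represents_eq_small X x y : represents X x -> for_small (fun e => x e = y e) ->
  represents X y.
Proof. by move=> h /negligible_eq_small; exact: represents_close. Qed.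

Lemma represents_uniq X Y x : represents X x -> represents Y x -> X = Y.
Proof. by move=> [_ <-] [_ <-]. Qed.

Lemma gclassE (x : mnet rho) : gclass rho x = \pi_RT%qT x.
Proof. by rewrite /gclass valKd. Qed.

Lemma represents_mnet X x : represents X x -> exists2 m : mnet rho, X = \pi_RT%qT m & mnet_val m = x.
Proof.
move=> [/moderate_rpred mx <-]; exists (Mnet mx) => //.
by rewrite -gclassE.
Qed.

Lemma mnet_represents (m : mnet rho) : represents (\pi_RT%qT m) m.
Proof. by split; [exact/asboolP/mnetP|exact: gclassE]. Qed.

Lemma representsD X Y x y : represents X x -> represents Y y ->
  represents (X + Y) (fun e => x e + y e).
Proof.
move=> /represents_mnet[m -> <-] /represents_mnet[n -> <-].
by rewrite -[_ + _](rmorphD (\pi_RT%qT : mnet rho -> RT)); exact: mnet_represents.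
Qed.

Lemma representsM X Y x y : represents X x -> represents Y y ->
  represents (X * Y) (fun e => x e * y e).
Proof.
move=> /represents_mnet[m -> <-] /represents_mnet[n -> <-].
by rewrite -[_ * _](rmorphM (\pi_RT%qT : mnet rho -> RT)); exact: mnet_represents.
Qed.

Lemma representsN X x : represents X x -> represents (- X) (fun e => - x e).
Proof.
move=> /represents_mnet[m -> <-].
by rewrite -[- _](rmorphN (\pi_RT%qT : mnet rho -> RT)); exact: mnet_represents.
Qed.

Lemma representsB X Y x y : represents X x -> represents Y y ->
  represents (X - Y) (fun e => x e - y e).
Proof. by move=> hx /representsN; exact: representsD. Qed.

Lemma represents0 : represents (0 : RT) (fun=> 0).
Proof.
rewrite -(rmorph0 (\pi_RT%qT : mnet rho -> RT)); exact: mnet_represents.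
Qed.

Lemma represents1 : represents (1 : RT) (fun=> 1).
Proof.
rewrite -(rmorph1 (\pi_RT%qT : mnet rho -> RT)); exact: mnet_represents.
Qed.

Lemma represents_exists X : exists x, represents X x.
Proof. by exists (gnet X); exact: gnetP. Qed.

(** The representatives in [gle] are existentially quantified, but any pair will do: an excess of
    [x] over [y] below every power of [rho] is removed by replacing [y] with the maximum of both,
    which still represents [Y]. *)
Lemma gleP X Y x y : represents X x -> represents Y y ->
  (X <=~ Y) <-> forall n, for_small (fun e => x e <= y e + rho e ^+ n).
Proof.
move=> Xx Yy; split=> [[x' [y' [Xx' Yy' xy]]] n|h].
  have /negligible_netP/(_ n.+1) hx := represents_negligible Xx Xx'.
  have /negligible_netP/(_ n.+1) hy := represents_negligible Yy' Yy.
  apply: for_smallW (for_smallI (gauge_powM_le 2 n) (for_smallI hx hy)) => e.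
  move=> [[_ hr] []] /(le_trans (ler_norm _)) h1 /(le_trans (ler_norm _)) h2.
  have := xy e; rewrite !fctBE in h1 h2 *; lra.
pose z e := Num.max (x e) (y e); exists x, z; split=> //; last first.
  by move=> e; rewrite le_max lexx.
apply: represents_close Yy _; apply/negligible_netP => n.
apply: for_smallW (for_smallI (gauge_small rho) (h n)) => e [/andP[r0 _] xy].
rewrite fctBE /z; case: (leP (x e) (y e)) => hxy.
  by rewrite subrr normr0 exprn_ge0// ltW.
by rewrite distrC gtr0_norm ?subr_gt0//; lra.
Qed.

Lemma gle_small X Y x y : represents X x -> represents Y y ->
  for_small (fun e => x e <= y e) -> X <=~ Y.
Proof.
move=> Xx Yy h; apply/(gleP Xx Yy) => n.
apply: for_smallW (for_smallI (gauge_small rho) h) => e [/andP[r0 _] /le_trans]; apply.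
by rewrite lerDl exprn_ge0// ltW.
Qed.

(** Invertibility keeps the difference away from 0 by a power of [rho]: if the inverse is at most
    [rho ^- k] and the difference were smaller than [rho ^ k.+1], their product would be at most
    [rho], yet it is 1 up to a negligible net. *)
Lemma gltP X Y x y : represents X x -> represents Y y ->
  (X <~ Y) <-> exists n, for_small (fun e => x e + rho e ^+ n <= y e).
Proof.
move=> Xx Yy; have D := representsB Yy Xx; split=> [[h0 [Z hZ]]|[n hn]].
  have [z Zz] := represents_exists Z.
  have /moderate_netP[k hk] := Zz.1.
  have /(gleP represents0 D) /(_ k.+1) h1 := h0.
  have P := representsM D Zz; rewrite hZ in P.
  have /negligible_netP/(_ 1%N) hn := represents_negligible represents1 P.
  exists k.+1.
  have r4 : 0 < (4^-1 : R) by [].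
  apply: for_smallW (for_smallI hk (for_smallI h1 (for_smallI hn (gauge_lt r4)))) => e.
  move=> [zk [xy [+ [/andP[r0 r1] r2]]]].
  rewrite fctBE expr1 => hp.
  rewrite leNgt; apply/negP => hlt.
  have rk0 : 0 < rho e ^+ k by rewrite exprn_gt0.
  have habs : `|y e - x e| <= rho e ^+ k * rho e.
    by rewrite -exprSr ler_norml; apply/andP; split; lra.
  have : `|(y e - x e) * z e| <= rho e.
    rewrite normrM; apply: le_trans (ler_pM _ _ habs zk) _ => //.
    by rewrite mulrAC mulfV ?mul1r// gt_eqF.
  move: hp; move: ((y e - x e) * z e) => w; rewrite !ler_norml => /andP[? ?] /andP[? ?].
  by clear hZ; lra.
split.
  apply: gle_small represents0 D _.
  apply: for_smallW (for_smallI (gauge_small rho) hn) => e [/andP[r0 _] h].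
  by rewrite subr_ge0; apply: le_trans h; rewrite lerDl exprn_ge0// ltW.
pose z e := (y e - x e)^-1.
have hD : for_small (fun e => 0 < rho e < 1 /\ rho e ^+ n <= y e - x e).
  by apply: for_smallW (for_smallI (gauge_small rho) hn) => e [? h]; split=> //; lra.
have mz : moderate rho z.
  apply/moderate_netP; exists n; apply: for_smallW hD => e [/andP[r0 _] h].
  have k0 : 0 < rho e ^+ n by rewrite exprn_gt0.
  by rewrite /z normfV gtr0_norm ?lef_pV2 ?posrE ?(lt_le_trans k0).
exists (gclass rho z); apply: represents_uniq (representsM D (represents_gclass mz)) _.
apply: represents_eq_small represents1 _; apply: for_smallW hD => e [/andP[r0 _] h].
have k0 : 0 < rho e ^+ n by rewrite exprn_gt0.
by rewrite /z mulfV// gt_eqF// (lt_le_trans k0).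
Qed.

Lemma glt0P X x : represents X x ->
  (0 <~ X) <-> exists n, for_small (fun e => rho e ^+ n <= x e).
Proof.
move=> /(gltP represents0) ->; split=> -[n h]; exists n; apply: for_smallW h => e;
  by rewrite add0r.
Qed.

Lemma gle_refl X : X <=~ X.
Proof. by have [x Xx] := represents_exists X; apply: (gle_small Xx Xx); exact: for_smallT. Qed.

Lemma gle_anti X Y : X <=~ Y -> Y <=~ X -> X = Y.
Proof.
have [x Xx] := represents_exists X; have [y Yy] := represents_exists Y.
move=> /(gleP Xx Yy) h1 /(gleP Yy Xx) h2.
apply: represents_uniq Xx _; apply: represents_close Yy _; apply/negligible_netP => n.
apply: for_smallW (for_smallI (h1 n) (h2 n)) => e [? ?].
by rewrite fctBE ler_norml; apply/andP; split; lra.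
Qed.

Lemma gle_lt_trans Y X Z : X <=~ Y -> Y <~ Z -> X <~ Z.
Proof.
have [x Xx] := represents_exists X; have [y Yy] := represents_exists Y.
have [z Zz] := represents_exists Z.
move=> /(gleP Xx Yy) h1 /(gltP Yy Zz)[n h2]; apply/(gltP Xx Zz); exists n.+1.
apply: for_smallW (for_smallI (gauge_powM_le 2 n) (for_smallI (h1 n.+1) h2)) => e.
by move=> [[_ ?] [? ?]]; lra.
Qed.

Lemma glt_le X Y : X <~ Y -> X <=~ Y.
Proof.
have [x Xx] := represents_exists X; have [y Yy] := represents_exists Y.
move=> /(gltP Xx Yy)[n h]; apply: (gle_small Xx Yy).
apply: for_smallW (for_smallI (gauge_small rho) h) => e [/andP[r0 _]].
by apply: le_trans; rewrite lerDl exprn_ge0// ltW.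
Qed.

Lemma glt_le_trans Y X Z : X <~ Y -> Y <=~ Z -> X <~ Z.
Proof.
have [x Xx] := represents_exists X; have [y Yy] := represents_exists Y.
have [z Zz] := represents_exists Z.
move=> /(gltP Xx Yy)[n h1] /(gleP Yy Zz) h2; apply/(gltP Xx Zz); exists n.+1.
apply: for_smallW (for_smallI (gauge_powM_le 2 n) (for_smallI h1 (h2 n.+1))) => e.
by move=> [[_ ?] [? ?]]; lra.
Qed.

Lemma clamp_represents a b X x y z : represents a x -> represents b y -> gle a X ->
  gle X b -> represents X z -> for_small (fun e => x e <= y e) ->
  represents X (fun e => Num.max (x e) (Num.min (z e) (y e))).
Proof.
move=> ax bx aX Xb Xz xy; apply: (represents_close Xz); apply/negligible_netP => n.
have h1 := (gleP ax Xz).1 aX n; have h2 := (gleP Xz bx).1 Xb n.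
apply: for_smallW (for_smallI (gauge_small rho) (for_smallI xy (for_smallI h1 h2))) => e.
move=> [/andP[r0 _] [h3 [h4 h5]]].
have := exprn_ge0 n (ltW r0) => ?.
rewrite fctBE ler_norml.
by case: (leP (z e) (y e)) => ?; case: (leP (x e) _) => ?; apply/andP; split; lra.
Qed.

Lemma gitv_represents a b X x y : represents a x -> represents b y ->
  for_small (fun e => x e <= y e) -> gitv a b X ->
  exists2 z, represents X z & for_small (fun e => x e <= z e <= y e).
Proof.
move=> ax bx xy [aX Xb]; have [z Xz] := represents_exists X.
exists (fun e => Num.max (x e) (Num.min (z e) (y e))); first exact: (clamp_represents ax bx aX Xb Xz xy).
apply: for_smallW xy => e h.
by rewrite le_max lexx/= ge_max h/= ge_min lexx orbT.
Qed.

Lemma represents_gitv a b X x y z : represents a x -> represents b y ->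
  represents X z -> for_small (fun e => x e <= z e <= y e) -> gitv a b X.
Proof.
move=> ax bx Xz h; split; [apply: gle_small ax Xz _|apply: gle_small Xz bx _];
  by apply: for_smallW h => e /andP[].
Qed.

Lemma moderate_between x y z : moderate rho x -> moderate rho y ->
  for_small (fun e => x e <= z e <= y e) -> moderate rho z.
Proof.
move=> mx my h; have mabs t : moderate rho t -> moderate rho (fun e => `|t e|).
  by apply: moderate_le => e; rewrite normr_id.
apply: moderate_small_le (moderateD (mabs _ mx) (mabs _ my)).
apply: for_smallW h => e /andP[h1 h2]; rewrite [leRHS]ger0_norm ?addr_ge0// ler_norml.
by have := ler_norm (y e); have := ler_norm (- x e); rewrite normrN;
  have := normr_ge0 (y e); have := normr_ge0 (x e) => *; apply/andP; split; lra.
Qed.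

Lemma moderate_pow n : moderate rho (fun e => rho e ^+ n).
Proof.
apply/moderate_netP; exists 0%N; apply: for_smallW (gauge_small rho) => e /andP[r0 r1].
by rewrite expr0 invr1 ger0_norm ?exprn_ge0 ?(ltW r0)// exprn_ile1 ?ltW.
Qed.

End Nets.

(** * Towers of derivatives *)

Section Towers.
Variable R : realType.

(** Smoothness is carried by the whole sequence of derivatives: sums, products, affine substitutions
    and gluings are then given by explicit formulas at every order, without iterating a derivation
    operator. *)
Definition tower (U : set R) (D : nat -> R -> R) : Prop :=
  forall k t, U t -> is_derive t (1 : R) (D k) (D k.+1 t).

Lemma is_derive_cont (f : R -> R) (t l : R) : is_derive t (1 : R) f l -> {for t, continuous f}.
Proof. by move=> [/derivable1_diffP/differentiable_continuous]. Qed.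

Lemma tower_cont U D k t : tower U D -> U t -> {for t, continuous (D k)}.
Proof. by move=> h /(h k); exact: is_derive_cont. Qed.

Lemma is_derive_line (V W : normedModType R) (f : V -> W) (a v : V) (t : R) :
  derivable f (t *: v + a) v ->
  is_derive t (1 : R) (fun s => f (s *: v + a)) ('D_v f (t *: v + a)).
Proof.
have E : (fun h : R => h^-1 *: (f ((h *: (1 : R) + t) *: v + a) - f (t *: v + a))) =
    (fun h : R => h^-1 *: (f (h *: v + (t *: v + a)) - f (t *: v + a))).
  by apply/funext => h; rewrite scalerDl addrA [h *: (1 : R)]mulr1.
move=> df; apply: DeriveDef; first by rewrite /derivable/= E.
by rewrite /derive/= E.
Qed.

Lemma is_derive_coord (V : normedModType R) (n : nat) (f : V -> 'rV[R]_n) x v df i :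
  is_derive x v f df -> is_derive x v (fun y => f y 0 i) (df 0 i).
Proof.
move=> [h <-]; apply: DeriveDef; first exact: (derivable_mxP f x v).1 h 0 i.
by rewrite derive_mx// mxE.
Qed.

Lemma is_derive_row (V : normedModType R) (n : nat) (f : V -> 'rV[R]_n) x v (df : 'rV[R]_n) :
  (forall i, is_derive x v (fun y => f y 0 i) (df 0 i)) -> is_derive x v f df.
Proof.
move=> h; have dfx : derivable f x v.
  by apply/derivable_mxP => i j; rewrite (ord1 i); have [] := h j.
apply: DeriveDef => //; rewrite derive_mx//; apply/matrixP => i j.
by rewrite mxE (ord1 i); exact: derive_val.
Qed.

Lemma const_mx1 (t : R) : const_mx t = t *: delta_mx 0 0 :> 'rV[R]_1.
Proof. by apply/rowP => i; rewrite !mxE (ord1 i) !eqxx mulr1. Qed.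

Lemma smooth_on_tower n (Om : set 'rV[R]_1) (f : 'rV[R]_1 -> 'rV[R]_n) i :
  smooth_on Om f ->
  tower [set t | Om (const_mx t)] (fun k t => dpart (nseq k ord0) f (const_mx t) 0 i).
Proof.
move=> sm k t Omt; apply: is_derive_coord => /=.
have [_ /(_ 0) dv] := sm (nseq k ord0) _ Omt.
rewrite [X in is_derive _ _ X](_ : _ =
  fun s : R => dpart (nseq k ord0) f (s *: delta_mx 0 0 + 0)); last first.
  by apply/funext => s; rewrite addr0 -const_mx1.
have := @is_derive_line _ _ (dpart (nseq k ord0) f) 0 (delta_mx 0 0) t.
by rewrite addr0 -const_mx1; apply.
Qed.

Lemma is_derive_head n (g : R -> 'rV[R]_n) (x : 'rV[R]_1) dg :
  is_derive (x 0 0) (1 : R) g dg ->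
  is_derive x (delta_mx 0 0 : 'rV[R]_1) (fun y => g (y 0 0)) dg.
Proof.
have E : (fun h : R => h^-1 *: (g ((h *: (delta_mx 0 0 : 'rV[R]_1) + x) 0 0) - g (x 0 0))) =
    (fun h : R => h^-1 *: (g (h *: (1 : R) + x 0 0) - g (x 0 0))).
  by apply/funext => h; rewrite !mxE !eqxx.
move=> [dv <-]; apply: DeriveDef; first by rewrite /derivable/= E.
by rewrite /derive/= E.
Qed.

Lemma open_head (U : set R) : open U -> open [set x : 'rV[R]_1 | U (x 0 0)].
Proof.
by move=> oU; apply: (open_comp _ oU) => x _; exact: coord_continuous.
Qed.

(** In dimension one a word of coordinates counts only through its length. *)
Lemma dpart_tower n (U : set R) (D : 'I_n -> nat -> R -> R) s (x : 'rV[R]_1) :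
  open U -> (forall i, tower U (D i)) -> U (x 0 0) ->
  dpart s (fun y : 'rV[R]_1 => \row_i D i 0%N (y 0 0)) x = \row_i D i (size s) (x 0 0).
Proof.
move=> oU tD; elim: s x => [//|j s IH] x Ux /=; rewrite (ord1 j).
have d1 : is_derive x (delta_mx 0 0 : 'rV[R]_1)
    (fun y : 'rV[R]_1 => \row_i D i (size s) (y 0 0)) (\row_i D i (size s).+1 (x 0 0)).
  apply: (@is_derive_head _ (fun t => \row_i D i (size s) t)); apply: is_derive_row => i.
  rewrite mxE [X in is_derive _ _ X](_ : _ = D i (size s)); first exact: tD.
  by apply/funext => y; rewrite mxE.
rewrite -(derive_val (is_derive := d1)); apply: near_eq_derive.
have := open_nbhs_nbhs (conj (open_head oU) Ux); apply: filterS => y; exact: IH.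
Qed.

Lemma tower_smooth_on n (U : set R) (D : 'I_n -> nat -> R -> R) :
  open U -> (forall i, tower U (D i)) ->
  smooth_on [set x | U (x 0 0)] (fun y : 'rV[R]_1 => \row_i D i 0%N (y 0 0)).
Proof.
move=> oU tD s x Ux.
have nU := open_nbhs_nbhs (conj (open_head oU) Ux).
have E : {near x, (fun x : 'rV[R]_1 => \row_i D i (size s) (x 0 0)) =1
     dpart s (fun y : 'rV[R]_1 => \row_i D i 0%N (y 0 0))}.
  by apply: filterS nU => y Uy; rewrite (dpart_tower s oU tD Uy).
have d1 : is_derive (x 0 0) (1 : R) (fun t => \row_i D i (size s) t)
    (\row_i D i (size s).+1 (x 0 0)).
  apply: is_derive_row => i.
  rewrite mxE [X in is_derive _ _ X](_ : _ = D i (size s)); first exact: tD.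
  by apply/funext => y; rewrite mxE.
split; last first.
  move=> i; rewrite (ord1 i); apply: near_eq_derivable E _.
  by have [] := is_derive_head d1.
rewrite /prop_for /continuous_at -(nbhs_singleton E).
apply: cvg_trans (near_eq_cvg E) _.
apply: (@continuous_comp _ _ _ (fun y : 'rV[R]_1 => y 0 0) (fun t => \row_i D i (size s) t)).
  exact: coord_continuous.
by have [/derivable1_diffP/differentiable_continuous] := d1.
Qed.

End Towers.

(** * Generalized functions of one variable as nets of towers *)

Section GTowers.
Variables (R : realType) (rho : gauge R).
Local Notation RT := (gnum rho).

(* [D e k] is the [k]-th derivative on [Om e] of a net defining [g] on [A]. *)
Record gtower (A : set RT) (g : RT -> RT) (Om : I0 R -> set R)
    (D : I0 R -> nat -> R -> R) : Prop := GTower {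
  gtower_open : forall e, open (Om e);
  gtower_tower : forall e, tower (Om e) (D e);
  gtower_in : forall X x, A X -> represents X x -> for_small (fun e => Om e (x e));
  gtower_moderate : forall X x k, A X -> represents X x -> moderate rho (fun e => D e k (x e));
  gtower_val : forall X x, A X -> represents X x -> represents (g X) (fun e => D e 0%N (x e)) }.

Lemma vrepresentsP n (X : 'rV[RT]_n) (x : I0 R -> 'rV[R]_n) :
  vrepresents X x <-> forall i, represents (X 0 i) (fun e => x e 0 i).
Proof.
split=> [[/vmoderateP mx <-] i|h]; first by split; rewrite ?mxE.
split; first by apply/vmoderateP => i; have [] := h i.
by apply/rowP => i; rewrite mxE; have [] := h i.
Qed.

Lemma defines_gtower n (A : set RT) (v : RT -> 'rV[RT]_n) Om fe i :
  defines (on_line A) (curve v) Om fe ->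
  gtower A (fun t => v t 0 i) (fun e => [set t | Om e (const_mx t)])
    (fun e k t => dpart (nseq k ord0) (fe e) (const_mx t) 0 i).
Proof.
move=> [oOm inOm val mod].
have rep (X : RT) (x : I0 R -> R) : represents X x -> vrepresents (const_mx X : 'rV_1) (fun e => const_mx (x e)).
  by move=> h; apply/vrepresentsP => j; rewrite mxE; under eq_fun do rewrite mxE.
have onA X : A X -> on_line A (const_mx X) by rewrite /on_line/= mxE.
split.
- move=> e; apply: (open_comp _ (oOm e).1) => t _.
  rewrite (_ : const_mx = fun t : R => t *: (delta_mx 0 0 : 'rV[R]_1)).
    exact: scalel_continuous.
  by apply/funext => s; exact: const_mx1.
- by move=> e; apply: smooth_on_tower; exact: (oOm e).2.
- by move=> X x AX Xx; exact: inOm (onA _ AX) _ (rep _ _ Xx).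
- move=> X x k AX Xx; have := mod _ _ (nseq k ord0) (onA _ AX) (rep _ _ Xx).
  by move/vmoderateP; exact.
- move=> X x AX Xx; have := val _ _ (onA _ AX) (rep _ _ Xx).
  by move/vrepresentsP/(_ i); rewrite /curve mxE.
Qed.

Lemma gtower_defines n (A : set RT) (v : RT -> 'rV[RT]_n) Om (D : 'I_n -> _) :
  (forall e, open (Om e)) ->
  (forall X x, A X -> represents X x -> for_small (fun e => Om e (x e))) ->
  (forall i, gtower A (fun t => v t 0 i) Om (D i)) ->
  defines (on_line A) (curve v) (fun e => [set x | Om e (x 0 0)])
   (fun e x => \row_i D i e 0%N (x 0 0)).
Proof.
move=> oOm inOm h.
have tw e : forall i, tower (Om e) (fun k => D i e k) by move=> i; exact: gtower_tower (h i) e.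
split.
- by move=> e; split; [exact: open_head|exact: (tower_smooth_on (oOm e) (tw e))].
- by move=> X AX x /vrepresentsP/(_ 0) Xx; exact: (inOm _ _ AX Xx).
- move=> X x AX /vrepresentsP/(_ 0) Xx; apply: (vrepresentsP _ _).2 => i.
  by under eq_fun do rewrite mxE; exact: (gtower_val (h i) AX Xx).
- move=> X x s AX /vrepresentsP/(_ 0) Xx; apply/vmoderateP => i.
  apply: moderate_small_le (gtower_moderate (h i) (size s) AX Xx).
  apply: for_smallW (inOm _ _ AX Xx) => e Omx.
  by rewrite (dpart_tower s (oOm e) (tw e) Omx) mxE.
Qed.

Lemma gtower_sub A A' g g' Om D : A' `<=` A -> (forall X, A' X -> g X = g' X) ->
  gtower A g Om D -> gtower A' g' Om D.
Proof.
move=> AA gg [h1 h2 h3 h4 h5]; split=> //.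
- by move=> X x /AA; exact: h3.
- by move=> X x k /AA; exact: h4.
- by move=> X x A'X Xx; rewrite -gg//; apply: h5 => //; exact: AA.
Qed.

(** The coordinates of a curve come with separate nets, whereas a net for the curve has a single
    domain: the intersection, open because [I] is finite. *)
Lemma gtower_common (I : finType) (A : set RT) (g : I -> RT -> RT) :
  (forall i, exists Om D, gtower A (g i) Om D) ->
  exists U D, [/\ forall e, open (U e),
    forall X x, A X -> represents X x -> for_small (fun e => U e (x e)) &
    forall i, gtower A (g i) U (D i)].
Proof.
move=> h; have [Om hOm] := choice h; have {hOm h}[D hD] := choice hOm.
pose U e := \bigcap_(i in [set: I]) Om i e.
have oU e : open (U e).
  rewrite /U (_ : [set: I] = [set` finset.setT]); last first.
    by apply/seteqP; split=> i //= _; rewrite finset.inE.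
  rewrite bigcap_fset_set//=; elim/big_ind : _ => [|X Y|i _]; first exact: openT.
    exact: openI.
  by have [] := hD i.
have inU X x : A X -> represents X x -> for_small (fun e => U e (x e)).
  move=> AX Xx; have := for_small_forall (fun i => gtower_in (hD i) AX Xx).
  by apply: for_smallW => e H i _; exact: H.
exists U, D; split=> // i; split=> //.
- by move=> e k t Ht; have [_ + _ _ _] := hD i; apply; exact: Ht.
- by have [] := hD i.
- by have [] := hD i.
Qed.

Lemma GSF_curveP n (A : set RT) (v : RT -> 'rV[RT]_n) :
  GSF (on_line A) [set: 'rV[RT]_n] (curve v) <->
  forall i, exists Om D, gtower A (fun t => v t 0 i) Om D.
Proof.
split=> [[_ [Om [fe dfe]]] i|h].
  by eexists; eexists; exact: defines_gtower dfe.
have [U [D [oU inU gt]]] := gtower_common h.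
by split=> //; eexists; eexists; exact: (gtower_defines oU inU gt).
Qed.

Lemma net_derivativeP (A : set RT) n g X Y : A X ->
  net_derivative A n g X Y <->
  exists Om D, gtower A g Om D /\
    exists2 x, represents X x & represents Y (fun e => D e n (x e)).
Proof.
move=> AX; split=> [[Om [fe [dfe [xe Xx Yy]]]]|[Om [D [gt [x Xx Yy]]]]].
  have dfe' : defines (on_line A) (curve (fun t => const_mx (g t) : 'rV[RT]_1)) Om fe by [].
  have := defines_gtower 0 dfe'; under [X in gtower _ X]eq_fun do rewrite mxE.
  move=> gt; eexists; eexists; split; first exact: gt.
  by exists xe.
have [oOm tw inOm _ _] := gt.
eexists; eexists; split; first apply: (@gtower_defines 1 A (fun t => const_mx (g t)) Om (fun=> D)) => //.
  by move=> i; under [X in gtower _ X]eq_fun do rewrite mxE.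
exists x => //; apply: represents_eq_small Yy _.
apply: for_smallW (inOm _ _ AX Xx) => e Omx.
have Omx' : Om e ((const_mx (x e) : 'rV[R]_1) 0 0) by rewrite mxE.
by rewrite (dpart_tower (D := fun=> D e) (nseq n ord0) (oOm e) (fun=> tw e) Omx') !mxE size_nseq.
Qed.

End GTowers.

(** * Generalized functions on an interval *)

Section RealLemmas.
Variable R : realType.

Lemma within_itv_continuous (f : R -> R) (p q : R) :
  (forall t, p <= t <= q -> {for t, continuous f}) -> {within `[p, q], continuous f}.
Proof.
move=> h; apply: continuous_in_subspaceT => t; rewrite inE/= in_itv/=; exact: h.
Qed.

Lemma MVT_between (f df : R -> R) (s t : R) :
  (forall x, Num.min s t <= x <= Num.max s t -> is_derive x (1 : R) f (df x)) ->
  exists2 c, Num.min s t <= c <= Num.max s t & f s - f t = df c * (s - t).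
Proof.
have main (p q : R) : p <= q ->
  (forall x, p <= x <= q -> is_derive x (1 : R) f (df x)) ->
  exists2 c, p <= c <= q & f q - f p = df c * (q - p).
  move=> pq h; have [x|| c] := @MVT_segment _ f df p q pq.
  - rewrite in_itv/= => /andP[/ltW h1 /ltW h2]; apply: h; exact/andP.
  - by apply: within_itv_continuous => x /h /is_derive_cont.
  - by rewrite in_itv/=; exists c.
case: (leP s t) => st h; last by apply: main => //; exact: ltW.
have [c cst E] := main _ _ st h; exists c => //.
by rewrite -opprB E -mulrN opprB.
Qed.

(** A difference quotient of step [h] bounds [f1] by [(A + A) / h] at some point within [h] of [t],
    and going back to [t] costs at most [h * B]. The step is taken to the right or to the left,
    whichever stays in the interval. *)
Lemma derive_interpolation (f f1 f2 : R -> R) (p q h A B : R) :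
  0 < h -> p + h + h <= q ->
  (forall t, p <= t <= q -> is_derive t (1 : R) f (f1 t)) ->
  (forall t, p <= t <= q -> is_derive t (1 : R) f1 (f2 t)) ->
  (forall t, p <= t <= q -> `|f t| <= A) ->
  (forall t, p <= t <= q -> `|f2 t| <= B) ->
  forall t, p <= t <= q -> `|f1 t| <= (A + A) / h + h * B.
Proof.
move=> h0 hpq d1 d2 bA bB t ptq.
have [s [hs ps]] : exists s, `|s - t| = h /\ p <= s <= q.
  have [ht|ht] := leP t (p + h).
    exists (t + h); split; first by rewrite addrC addKr gtr0_norm.
    by move: ptq => /andP[? ?]; apply/andP; split; lra.
  exists (t - h); split; first by rewrite addrC addKr normrN gtr0_norm.
  by move: ptq => /andP[? ?]; apply/andP; split; lra.
have sub x c : p <= c <= q -> Num.min c t <= x <= Num.max c t -> p <= x <= q.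
  by move: ptq => /andP[? ?] /andP[? ?]; case: (leP c t) => ? /andP[? ?];
    apply/andP; split; lra.
have [c hc E1] := MVT_between (fun x hx => d1 x (sub x s ps hx)).
have pc := sub _ _ ps hc.
have [c' hc' E2] := MVT_between (fun x hx => d2 x (sub x c pc hx)).
have pc' := sub _ _ pc hc'.
have B0 : 0 <= B by exact: le_trans (bB _ pc').
have ct : `|c - t| <= h.
  have -> : h = `|s - t| by [].
  move: hc; case: (leP s t) => ? /andP[? ?].
    by rewrite !ler0_norm; lra.
  by rewrite !ger0_norm; lra.
have fc : `|f1 c| <= (A + A) / h.
  rewrite ler_pdivlMr// -hs -normrM -E1.
  by apply: le_trans (ler_normB _ _) _; apply: lerD; exact: bA.
have -> : f1 t = f1 c - (f1 c - f1 t) by ring.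
apply: le_trans (ler_normB _ _) _; apply: lerD => //.
by rewrite E2 normrM mulrC; apply: ler_pM => //; exact: bB.
Qed.

Lemma Rintegral_itv_le (f : R -> R) (p q M : R) : p <= q ->
  (forall t, p <= t <= q -> {for t, continuous f}) ->
  (forall t, p <= t <= q -> `|f t| <= M) ->
  `|\int[lebesgue_measure]_(t in `[p, q]) f t| <= (q - p) * M.
Proof.
move=> pq cf bf.
have intf : lebesgue_measure.-integrable `[p, q] (EFin \o f).
  by apply: continuous_compact_integrable; [exact: segment_compact|exact: within_itv_continuous].
apply: le_trans (le_normr_Rintegral _ intf) _ => //.
apply: le_trans (_ : \int[lebesgue_measure]_(t in `[p, q]) M <= _).
  apply: le_Rintegral => //.
  - by apply: continuous_compact_integrable; [exact: segment_compact|
      apply: within_itv_continuous => t /cf ct; exact: continuous_comp ct (@norm_continuous _ _ _)].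
  - by apply: continuous_compact_integrable; [exact: segment_compact|
      apply: within_itv_continuous => t _; exact: cst_continuous].
rewrite Rintegral_cst//= lebesgue_measure_itv/= lte_fin.
case: (ltgtP p q) pq => // [_ _|<- _]; first by rewrite /= mulrC.
by rewrite subrr !mulr0 mul0r.
Qed.

Lemma Rintegral_split (f : R -> R) (p x q : R) : p <= x <= q ->
  (forall t, p <= t <= q -> {for t, continuous f}) ->
  \int[lebesgue_measure]_(t in `[p, q]) f t =
  \int[lebesgue_measure]_(t in `[p, x]) f t + \int[lebesgue_measure]_(t in `[x, q]) f t.
Proof.
move=> /andP[px xq] cf.
have intf (s t : R) : p <= s -> t <= q -> lebesgue_measure.-integrable `[s, t] (EFin \o f).
  move=> ps tq; apply: continuous_compact_integrable; first exact: segment_compact.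
  apply: within_itv_continuous => y /andP[sy yt]; apply: cf.
  by rewrite (le_trans ps sy) (le_trans yt tq).
rewrite -(@Rintegral_itv_obnd_cbnd _ x).
  by rewrite -(@Rintegral_itvB _ f (BLeft p) (BRight q) x) ?bnd_simp ?intf// addrC subrK.
by apply: integrableS (intf x q px (lexx _)) => //; exact: subset_itv_oc_cc.
Qed.

Lemma Rintegral_itv_sub (f : R -> R) (p' p q q' M : R) : p' <= p -> p <= q -> q <= q' ->
  (forall t, p' <= t <= q' -> {for t, continuous f}) ->
  (forall t, p' <= t <= q' -> `|f t| <= M) ->
  `|\int[lebesgue_measure]_(t in `[p', q']) f t - \int[lebesgue_measure]_(t in `[p, q]) f t|
    <= ((p - p') + (q' - q)) * M.
Proof.
move=> h1 h2 h3 cf bf.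
have sub s t : p' <= s -> t <= q' -> forall x, s <= x <= t -> p' <= x <= q'.
  by move=> hs ht x /andP[? ?]; apply/andP; split; lra.
have h4 : p <= q' by lra.
rewrite (@Rintegral_split f p' p q') ?h1//.
rewrite (@Rintegral_split f p q q') ?h2//; last first.
  by move=> t ht; apply: cf; exact: (sub p q').
rewrite mulrDl [X in `|X|](_ : _ =
  \int[lebesgue_measure]_(t in `[p', p]) f t + \int[lebesgue_measure]_(t in `[q, q']) f t);
  last by ring.
apply: le_trans (ler_normD _ _) _; apply: lerD; apply: Rintegral_itv_le => // t ht.
- by apply: cf; exact: (sub p' p).
- by apply: bf; exact: (sub p' p).
- by apply: cf; apply: (sub q q') => //; lra.
- by apply: bf; apply: (sub q q') => //; lra.
Qed.

End RealLemmas.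

Section Intervals.
Variables (R : realType) (rho : gauge R).
Local Notation RT := (gnum rho).
Implicit Types (g : RT -> RT) (X Y : RT).

Lemma gtower_lin A g g' Om Om' D D' (c : RT) ce : represents c ce ->
  gtower A g Om D -> gtower A g' Om' D' ->
  gtower A (fun X => g X + c * g' X) (fun e => Om e `&` Om' e)
    (fun e k t => D e k t + ce e * D' e k t).
Proof.
move=> cc [h1 h2 h3 h4 h5] [k1 k2 k3 k4 k5]; split.
- by move=> e; apply: openI.
- move=> e k t [Ut Ut']; apply: is_deriveD; first exact: h2.
  by apply: (@is_deriveZ R R R (D' e k) (ce e)); exact: k2.
- by move=> X x AX Xx; apply: for_smallI; [exact: h3 Xx|exact: k3 Xx].
- move=> X x k AX Xx; apply: moderateD; first exact: h4 Xx.
  by apply: moderateM; [exact: cc.1|exact: k4 Xx].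
- move=> X x AX Xx; apply: representsD; first exact: h5 Xx.
  by apply: representsM => //; exact: k5 Xx.
Qed.

(* A point is chosen badly whenever possible, so that a property holding at every
   generalized point holds uniformly. *)
Lemma for_small_choice (T : Type) (t0 : T) (P : I0 R -> Prop) (Q B : I0 R -> T -> Prop) :
  for_small P -> (forall e, P e -> exists t, Q e t) ->
  (forall x, for_small (fun e => Q e (x e)) -> for_small (fun e => B e (x e))) ->
  for_small (fun e => forall t, Q e t -> B e t).
Proof.
move=> hP QP h.
have hx e : exists t, P e -> Q e t /\ ((exists2 s, Q e s & ~ B e s) -> ~ B e t).
  have [Pe|nPe] := pselect (P e); last by exists t0.
  have [[s Qs Bs]|H] := pselect (exists2 s, Q e s & ~ B e s).
    by exists s.
  by have [t Qt] := QP e Pe; exists t.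
have [x Hx] := choice hx.
have hQ : for_small (fun e => Q e (x e)) by apply: for_smallW hP => e /Hx[].
apply: for_smallW (for_smallI hP (h x hQ)) => e [/Hx[_ H] Bx] t Qt.
by apply: contrapT => Bt; apply: H => //; exists t.
Qed.

Lemma gitv_uniform a b (ae be : I0 R -> R) (B : I0 R -> R -> Prop) :
  represents a ae -> represents b be -> for_small (fun e => ae e <= be e) ->
  (forall X x, gitv a b X -> represents X x -> for_small (fun e => B e (x e))) ->
  for_small (fun e => forall t, ae e <= t <= be e -> B e t).
Proof.
move=> aae bbe ab h; apply: (for_small_choice 0 ab) => [e abe|x hx].
  by exists (ae e); rewrite lexx.
have mx := moderate_between aae.1 bbe.1 hx.
have Xx : represents (gclass rho x) x by [].
exact: (h _ _ (represents_gitv aae bbe Xx hx) Xx).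
Qed.

(** Mean value theorem between the two representatives: the intermediate points represent [X] as
    well, so the next derivative is moderate there and its product with [x - x'] is negligible. The
    segments lie in the domains because a net of badly chosen points on them would represent [X]. *)
Lemma tower_net_eq_point X x x' (Om : I0 R -> set R) D k : (forall e, tower (Om e) (D e)) ->
  (forall y, represents X y -> for_small (fun e => Om e (y e))) ->
  (forall y, represents X y -> moderate rho (fun e => D e k.+1 (y e))) ->
  represents X x -> represents X x' -> negligible_net rho (fun e => D e k (x e) - D e k (x' e)).
Proof.
move=> tD inD mD Xx Xx'.
pose lo e := Num.min (x e) (x' e); pose hi e := Num.max (x e) (x' e).
have rep y : for_small (fun e => lo e <= y e <= hi e) -> represents X y.
  move=> h; apply: (represents_close Xx); apply: negligible_small_le (represents_negligible Xx Xx').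
  apply: for_smallW h => e; rewrite !fctBE /lo /hi.
  case: (leP (x e) (x' e)) => ? /andP[? ?].
    by rewrite !ler0_norm; lra.
  by rewrite !ger0_norm; lra.
have inOm : for_small (fun e => forall t, lo e <= t <= hi e -> Om e t).
  apply: (for_small_choice 0 (P := fun=> True)) => [|e _|y hy]; first exact: for_smallT.
    by exists (lo e); rewrite lexx/= /lo /hi ge_min le_max lexx.
  exact: (inD _ (rep _ hy)).
have hc e : exists c, (forall t, lo e <= t <= hi e -> Om e t) -> lo e <= c <= hi e /\
    D e k (x e) - D e k (x' e) = D e k.+1 c * (x e - x' e).
  have [H|] := pselect (forall t, lo e <= t <= hi e -> Om e t); last by exists 0.
  have [c hc E] := MVT_between (fun t ht => tD e k t (H t ht)).
  by exists c => _.
have [c Hc] := choice hc.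
have Xc : represents X c by apply: rep; apply: for_smallW inOm => e /Hc[].
apply: negligible_small_le
  (negligibleM (mD _ Xc) (represents_negligible Xx Xx')).
by apply: for_smallW inOm => e /Hc[_ ->].
Qed.

Lemma gtower_eq_point A g Om D X x x' k : gtower A g Om D -> A X ->
  represents X x -> represents X x' -> negligible_net rho (fun e => D e k (x e) - D e k (x' e)).
Proof.
move=> gt AX; apply: (tower_net_eq_point (Om := Om)) => [e|y Xy|y Xy].
- exact: (gtower_tower gt (e := e)).
- exact: (gtower_in gt AX Xy).
- exact: (gtower_moderate gt k.+1 AX Xy).
Qed.

(** Independence of the representative comes for free from the moderate first derivative. *)
Lemma gtower_of_net (A : set RT) (Om : I0 R -> set R) D : (forall e, open (Om e)) ->
  (forall e, tower (Om e) (D e)) ->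
  (forall X x, A X -> represents X x -> for_small (fun e => Om e (x e))) ->
  (forall X x k, A X -> represents X x -> moderate rho (fun e => D e k (x e))) ->
  gtower A (fun X => gclass rho (fun e => D e 0%N (gnet X e))) Om D.
Proof.
move=> oO tD inD mD; split=> // X x AX Xx.
have h := represents_gclass (mD X _ 0%N AX (gnetP X)).
apply: (represents_close h); apply: (tower_net_eq_point (Om := Om)) (gnetP X) Xx => //.
- by move=> y Xy; exact: (inD _ _ AX Xy).
- by move=> y Xy; exact: (mD _ _ 1%N AX Xy).
Qed.

Section Itv.
Variables (a b : RT) (ae be : I0 R -> R).
Hypotheses (ab : a <~ b) (aae : represents a ae) (bbe : represents b be).

Lemma itv_gap : exists n, for_small (fun e => ae e + rho e ^+ n <= be e).
Proof. exact/(gltP aae bbe). Qed.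

Lemma itv_le : for_small (fun e => ae e <= be e).
Proof.
have [n h] := itv_gap; apply: for_smallW (for_smallI (gauge_small rho) h) => e.
by move=> [/andP[r0 _]]; apply: le_trans; rewrite lerDl exprn_ge0 ?ltW.
Qed.

Lemma gtower_itv_in g Om D : gtower (gitv a b) g Om D ->
  for_small (fun e => forall t, ae e <= t <= be e -> Om e t).
Proof.
by move=> gt; apply: (gitv_uniform aae bbe itv_le) => X x hX Xx; exact: (gtower_in gt hX Xx).
Qed.

Lemma gtower_itv_max g Om D k : gtower (gitv a b) g Om D ->
  exists x, for_small (fun e => ae e <= x e <= be e /\
    forall t, ae e <= t <= be e -> D e k t <= D e k (x e)).
Proof.
move=> gt; have h := for_smallI itv_le (gtower_itv_in gt).
have hx e : exists x, ae e <= be e /\ (forall t, ae e <= t <= be e -> Om e t) ->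
   ae e <= x <= be e /\ forall t, ae e <= t <= be e -> D e k t <= D e k x.
  have [[abe H]|] := pselect (ae e <= be e /\ forall t, ae e <= t <= be e -> Om e t);
    last by exists 0.
  have [|c] := @EVT_max _ (D e k) _ _ abe.
    by apply: within_itv_continuous => t /H; exact: tower_cont (gtower_tower gt (e := e)).
  rewrite in_itv/= => hc mx; exists c => _; split=> // t ht.
by have [x Hx] := choice hx; exists x; apply: for_smallW h => e /Hx.
Qed.

Lemma gtower_opp A g Om D : gtower A g Om D ->
  gtower A (fun X => - g X) Om (fun e k t => - D e k t).
Proof.
move=> [h1 h2 h3 h4 h5]; split=> //.
- by move=> e k t /(h2 e k) ?; apply: is_deriveN.
- by move=> X x k AX Xx; apply: moderateN; exact: h4 Xx.
- by move=> X x AX Xx; apply: representsN; exact: h5.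
Qed.

(** The extrema at each [e] form generalized points, where moderateness is known; this turns
    pointwise moderateness into one exponent for the whole interval. *)
Lemma gtower_itv_moderate g Om D k : gtower (gitv a b) g Om D ->
  exists n, for_small (fun e => forall t, ae e <= t <= be e -> `|D e k t| <= (rho e ^+ n)^-1).
Proof.
move=> gt.
have bound D' g' : gtower (gitv a b) g' Om D' ->
    exists n, for_small (fun e => forall t, ae e <= t <= be e -> D' e k t <= (rho e ^+ n)^-1).
  move=> gt'; have [x hx] := gtower_itv_max k gt'.
  have hx1 : for_small (fun e => ae e <= x e <= be e) by apply: for_smallW hx => e [].
  have Xx : represents (gclass rho x) x := represents_gclass (moderate_between aae.1 bbe.1 hx1).
  have /moderate_netP[n hn] := gtower_moderate gt' k (represents_gitv aae bbe Xx hx1) Xx.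
  exists n; apply: for_smallW (for_smallI hn hx) => e [h1 [_ h2]] t /h2 /le_trans; apply.
  exact: le_trans (ler_norm _) h1.
have [n1 h1] := bound _ _ gt; have [n2 h2] := bound _ _ (gtower_opp gt).
exists (n1 + n2)%N.
apply: for_smallW (for_smallI (gauge_small rho) (for_smallI h1 h2)) => e.
move=> [/andP[r0 r1] [H1 H2]] t ht.
have le n m : (rho e ^+ n)^-1 <= (rho e ^+ (n + m))^-1.
  rewrite lef_pV2 ?posrE ?exprn_gt0// exprD ler_piMr ?exprn_ge0 ?(ltW r0)//.
  by rewrite exprn_ile1 ?ltW.
rewrite ler_norml; apply/andP; split.
  by rewrite lerNl (le_trans (H2 t ht))// addnC.
exact: le_trans (H1 t ht) (le _ _).
Qed.

(** Induction on the order: the derivative of order [k + 1] is interpolated between the negligible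
    one of order [k] and the moderate one of order [k + 2]. *)
Lemma gtower0_itv_negligible g Om D k : (forall X, gitv a b X -> g X = 0) ->
  gtower (gitv a b) g Om D ->
  forall n, for_small (fun e => forall t, ae e <= t <= be e -> `|D e k t| <= rho e ^+ n).
Proof.
move=> g0 gt; elim: k => [|k IH] n.
  apply: (gitv_uniform aae bbe itv_le) => X x hX Xx.
  have := gtower_val gt hX Xx; rewrite g0// => h0.
  have /negligible_netP/(_ n) := represents_negligible h0 (represents0 rho).
  by apply: for_smallW => e; rewrite fctBE subr0.
have [n0 gap] := itv_gap; have [M hM] := gtower_itv_moderate k.+2 gt.
(* The step is [rho ^ K]. The summand [n0 + 2] lets two steps fit in the interval, and [M + n] makes
   the term [rho ^ K / rho ^ M] small; using [IH] at [K + n + 2] turns the other term into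
   [2 * rho ^ (n + 2)]. *)
pose K := (n0 + M + n + 2)%N.
have r4 : 0 < (4^-1 : R) by [].
apply: for_smallW (for_smallI (gauge_lt rho r4) (for_smallI gap (for_smallI hM
  (for_smallI (gtower_itv_in gt) (IH (K + n + 2)%N))))) => e.
move=> [[/andP[r0 r1] r2] [gp [bM [inO bk]]]] t ht.
have p0 j : 0 < rho e ^+ j by rewrite exprn_gt0.
have pD i j : rho e ^+ (i + j) <= rho e ^+ i.
  by rewrite exprD ler_piMr ?(ltW (p0 _))// exprn_ile1 ?ltW.
have sub2 j : rho e ^+ (j + 2) <= rho e ^+ j / 16.
  rewrite exprD; apply: ler_wpM2l; first exact: ltW.
  by rewrite expr2; nra.
have hg : ae e + rho e ^+ K + rho e ^+ K <= be e.
  have := pD (n0 + 2)%N (M + n)%N; have := sub2 n0.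
  by rewrite addnAC addnA => ? ?; have := p0 n0; rewrite /K; lra.
have := @derive_interpolation _ (D e k) (D e k.+1) (D e k.+2) (ae e) (be e) _ _ _ (p0 K) hg
  (fun t ht => gtower_tower gt k (inO t ht)) (fun t ht => gtower_tower gt k.+1 (inO t ht)) bk bM t ht.
move=> /le_trans; apply.
have -> : rho e ^+ (K + n + 2) = rho e ^+ K * rho e ^+ (n + 2) by rewrite -exprD addnA.
have -> : rho e ^+ K / rho e ^+ M = rho e ^+ (n0 + n + 2).
  by rewrite /K -!addnA (addnCA n0) exprD mulrAC mulfV ?mul1r// gt_eqF.
rewrite -mulrDr mulrAC mulfV ?mul1r ?gt_eqF//.
have -> : (n0 + n + 2 = n + 2 + n0)%N by rewrite -addnA addnC.
have := pD (n + 2)%N n0 => ?.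
have := sub2 n; have := p0 n; lra.
Qed.

Lemma gtower_itv_uniq g Om Om' D D' k : gtower (gitv a b) g Om D ->
  gtower (gitv a b) g Om' D' ->
  forall n, for_small (fun e => forall t, ae e <= t <= be e -> `|D e k t - D' e k t| <= rho e ^+ n).
Proof.
move=> gt gt' n.
have gt0 := gtower_lin (representsN (represents1 rho)) gt gt'.
have g0 X : gitv a b X -> g X + -1 * g X = 0 by rewrite mulN1r subrr.
apply: for_smallW (gtower0_itv_negligible k g0 gt0 n) => e h t /h.
by rewrite mulN1r.
Qed.

Lemma gtower_itv_close g Om Om' D D' k X x : gtower (gitv a b) g Om D ->
  gtower (gitv a b) g Om' D' -> gitv a b X -> represents X x ->
  negligible_net rho (fun e => D e k (x e) - D' e k (x e)).
Proof.
move=> gt gt' hX Xx; have [y Xy hy] := gitv_represents aae bbe itv_le hX.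
have n1 := gtower_eq_point k gt hX Xx Xy; have n2 := gtower_eq_point k gt' hX Xy Xx.
have n3 : negligible_net rho (fun e => D e k (y e) - D' e k (y e)).
  apply/negligible_netP => n; apply: for_smallW (for_smallI hy (gtower_itv_uniq k gt gt' n)) => e.
  by move=> [h]; exact.
apply: negligible_small_le (negligibleD n1 (negligibleD n3 n2)).
by apply: for_smallT => e; rewrite !subrKA.
Qed.

Lemma net_derivative_itv g Om D n X x Y : gtower (gitv a b) g Om D ->
  gitv a b X -> represents X x ->
  net_derivative (gitv a b) n g X Y <-> represents Y (fun e => D e n (x e)).
Proof.
move=> gt hX Xx; split=> [|hY].
  move=> /(net_derivativeP _ _ _ hX)[Om' [D' [gt' [x' Xx' Yy]]]].
  apply: (represents_close Yy).
  have n1 := gtower_eq_point n gt' hX Xx' Xx; have n2 := gtower_itv_close n gt' gt hX Xx.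
  apply: negligible_small_le (negligibleD n1 n2).
  by apply: for_smallT => e; rewrite subrKA.
by apply/(net_derivativeP _ _ _ hX); exists Om, D; split=> //; exists x.
Qed.

Lemma gabsB_lt X Y s (x y se : I0 R -> R) : represents X x -> represents Y y -> represents s se ->
  (gabs (X - Y) <~ s) <-> exists n, for_small (fun e => `|x e - y e| + rho e ^+ n <= se e).
Proof. by move=> Xx Yy ss; exact: gltP (gabs_represents (representsB Xx Yy)) ss. Qed.

(** Provides the limit that [is_gderiv] asks for at points which are not sharply interior. *)
Lemma gtower_itv_continuous g Om D n X x r : gtower (gitv a b) g Om D ->
  gitv a b X -> represents X x -> 0 <~ r ->
  exists2 s, 0 <~ s & forall X' x', gitv a b X' -> represents X' x' -> gball X s X' ->
    gabs (gclass rho (fun e => D e n (x' e)) - gclass rho (fun e => D e n (x e))) <~ r.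
Proof.
move=> gt hX Xx r0; have [y Xy hy] := gitv_represents aae bbe itv_le hX.
have [re rre] := represents_exists r; have [N hN] := (glt0P rre).1 r0.
have [M hM] := gtower_itv_moderate n.+1 gt.
have sM := represents_gclass (moderate_pow rho (N + M + 1)%N).
(* The next derivative is at most [rho ^- M], so this radius moves the derivative by at most
   [rho ^ N.+1], while [r] is at least [rho ^ N]. *)
exists (gclass rho (fun e => rho e ^+ (N + M + 1))).
  by apply/(glt0P sM); exists (N + M + 1)%N; exact: for_smallT.
move=> X' x' hX' Xx'; have [y' Xy' hy'] := gitv_represents aae bbe itv_le hX'.
move=> /(gabsB_lt Xy' Xy sM)[K hK].
have mD z Z : gitv a b Z -> represents Z z ->
    represents (gclass rho (fun e => D e n (z e))) (fun e => D e n (z e)).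
  by move=> hZ Zz; apply: represents_gclass; exact: (gtower_moderate gt n hZ Zz).
have H1 := represents_close (mD _ _ hX' Xx') (gtower_eq_point n gt hX' Xx' Xy').
have H2 := represents_close (mD _ _ hX Xx) (gtower_eq_point n gt hX Xx Xy).
apply/(gabsB_lt H1 H2 rre); exists N.+1.
have inOm := gtower_itv_in gt.
have small := for_smallI (gauge_powM_le rho 2 N) (for_smallI hN (for_smallI hM
 (for_smallI hy (for_smallI hy' (for_smallI hK inOm))))).
apply: for_smallW small => e.
move=> [[/andP[q0 q1] q2] [rN [bM [hye [hye' [hKe inO]]]]]].
have [|c hc ->] := @MVT_between _ (D e n) (D e n.+1) (y' e) (y e).
  move=> t ht; apply: (gtower_tower gt n); apply: inO.
  move: hye hye' ht => /andP[? ?] /andP[? ?].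
  by case: (leP (y' e) (y e)) => ? /andP[? ?]; apply/andP; split; lra.
have hce : ae e <= c <= be e.
  move: hye hye' hc => /andP[? ?] /andP[? ?].
  by case: (leP (y' e) (y e)) => ? /andP[? ?]; apply/andP; split; lra.
have p0 j : 0 < rho e ^+ j by rewrite exprn_gt0.
have hd : `|y' e - y e| <= rho e ^+ (N + M + 1) by have := p0 K; lra.
have : `|D e n.+1 c * (y' e - y e)| <= rho e ^+ N.+1.
  rewrite normrM; apply: le_trans (ler_pM _ _ (bM c hce) hd) _ => //.
  by rewrite addnAC addn1 exprD mulrCA mulVf ?mulr1// gt_eqF.
by lra.
Qed.

(** Makes the limits in [is_gderiv] unique: without interior points near [X] every value would be a
    limit. *)
Lemma sharp_int_dense X s : gitv a b X -> 0 <~ s ->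
  exists X', [/\ gitv a b X', sharp_int (gitv a b) X' & gball X s X'].
Proof.
move=> hX s0; have [y Xy hy] := gitv_represents aae bbe itv_le hX.
have [se sse] := represents_exists s; have [N hN] := (glt0P sse).1 s0.
have [n0 gap] := itv_gap; have [M hM] := (moderate_netP _ _).1 (moderateD bbe.1 (moderateN aae.1)).
pose K := (N + M + 1)%N.
(* A small move towards the midpoint: the displacement is at most [rho ^ (K - M)], that is
   [rho ^ N.+1], and the distance to both endpoints becomes at least [rho ^ (K + n0 + 1)]. *)
pose z e := y e + rho e ^+ K * ((ae e + be e) / 2 - y e).
have r4 : 0 < (4^-1 : R) by [].
have small := for_smallI (gauge_lt rho r4) (for_smallI hy (for_smallI gap hM)).
have hz : for_small (fun e => [/\ rho e < 4^-1, ae e + rho e ^+ (K + n0 + 1) <= z e,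
     z e <= be e - rho e ^+ (K + n0 + 1) & `|z e - y e| <= rho e ^+ N.+1]).
  apply: for_smallW small => e [[/andP[q0 q1] q2] [/andP[y1 y2] [gp mb]]].
  have p0 j : 0 < rho e ^+ j by rewrite exprn_gt0.
  have pK : rho e ^+ K <= 1 by rewrite exprn_ile1 ?ltW.
  have E : rho e ^+ (K + n0 + 1) <= rho e ^+ K * (be e - ae e) / 2.
    rewrite -addnA exprD -mulrA ler_pM2l// exprD expr1.
    have := p0 n0; nra.
  have := p0 K => ?; split=> //; rewrite /z.
  - by nra.
  - by nra.
  rewrite addrC addKr normrM gtr0_norm//.
  have : `|(ae e + be e) / 2 - y e| <= (rho e ^+ M)^-1.
    by apply: le_trans mb; rewrite [leRHS]ger0_norm; [rewrite ler_norml; apply/andP; split; lra|lra].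
  rewrite -(ler_pM2l (p0 M)) mulfV ?gt_eqF// => H.
  have -> : K = (N.+1 + M)%N by rewrite /K addnAC addn1.
  by rewrite exprD -mulrA -[leRHS]mulr1 ler_pM2l.
have mz : moderate rho z.
  apply: (moderate_between aae.1 bbe.1).
  apply: for_smallW (for_smallI (gauge_small rho) hz) => e [/andP[q0 _] [_ h1 h2 _]].
  by have ? := exprn_gt0 (K + n0 + 1)%N q0; apply/andP; split; lra.
have Zz := represents_gclass mz.
have KK := represents_gclass (moderate_pow rho (K + n0 + 1)%N).
have Kpos : 0 <~ gclass rho (fun e => rho e ^+ (K + n0 + 1)).
  by apply/(glt0P KK); exists (K + n0 + 1)%N; exact: for_smallT.
exists (gclass rho z); split.
- apply: (represents_gitv aae bbe Zz).
  apply: for_smallW (for_smallI (gauge_small rho) hz) => e [/andP[q0 _] [_ h1 h2 _]].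
  by have ? := exprn_gt0 (K + n0 + 1)%N q0; apply/andP; split; lra.
- exists (gclass rho z), (gclass rho (fun e => rho e ^+ (K + n0 + 1))); split=> //.
    apply/(gabsB_lt Zz Zz KK); exists (K + n0 + 1)%N.
    by apply: for_smallT => e; rewrite subrr normr0 add0r.
  move=> W; have [w Ww] := represents_exists W => /(gabsB_lt Ww Zz KK)[J hJ].
  apply: (represents_gitv aae bbe Ww).
  apply: for_smallW (for_smallI (gauge_small rho) (for_smallI hJ hz)) => e.
  move=> [/andP[q0 _] [h [_ h1 h2 _]]]; have := exprn_gt0 J q0.
  have := ler_norm (w e - z e); have := ler_norm (z e - w e); rewrite (distrC (z e)).
  by move=> *; apply/andP; split; lra.
- apply/(gabsB_lt Zz Xy sse); exists N.+1.
  apply: for_smallW (for_smallI (gauge_powM_le rho 2 N) (for_smallI hN hz)) => e.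
  by move=> [[_ ?] [? [_ _ _ ?]]]; lra.
Qed.

(** As [gderiv] is a choice, existence and uniqueness are both required. At sharply interior points
    they express independence of the net; elsewhere existence is sharp continuity, and another limit
    [Z] is compared with the value of the net at an interior point close to [X]. *)
Lemma represents_gderiv_itv g Om D n X x : gtower (gitv a b) g Om D ->
  gitv a b X -> represents X x ->
  represents (gderiv (gitv a b) n g X) (fun e => D e n (x e)).
Proof.
move=> gt hX Xx; pose Y := gclass rho (fun e => D e n (x e)).
have hY : represents Y (fun e => D e n (x e)).
  by apply: represents_gclass; exact: (gtower_moderate gt n hX Xx).
suff -> : gderiv (gitv a b) n g X = Y by [].
rewrite /gderiv; apply: xget_unique.
  have [iX|niX] := pselect (sharp_int (gitv a b) X).
    by left; split=> //; exact/(net_derivative_itv _ _ gt hX Xx).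
  right; split=> // r r0; have [s s0 hs] := gtower_itv_continuous n gt hX Xx r0.
  exists s => // X' Y' [c [r' [_ cX' /(_ _ cX') hX']]] bX'.
  have [x' Xx'] := represents_exists X'.
  move=> /(net_derivative_itv _ _ gt hX' Xx') hY'.
  have -> : Y' = gclass rho (fun e => D e n (x' e)) by case: hY'.
  exact: (hs X' x').
move=> Z [[iX]|[niX hZ]].
  by move=> /(net_derivative_itv _ _ gt hX Xx) hZ; exact: represents_uniq hZ hY.
have [z Zz] := represents_exists Z.
apply: (represents_uniq Zz); apply: (represents_close hY).
apply/negligible_netP => N.
have rN := represents_gclass (moderate_pow rho N.+1).
have rpos : 0 <~ gclass rho (fun e => rho e ^+ N.+1).
  by apply/(glt0P rN); exists N.+1; exact: for_smallT.
have [s s0 hs] := hZ _ rpos.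
have [s' s'0 hs'] := gtower_itv_continuous n gt hX Xx rpos.
have [se sse] := represents_exists s; have [n1 hn1] := (glt0P sse).1 s0.
have [se' sse'] := represents_exists s'; have [n2 hn2] := (glt0P sse').1 s'0.
have mm := represents_gclass (moderate_pow rho (n1 + n2)%N).
have mpos : 0 <~ gclass rho (fun e => rho e ^+ (n1 + n2)).
  by apply/(glt0P mm); exists (n1 + n2)%N; exact: for_smallT.
have [X' [hX' iX' bX']] := sharp_int_dense hX mpos.
have [x' Xx'] := represents_exists X'.
pose Y' := gclass rho (fun e => D e n (x' e)).
have hY' : represents Y' (fun e => D e n (x' e)).
  by apply: represents_gclass; exact: (gtower_moderate gt n hX' Xx').
have le1 : gclass rho (fun e => rho e ^+ (n1 + n2)) <=~ s.
  apply: (gle_small mm sse); apply: for_smallW (for_smallI (gauge_small rho) hn1) => e.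
  move=> [/andP[q0 q1]]; apply: le_trans.
  by rewrite exprD ler_piMr ?exprn_ge0 ?(ltW q0)// exprn_ile1 ?ltW.
have le2 : gclass rho (fun e => rho e ^+ (n1 + n2)) <=~ s'.
  apply: (gle_small mm sse'); apply: for_smallW (for_smallI (gauge_small rho) hn2) => e.
  move=> [/andP[q0 q1]]; apply: le_trans.
  by rewrite exprD ler_piMl ?exprn_ge0 ?(ltW q0)// exprn_ile1 ?ltW.
have /(gabsB_lt hY' Zz rN)[i hi] := hs X' Y' iX' (glt_le_trans bX' le1)
  ((net_derivative_itv _ _ gt hX' Xx').2 hY').
have /(gabsB_lt hY' hY rN)[j hj] := hs' X' x' hX' Xx' (glt_le_trans bX' le2).
apply: for_smallW (for_smallI (gauge_powM_le rho 2 N) (for_smallI hi hj)) => e.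
move=> [[/andP[q0 _] q1] [h1 h2]]; rewrite fctBE.
have := exprn_gt0 i q0; have := exprn_gt0 j q0 => ? ?.
have -> : D e n (x e) - z e = (D e n (x' e) - z e) - (D e n (x' e) - D e n (x e)) by ring.
by apply: le_trans (ler_normB _ _) _; lra.
Qed.

Lemma moderate_Rintegral g Om D : gtower (gitv a b) g Om D ->
  moderate rho (fun e => \int[lebesgue_measure]_(t in `[ae e, be e]) D e 0%N t).
Proof.
move=> gt; have [M hM] := gtower_itv_moderate 0 gt; have inOm := gtower_itv_in gt.
have [N hN] := (moderate_netP _ _).1 (moderateD bbe.1 (moderateN aae.1)).
apply/moderate_netP; exists (N + M)%N.
have small := for_smallI (gauge_small rho) (for_smallI itv_le (for_smallI hM (for_smallI hN inOm))).
apply: for_smallW small => e [/andP[q0 q1] [abe [bM [mb inO]]]].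
apply: le_trans (Rintegral_itv_le abe _ bM) _.
  by move=> t /inO; exact: tower_cont (gtower_tower gt (e := e)).
rewrite exprD invfM ler_pM ?subr_ge0 ?invr_ge0 ?exprn_ge0 ?(ltW q0)//.
exact: le_trans (ler_norm _) mb.
Qed.

End Itv.

(** Both intervals are enlarged to their hull, whose endpoints still represent [a] and [b]; on the
    hull the integrands are moderate and differ negligibly. *)
Lemma negligible_RintegralB a b (ae be ae' be' : I0 R -> R) g Om Om' D D' : a <~ b ->
  represents a ae -> represents b be -> represents a ae' -> represents b be' ->
  gtower (gitv a b) g Om D -> gtower (gitv a b) g Om' D' ->
  negligible_net rho (fun e => \int[lebesgue_measure]_(t in `[ae e, be e]) D e 0%N t -
    \int[lebesgue_measure]_(t in `[ae' e, be' e]) D' e 0%N t).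
Proof.
move=> ab.
have step (ae1 be1 lo hi : I0 R -> R) Om1 D1 : represents a ae1 -> represents b be1 ->
    represents a lo -> represents b hi ->
    (forall e, lo e <= ae1 e) -> (forall e, be1 e <= hi e) ->
    gtower (gitv a b) g Om1 D1 ->
    negligible_net rho (fun e => \int[lebesgue_measure]_(t in `[lo e, hi e]) D1 e 0%N t -
      \int[lebesgue_measure]_(t in `[ae1 e, be1 e]) D1 e 0%N t).
  move=> aa bb al bh la hb gt.
  have [M hM] := gtower_itv_moderate ab al bh 0 gt; have inOm := gtower_itv_in ab al bh gt.
  apply/negligible_netP => n.
  have nl := (negligible_netP _ _).1 (represents_negligible aa al) (n + M + 1)%N.
  have nh := (negligible_netP _ _).1 (represents_negligible bh bb) (n + M + 1)%N.
  have small := for_smallI (gauge_powM_le rho 2 n) (for_smallI (itv_le ab aa bb)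
    (for_smallI hM (for_smallI inOm (for_smallI nl nh)))).
  apply: for_smallW small => e [[/andP[q0 q1] q2] [abe [bM [inO [h1 h2]]]]].
  rewrite !fctBE in h1 h2.
  apply: le_trans (Rintegral_itv_sub (la e) abe (hb e) _ bM) _.
    by move=> t /inO; exact: tower_cont (gtower_tower gt (e := e)).
  apply: le_trans q2; rewrite ler_pdivrMr ?exprn_gt0// -mulrA -exprD.
  have -> : (n.+1 + M = n + M + 1)%N by rewrite addnAC addn1.
  have := le_trans (ler_norm _) h1; have := le_trans (ler_norm _) h2; lra.
move=> aa bb aa' bb' gt gt'.
pose lo e := Num.min (ae e) (ae' e); pose hi e := Num.max (be e) (be' e).
have al : represents a lo.
  apply: (represents_close aa); apply: negligible_small_le (represents_negligible aa aa').
  apply: for_smallT => e; rewrite !fctBE /lo.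
  by case: (leP (ae e) (ae' e)) => // _; rewrite subrr normr0.
have bh : represents b hi.
  apply: (represents_close bb); apply: negligible_small_le (represents_negligible bb bb').
  apply: for_smallT => e; rewrite !fctBE /hi.
  by case: (leP (be e) (be' e)) => // _; rewrite subrr normr0.
have n1 : negligible_net rho (fun e => \int[lebesgue_measure]_(t in `[lo e, hi e]) D e 0%N t -
      \int[lebesgue_measure]_(t in `[ae e, be e]) D e 0%N t).
  by apply: (step _ _ _ _ Om) => // e; rewrite /lo /hi ?ge_min ?le_max lexx.
have n2 : negligible_net rho (fun e => \int[lebesgue_measure]_(t in `[lo e, hi e]) D' e 0%N t -
      \int[lebesgue_measure]_(t in `[ae' e, be' e]) D' e 0%N t).
  by apply: (step _ _ _ _ Om') => // e; rewrite /lo /hi ?ge_min ?le_max lexx ?orbT.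
have n3 : negligible_net rho (fun e => \int[lebesgue_measure]_(t in `[lo e, hi e]) D e 0%N t -
      \int[lebesgue_measure]_(t in `[lo e, hi e]) D' e 0%N t).
  apply/negligible_netP => n.
  have inOm := gtower_itv_in ab al bh gt; have inOm' := gtower_itv_in ab al bh gt'.
  have [N hN] := (moderate_netP _ _).1 (moderateD bh.1 (moderateN al.1)).
  have hU := gtower_itv_uniq ab al bh 0 gt gt' (n + N)%N.
  have small := for_smallI (gauge_small rho) (for_smallI (itv_le ab al bh)
    (for_smallI inOm (for_smallI inOm' (for_smallI hU hN)))).
  apply: for_smallW small => e [/andP[q0 q1] [abe [inO [inO' [hUe hNe]]]]].
  have cD t : lo e <= t <= hi e -> {for t, continuous (D e 0%N)}.
    by move=> /inO; exact: tower_cont (gtower_tower gt (e := e)).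
  have cD' t : lo e <= t <= hi e -> {for t, continuous (D' e 0%N)}.
    by move=> /inO'; exact: tower_cont (gtower_tower gt' (e := e)).
  have int f : (forall t, lo e <= t <= hi e -> {for t, continuous f}) ->
      lebesgue_measure.-integrable `[lo e, hi e] (EFin \o f).
    move=> cf; apply: continuous_compact_integrable; first exact: segment_compact.
    exact: within_itv_continuous.
  rewrite -RintegralB ?int//.
  apply: le_trans (Rintegral_itv_le abe _ hUe) _.
    by move=> t ht; apply: continuousB; [exact: cD|exact: cD'].
  rewrite addnC exprD mulrA ler_piMl ?exprn_ge0 ?(ltW q0)//.
  rewrite -ler_pdivlMr ?exprn_gt0// div1r.
  exact: le_trans (ler_norm _) hNe.
apply: negligible_small_le (negligibleD (negligibleD n3 n2) (negligibleN n1)).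
by apply: for_smallT => e; rewrite le_eqVlt; apply/orP; left; apply/eqP; congr (`|_|); ring.
Qed.

Lemma represents_gint a b (ae be : I0 R -> R) g Om D : a <~ b ->
  represents a ae -> represents b be -> gtower (gitv a b) g Om D ->
  represents (gint a b g) (fun e => \int[lebesgue_measure]_(t in `[ae e, be e]) D e 0%N t).
Proof.
move=> ab aa bb gt.
have hJ := represents_gclass (moderate_Rintegral ab aa bb gt).
suff -> : gint a b g = gclass rho (fun e => \int[lebesgue_measure]_(t in `[ae e, be e]) D e 0%N t) by [].
rewrite /gint; apply: xget_unique.
  eexists; eexists; split.
    apply: (@gtower_defines _ _ 1 _ (fun t => const_mx (g t)) Om (fun=> D)).
    - exact: gtower_open gt.
    - by move=> X x hX Xx; exact: (gtower_in gt hX Xx).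
    - by move=> i; under [X in gtower _ X]eq_fun do rewrite mxE.
  exists ae, be; split=> //; apply: represents_eq_small hJ _; apply: for_smallT => e.
  by apply: eq_Rintegral => t _; rewrite !mxE.
move=> J [Om' [fe [dfe [ae' [be' [aa' bb' hJ']]]]]].
have dfe' : defines (on_line (gitv a b)) (curve (fun t => const_mx (g t) : 'rV[RT]_1)) Om' fe by [].
have := defines_gtower 0 dfe'; under [X in gtower _ X]eq_fun do rewrite mxE.
move=> gt'; apply: (represents_uniq hJ'); apply: (represents_close hJ).
exact: negligible_RintegralB gt gt'.
Qed.

(** Reduces questions at a point of the whole line to the results on intervals. *)
Lemma gtower_setT_near g Om D (X : RT) x : gtower [set: RT] g Om D -> represents X x ->
  [/\ X - 1 <~ X + 1, gitv (X - 1) (X + 1) X & gtower (gitv (X - 1) (X + 1)) g Om D].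
Proof.
move=> gt Xx; have Xm := representsB Xx (represents1 rho); have Xp := representsD Xx (represents1 rho).
split.
- apply/(gltP Xm Xp); exists 0%N; apply: for_smallT => e; rewrite expr0; lra.
- by apply: (represents_gitv Xm Xp Xx); apply: for_smallT => e; apply/andP; split; lra.
- exact: gtower_sub gt.
Qed.

Lemma net_derivative_setT g Om D n X x Y : gtower [set: RT] g Om D -> represents X x ->
  net_derivative [set: RT] n g X Y <-> represents Y (fun e => D e n (x e)).
Proof.
move=> gt Xx; have [ab hX gt1] := gtower_setT_near gt Xx; split=> [|hY].
  move=> /(net_derivativeP _ _ _ I)[Om' [D' [gt' H]]].
  have [_ _ gt1'] := gtower_setT_near gt' Xx.
  have Xm := representsB Xx (represents1 rho); have Xp := representsD Xx (represents1 rho).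
  apply/(net_derivative_itv ab Xm Xp _ _ gt1 hX Xx); apply/(net_derivativeP _ _ _ hX).
  by exists Om', D'.
by apply/(net_derivativeP _ _ _ I); exists Om, D; split=> //; exists x.
Qed.

Lemma represents_gderiv_setT g Om D n X x : gtower [set: RT] g Om D -> represents X x ->
  represents (gderiv [set: RT] n g X) (fun e => D e n (x e)).
Proof.
move=> gt Xx; pose Y := gclass rho (fun e => D e n (x e)).
have hY : represents Y (fun e => D e n (x e)).
  by apply: represents_gclass; exact: (gtower_moderate gt n I Xx).
suff -> : gderiv [set: RT] n g X = Y by [].
have iX : sharp_int [set: RT] X.
  have one0 : 0 <~ (1 : RT).
    by apply/(glt0P (represents1 rho)); exists 0%N; apply: for_smallT => e; rewrite expr0.
  exists X, 1; split=> //.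
  apply/(gabsB_lt Xx Xx (represents1 rho)); exists 0%N; apply: for_smallT => e.
  by rewrite subrr normr0 add0r expr0.
rewrite /gderiv; apply: xget_unique.
  by left; split=> //; exact/(net_derivative_setT _ _ gt Xx).
move=> Z [[_ /(net_derivative_setT _ _ gt Xx) hZ]|[]//].
exact: represents_uniq hZ hY.
Qed.

End Intervals.

(** * Composition with a curve *)

Section ChainRule.
Variable R : realType.

Lemma is_derive_cvgP (V W : normedModType R) (f : V -> W) (x v : V) (l : W) :
  (h^-1 *: (f (h *: v + x) - f x) @[h --> 0^'] --> l) <-> is_derive x v f l.
Proof.
split=> [h|[d <-]]; last exact: d.
by apply: DeriveDef; [apply/cvg_ex; exists l|exact: cvg_lim].
Qed.

Lemma rV_norm_coord n (x : 'rV[R]_n) i : `|x 0 i| <= `|x|.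
Proof. by rewrite [leRHS]/Num.Def.normr/= mx_normrE; exact: (le_bigmax _ _ (0, i)). Qed.

Lemma rV_norm_le n (x : 'rV[R]_n) (c : R) : 0 <= c -> (forall i, `|x 0 i| <= c) -> `|x| <= c.
Proof.
move=> c0 h; rewrite [leLHS]/Num.Def.normr/= mx_normrE.
by apply: bigmax_le => // -[i j] _ /=; rewrite (ord1 i).
Qed.

(** One coordinate is moved at a time: [tr j] has the first [j] coordinates of [w] and the others of
    [x]. For the maximum norm the whole path stays within [|w - x|] of [x]. *)
Lemma partial_mean_value n (x w : 'rV[R]_n) (B : set 'rV[R]_n) (phi : 'rV[R]_n -> R)
    (dphi : 'I_n -> 'rV[R]_n -> R) :
  (forall z, `|z - x| <= `|w - x| -> B z) ->
  (forall z i, B z -> is_derive z (delta_mx 0 i : 'rV[R]_n) phi (dphi i z)) ->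
  exists zeta : 'I_n -> 'rV[R]_n, (forall i, `|zeta i - x| <= `|w - x|) /\
    phi w - phi x = \sum_i dphi i (zeta i) * (w 0 i - x 0 i).
Proof.
move=> hB hphi.
pose tr (j : nat) : 'rV[R]_n := \row_i (if (i < j)%N then w 0 i else x 0 i).
have tr0 : tr 0%N = x by apply/rowP => i; rewrite mxE.
have trn : tr n = w by apply/rowP => i; rewrite mxE ltn_ord.
have trS (j : 'I_n) : tr j.+1 = (w 0 j - x 0 j) *: delta_mx 0 j + tr j.
  apply/rowP => i; rewrite !mxE eqxx/= ltnS leq_eqVlt.
  case: eqVneq => [/val_inj ->|ij]; first by rewrite ltnn eqxx mulr1 subrK.
  have -> : (i == j) = false by apply/negbTE; apply: contraNneq ij => ->.
  by rewrite mulr0 add0r.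
have step (j : 'I_n) : exists zeta : 'rV[R]_n, `|zeta - x| <= `|w - x| /\
    phi (tr j.+1) - phi (tr j) = dphi j zeta * (w 0 j - x 0 j).
  pose c := w 0 j - x 0 j.
  have near s : Num.min c 0 <= s <= Num.max c 0 ->
      `|s *: delta_mx 0 j + tr j - x| <= `|w - x|.
    move=> hs; apply: rV_norm_le => // i; rewrite !mxE eqxx/=.
    have hi : `|w 0 i - x 0 i| <= `|w - x| by have := rV_norm_coord (w - x) i; rewrite !mxE.
    case: eqVneq => [->|ij]; last first.
      by rewrite mulr0 add0r; case: ifP => // _; rewrite subrr normr0.
    rewrite ltnn mulr1 addrK; have := rV_norm_coord (w - x) j; rewrite !mxE -/c.
    apply: le_trans; move: hs; case: (leP c 0) => c0 /andP[h1 h2].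
      by rewrite !ler0_norm ?lerN2.
    by rewrite !ger0_norm ?(ltW c0).
  have [|s hs E] := @MVT_between _ (fun s => phi (s *: delta_mx 0 j + tr j))
    (fun s => dphi j (s *: delta_mx 0 j + tr j)) c 0.
    move=> s /near /hB /(hphi _ j) ds.
    rewrite -(derive_val (is_derive := ds)).
    by apply: (@is_derive_line _ _ _ phi (tr j)); case: ds.
  exists (s *: delta_mx 0 j + tr j); split; first exact: near.
  by move: E; rewrite scale0r add0r subr0 -trS.
have [zeta hz] := choice step; exists zeta; split; first by move=> i; have [] := hz i.
rewrite -trn -[in LHS]tr0 -(telescope_sumr (fun j => phi (tr j)) (leq0n n)) big_mkord.
by apply: eq_bigr => j _; rewrite (hz j).2 trn.
Qed.

(** [smooth_on] speaks only of partial derivatives and their continuity, so the chain rule is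
    derived from the mean value theorem in each coordinate rather than from a total differential. *)
Lemma is_derive_curve n (Om : set 'rV[R]_n) (phi : 'rV[R]_n -> R)
    (dphi : 'I_n -> 'rV[R]_n -> R) (gam : R -> 'rV[R]_n) (dgam : 'I_n -> R) (t : R) :
  open Om ->
  (forall z i, Om z -> is_derive z (delta_mx 0 i : 'rV[R]_n) phi (dphi i z)) ->
  (forall i, {for gam t, continuous (dphi i)}) ->
  Om (gam t) -> (forall i, is_derive t (1 : R) (fun s => gam s 0 i) (dgam i)) ->
  is_derive t (1 : R) (fun s => phi (gam s)) (\sum_i dphi i (gam t) * dgam i).
Proof.
move=> oOm hphi cphi Ot hgam.
have cgam : {for t, continuous gam}.
  have [/derivable1_diffP/differentiable_continuous] // :
    is_derive t (1 : R) gam (\row_i dgam i).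
  by apply: is_derive_row => i; rewrite mxE.
have [r /= r0 hr] := (nbhs_ballP _ _).1 (open_nbhs_nbhs (conj oOm Ot)).
pose w (h : R) := gam (h *: (1 : R) + t).
(* Outside the ball contained in [Om] the default [gam t] keeps the first bound valid for every [h],
   which gives the convergence of [z h i]. *)
have hz h : exists z : 'I_n -> 'rV[R]_n, (forall i, `|z i - gam t| <= `|w h - gam t|) /\
    (`|w h - gam t| < r -> phi (w h) - phi (gam t) =
      \sum_i dphi i (z i) * (w h 0 i - gam t 0 i)).
  have [hlt|hge] := ltP `|w h - gam t| r; last first.
    by exists (fun=> gam t); split=> // i; rewrite subrr normr0.
  have [|z [h1 h2]] := @partial_mean_value n (gam t) (w h) Om phi dphi _ hphi.
    move=> z hz; apply: hr; rewrite -ball_normE /ball_/= distrC.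
    exact: le_lt_trans hlt.
  by exists z.
have [z Hz] := choice hz.
have cw0 : {for (0 : R), continuous w}.
  apply: (@continuous_comp _ _ _ (fun h : R => h *: (1 : R) + t) gam).
    by apply: continuousD; [exact: scalel_continuous|exact: cst_continuous].
  by rewrite scale0r add0r.
have cw : w h @[h --> 0^'] --> gam t.
  apply: (@cvg_trans _ (w h @[h --> 0])).
    by move=> A; exact: nbhs_dnbhs.
  by have := cw0; rewrite /prop_for /continuous_at {2}/w scale0r add0r.
have cz i : z h i @[h --> 0^'] --> gam t.
  apply/cvgrPdist_le => e e0; move/cvgrPdist_le : cw => /(_ e e0).
  apply: filterS => h /=; rewrite distrC => hw; rewrite distrC.
  by apply: le_trans hw; have [] := Hz h.
apply/is_derive_cvgP.
have E : \forall h \near 0^', \sum_i dphi i (z h i) * (h^-1 *: (gam (h *: (1 : R) + t) 0 i - gam t 0 i)) =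
   h^-1 *: (phi (gam (h *: (1 : R) + t)) - phi (gam t)).
  have : \forall h \near 0^', `|w h - gam t| < r.
    move/cvgrPdist_lt : cw => /(_ r r0); apply: filterS => h /=; by rewrite distrC.
  apply: filterS => h hw; have Eh := (Hz h).2 hw; rewrite -/(w h) Eh scaler_sumr.
  by apply: eq_bigr => i _; rewrite [LHS]mulrCA.
apply: cvg_trans (near_eq_cvg E) _.
apply: cvg_big => [|i _]; first exact: add_continuous.
apply: cvgM; last exact/is_derive_cvgP.
exact: cvg_comp (cz i) (cphi i).
Qed.

Lemma is_derive_affine (c0 c1 s : R) : is_derive s (1 : R) (fun x => c0 + x * c1) c1.
Proof.
have H : is_derive s (1 : R) (cst c0 + (fun x : R => c1 *: x)) (0 + c1 *: (1 : R)).
  by apply: is_deriveD.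
have -> : (fun x : R => c0 + x * c1) = cst c0 + (fun x : R => c1 *: x).
  by apply/funext => x; rewrite [RHS]/(c0 + c1 * x) (mulrC x).
by rewrite add0r [c1 *: _]mulr1 in H.
Qed.

End ChainRule.

(* Polynomials in the iterated partial derivatives of a function along a curve ([PF s])
   and in the derivatives of the coordinates of the curve ([PG i k]); they are closed
   under differentiation along the curve. *)
Inductive pexpr (n : nat) : Type :=
  | PZero | PF of seq 'I_n | PG of 'I_n & nat | PAdd of pexpr n & pexpr n
  | PMul of pexpr n & pexpr n.
Arguments PZero {n}.

Section Pexpr.
Variable n : nat.

Fixpoint pder (E : pexpr n) : pexpr n :=
  match E with
  | PZero => PZero
  | PF s => foldr (fun i acc => PAdd (PMul (PF (i :: s)) (PG i 1)) acc) PZero (enum 'I_n)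
  | PG i k => PG i k.+1
  | PAdd E1 E2 => PAdd (pder E1) (pder E2)
  | PMul E1 E2 => PAdd (PMul (pder E1) E2) (PMul E1 (pder E2))
  end.

Definition pders k : pexpr n := iter k pder (PF [::]).

Variable R : realType.

Fixpoint pev (f : seq 'I_n -> R) (g : 'I_n -> nat -> R) (E : pexpr n) : R :=
  match E with
  | PZero => 0
  | PF s => f s
  | PG i k => g i k
  | PAdd E1 E2 => pev f g E1 + pev f g E2
  | PMul E1 E2 => pev f g E1 * pev f g E2
  end.

Lemma pev_pderF f g s : pev f g (pder (PF s)) = \sum_i f (i :: s) * g i 1%N.
Proof.
rewrite /= -big_enum/=; elim: (enum 'I_n) => [|i l IH]; first by rewrite big_nil.
by rewrite big_cons /= IH.
Qed.

Lemma is_derive_pev (f : R -> seq 'I_n -> R) (g : R -> 'I_n -> nat -> R) (t : R) E :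
  (forall s, is_derive t (1 : R) (f^~ s) (pev (f t) (g t) (pder (PF s)))) ->
  (forall i k, is_derive t (1 : R) (fun x => g x i k) (g t i k.+1)) ->
  is_derive t (1 : R) (fun x => pev (f x) (g x) E) (pev (f t) (g t) (pder E)).
Proof.
move=> hf hg; elim: E => [|s|i k|E1 h1 E2 h2|E1 h1 E2 h2].
- exact: is_derive_cst.
- exact: hf.
- exact: hg.
- exact: is_deriveD.
- rewrite [X in is_derive _ _ _ X](_ : _ = pev (f t) (g t) E1 *: pev (f t) (g t) (pder E2)
    + pev (f t) (g t) E2 *: pev (f t) (g t) (pder E1)); first exact: is_deriveM.
  by rewrite /= /GRing.scale/=; ring.
Qed.

Lemma continuous_pev (T : topologicalType) (f : T -> seq 'I_n -> R)
    (g : T -> 'I_n -> nat -> R) (x : T) E :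
  (forall s, {for x, continuous (f^~ s)}) ->
  (forall i k, {for x, continuous (fun y => g y i k)}) ->
  {for x, continuous (fun y => pev (f y) (g y) E)}.
Proof.
move=> hf hg; elim: E => [|s|i k|E1 h1 E2 h2|E1 h1 E2 h2].
- exact: cst_continuous.
- exact: hf.
- exact: hg.
- exact: continuousD.
- exact: continuousM.
Qed.

Lemma moderate_pev (rho : gauge R) (f : I0 R -> seq 'I_n -> R) (g : I0 R -> 'I_n -> nat -> R) E :
  (forall s, moderate rho (f^~ s)) -> (forall i k, moderate rho (fun e => g e i k)) ->
  moderate rho (fun e => pev (f e) (g e) E).
Proof.
move=> hf hg; elim: E => [|s|i k|E1 h1 E2 h2|E1 h1 E2 h2] //=.
- exact: moderate_cst.
- exact: moderateD.
- exact: moderateM.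
Qed.

End Pexpr.

(** * Derivatives of a composite, and differentiation under the integral sign *)

Section Composition.
Variable R : realType.

Definition curve_of n (G : 'I_n -> nat -> R -> R) (t : R) : 'rV[R]_n := \row_i G i 0%N t.

(** The formula of Faa di Bruno kept as an unexpanded expression: only its shape matters for
    differentiation, continuity and moderateness. [g i j] stands for the derivative of order [j] of
    the coordinate [i]. *)
Definition comp_deriv n (f : 'rV[R]_n -> 'rV[R]_1) (x : 'rV[R]_n) (g : 'I_n -> nat -> R) k : R :=
  pev (fun s => dpart s f x 0 0) g (pders n k).

Lemma is_derive_comp_deriv n (Om : set 'rV[R]_n) f (x : R -> 'rV[R]_n) (g : R -> 'I_n -> nat -> R) k t :
  open Om -> smooth_on Om f -> Om (x t) ->
  (forall i, is_derive t (1 : R) (fun s => x s 0 i) (g t i 1%N)) ->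
  (forall i k, is_derive t (1 : R) (fun s => g s i k) (g t i k.+1)) ->
  is_derive t (1 : R) (fun s => comp_deriv f (x s) (g s) k) (comp_deriv f (x t) (g t) k.+1).
Proof.
move=> oOm sm Ot hx hg; rewrite /comp_deriv /pders iterS.
apply: (is_derive_pev (f := fun s l => dpart l f (x s) 0 0)) => // l.
rewrite pev_pderF.
apply: (is_derive_curve (phi := fun z => dpart l f z 0 0)
  (dphi := fun i z => dpart (i :: l) f z 0 0) oOm) => // [z i Oz|i].
  apply: is_derive_coord; apply: derivableP.
  exact: (sm l z Oz).2 i.
have [c _] := sm (i :: l) _ Ot.
apply: (@continuous_comp _ _ _ (dpart (i :: l) f) (fun z : 'rV[R]_1 => z 0 0)) => //.
exact: coord_continuous.
Qed.

Lemma continuous_comp_deriv (T : topologicalType) n (Om : set 'rV[R]_n) f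
    (x : T -> 'rV[R]_n) (g : T -> 'I_n -> nat -> R) k (y : T) :
  smooth_on Om f -> Om (x y) -> {for y, continuous x} ->
  (forall i k, {for y, continuous (fun z => g z i k)}) ->
  {for y, continuous (fun z => comp_deriv f (x z) (g z) k)}.
Proof.
move=> sm Oy cx cg; apply: (continuous_pev (f := fun z l => dpart l f (x z) 0 0)) => // l.
apply: (@continuous_comp _ _ _ (fun z => dpart l f (x z)) (fun z : 'rV[R]_1 => z 0 0)).
  by apply: (@continuous_comp _ _ _ x (dpart l f)) => //; exact: (sm l _ Oy).1.
exact: coord_continuous.
Qed.

Lemma continuous_row (T : topologicalType) n (x : T -> 'rV[R]_n) (y : T) :
  (forall i, {for y, continuous (fun z => x z 0 i)}) -> {for y, continuous x}.
Proof.
move=> h; apply/cvgrPdist_le => e e0.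
have : \forall z \near y, forall i, `|x y 0 i - x z 0 i| <= e.
  apply: filter_forall => i; have /cvgrPdist_le := h i; exact.
apply: filterS => z hz; apply: rV_norm_le; first exact: ltW.
by move=> i; rewrite !mxE.
Qed.

(** The bound is a value of the integrand at a point of the interval, so that moderateness at
    generalized points applies to it. *)
Lemma Rintegral_mean_bound (f : R -> R) (p q : R) : p <= q ->
  (forall t, p <= t <= q -> {for t, continuous f}) ->
  exists2 c, p <= c <= q & `|\int[lebesgue_measure]_(t in `[p, q]) f t| <= (q - p) * `|f c|.
Proof.
move=> pq cf; have [|c] := @EVT_max _ (fun t => `|f t|) p q pq.
  apply: within_itv_continuous => t /cf ct; exact: continuous_comp ct (@norm_continuous _ _ _).
rewrite in_itv/= => hc mx; exists c => //; exact: Rintegral_itv_le.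
Qed.

Lemma is_derive_Rintegral (K K' : R -> R -> R) (p q s d : R) : p <= q -> 0 < d ->
  (forall s' t, `|s' - s| <= d -> p <= t <= q -> is_derive s' (1 : R) (K^~ t) (K' s' t)) ->
  (forall s' t, `|s' - s| <= d -> p <= t <= q -> {for t, continuous (K s')}) ->
  (forall s' t, `|s' - s| <= d -> p <= t <= q ->
     {for (s', t), continuous (fun z : R * R => K' z.1 z.2)}) ->
  is_derive s (1 : R) (fun s => \int[lebesgue_measure]_(t in `[p, q]) K s t)
    (\int[lebesgue_measure]_(t in `[p, q]) K' s t).
Proof.
move=> pq d0 dK cK cK'.
have hs' s' : s' \in `[s - d, s + d] -> `|s' - s| <= d.
  by rewrite in_itv/= => /andP[? ?]; rewrite ler_norml; apply/andP; split; lra.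
pose C := `[s - d, s + d] `*` `[p, q].
have cC : compact C by apply: compact_setX; exact: segment_compact.
have C0 : C !=set0.
  exists (s, p); split; rewrite /= in_itv/= ?lexx ?pq//.
  by apply/andP; split; lra.
(* The maximum over the compact rectangle is the constant dominating function; this is where joint
   continuity of [K'] enters. *)
have [|[c1 c2] Cc hM] := @compact_EVT_max _ R (fun z : R * R => `|K' z.1 z.2|) C C0 cC.
  apply: continuous_in_subspaceT => -[s' t]; rewrite inE => -[/= h1 h2].
  apply: (@continuous_comp _ _ _ (fun z : R * R => K' z.1 z.2)); last exact: norm_continuous.
  by apply: cK'; [exact: hs'|move: h2; rewrite in_itv].
pose M := `|K' c1 c2|.
have Iin s' : `]s - d, s + d[%classic s' -> `|s' - s| <= d.
  by move=> h; apply: hs'; exact: subset_itv_oo_cc.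
have intK s' : `]s - d, s + d[%classic s' ->
    lebesgue_measure.-integrable `[p, q] (EFin \o K s').
  move=> h; apply: continuous_compact_integrable; first exact: segment_compact.
  by apply: within_itv_continuous => t; apply: cK; exact: Iin.
have sI : `]s - d, s + d[%classic s by rewrite /= in_itv/=; apply/andP; split; lra.
have derK s' t : `]s - d, s + d[%classic s' -> `[p, q]%classic t -> derivable (K^~ t) s' 1.
  by move=> h; rewrite /= in_itv/= => ht; have [] := dK s' t (Iin _ h) ht.
have dE s' t : `]s - d, s + d[%classic s' -> `[p, q]%classic t -> partial1of2 K s' t = K' s' t.
  move=> h; rewrite /= in_itv/= => ht; rewrite partial1of2E.
  by have H := dK s' t (Iin _ h) ht; exact: derive_val.
have intM : lebesgue_measure.-integrable `[p, q] (EFin \o (fun=> M)).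
  apply: continuous_compact_integrable; first exact: segment_compact.
  by apply: within_itv_continuous => t _; exact: cst_continuous.
have ub s' t : `]s - d, s + d[%classic s' -> `[p, q]%classic t -> `|partial1of2 K s' t| <= M.
  move=> h ht; rewrite (dE _ _ h ht); apply: (hM (s', t)).
  by rewrite inE; split=> //=; exact: subset_itv_oo_cc.
have mB : measurable (`[p, q]%classic : set R) by exact: measurable_itv.
have dv := @derivable_under_integral R _ _ lebesgue_measure K _ mB s (s - d) (s + d)
  sI intK derK (fun=> M) (fun=> normr_ge0 _) intM ub.
have val := @differentiation_under_integral R _ _ lebesgue_measure K _ mB s (s - d) (s + d)
  sI intK derK (fun=> M) (fun=> normr_ge0 _) intM ub.
apply: DeriveDef => //; rewrite -derive1E val; apply: eq_Rintegral => t.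
by rewrite inE => ht; exact: dE.
Qed.

End Composition.

Section GeneralizedComposition.
Variables (R : realType) (rho : gauge R).
Local Notation RT := (gnum rho).

Lemma continuous_curve_of n (G : 'I_n -> nat -> R -> R) U t : (forall i, tower U (G i)) -> U t ->
  {for t, continuous (curve_of G)}.
Proof.
move=> tG Ut; apply: continuous_row => i.
rewrite [X in {for _, continuous X}](_ : _ = G i 0%N).
  exact: tower_cont (tG i) Ut.
by apply/funext => s; rewrite mxE.
Qed.

Lemma open_curve_preimage n (G : 'I_n -> nat -> R -> R) U (Om : set 'rV[R]_n) : open U -> open Om ->
  (forall i, tower U (G i)) -> open [set t | U t /\ Om (curve_of G t)].
Proof.
move=> oU oOm tG; rewrite openE => t [Ut Ot].
have h1 := open_nbhs_nbhs (conj oU Ut).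
have h2 := continuous_curve_of tG Ut (open_nbhs_nbhs (conj oOm Ot)).
by apply: filterS2 h1 h2 => s Us Os; split.
Qed.

Lemma gtower_comp n (A : set RT) (G : RT -> 'rV[RT]_n) U (Gam : 'I_n -> I0 R -> nat -> R -> R)
    Z f OmF Fe :
  (forall e, open (U e)) ->
  (forall X x, A X -> represents X x -> for_small (fun e => U e (x e))) ->
  (forall i, gtower A (fun t => G t 0 i) U (Gam i)) ->
  defines Z f OmF Fe -> (forall X, A X -> Z (G X)) ->
  gtower A (fun X => (f (G X) : 'rV[RT]_1) 0 0)
    (fun e => [set t | U e t /\ OmF e (curve_of (fun i => Gam i e) t)])
    (fun e k t => comp_deriv (Fe e) (curve_of (fun i => Gam i e) t) (fun i j => Gam i e j t) k).
Proof.
move=> oU inU gG [oF inF valF modF] hZ.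
have tG e : forall i, tower (U e) (fun k => Gam i e k) by move=> i; exact: gtower_tower (gG i) e.
have rep X x : A X -> represents X x ->
    vrepresents (G X) (fun e => curve_of (fun i => Gam i e) (x e)).
  move=> AX Xx; apply: (vrepresentsP _ _).2 => i; under eq_fun do rewrite mxE.
  exact: (gtower_val (gG i) AX Xx).
split.
- by move=> e; apply: open_curve_preimage (oU e) (oF e).1 (tG e).
- move=> e k t [Ut Ot]; apply: (is_derive_comp_deriv _ (oF e).1 (oF e).2 Ot) => [i|i j].
    rewrite [X in is_derive _ _ X](_ : _ = Gam i e 0%N); first exact: tG.
    by apply/funext => s; rewrite mxE.
  exact: tG.
- move=> X x AX Xx; apply: for_smallI; first exact: inU Xx.
  exact: inF (hZ _ AX) _ (rep _ _ AX Xx).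
- move=> X x k AX Xx; apply: moderate_pev => [s|i j].
    have := modF _ _ s (hZ _ AX) (rep _ _ AX Xx).
    by move/vmoderateP/(_ 0).
  exact: (gtower_moderate (gG i) j AX Xx).
- move=> X x AX Xx; have := valF _ _ (hZ _ AX) (rep _ _ AX Xx).
  by move/vrepresentsP/(_ 0).
Qed.

End GeneralizedComposition.

(** * Integrals depending on a parameter *)

Section ParametricIntegral.
Variables (R : realType) (rho : gauge R).
Local Notation RT := (gnum rho).

(** The argument of [f] is affine in the parameter, so differentiating in it involves no derivative
    of [G] or [H] in the integration variable. *)
Lemma gtower_parametric_integral a b n (G H : RT -> 'rV[RT]_n) U
    (Gam The : 'I_n -> I0 R -> nat -> R -> R) Z f OmF Fe :
  a <~ b -> (forall e, open (U e)) ->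
  (forall X x, gitv a b X -> represents X x -> for_small (fun e => U e (x e))) ->
  (forall i, gtower (gitv a b) (fun t => G t 0 i) U (Gam i)) ->
  (forall i, gtower (gitv a b) (fun t => H t 0 i) U (The i)) ->
  defines Z f OmF Fe ->
  (forall S t, gitv a b t -> Z (G t + S *: H t)) ->
  exists Om D, gtower [set: RT]
    (fun S => gint a b (fun t => (f (G t + S *: H t) : 'rV[RT]_1) 0 0)) Om D.
Proof.
move=> ab oU inU gG gH dF hZ; have [oF inF valF modF] := dF.
have [ae aae] := represents_exists a; have [be bbe] := represents_exists b.
pose gam e s := curve_of (fun i k t => Gam i e k t + s * The i e k t).
(* Derivatives in [s], at fixed [t], of the affine map [Gam + s * The]. *)
pose c e s t i (j : nat) :=
  match j with 0%N => Gam i e 0%N t + s * The i e 0%N t | 1%N => The i e 0%N t | _ => 0 end.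
pose K e k s t := comp_deriv (Fe e) (gam e s t) (c e s t) k.
pose good e := ae e <= be e /\ forall t, ae e <= t <= be e -> U e t.
(* Parameters whose whole curve lies in the domain of [Fe e]. The domain of the tower will be the
   interior of this set. *)
pose S0 e := [set s | good e /\ forall t, ae e <= t <= be e -> OmF e (gam e s t)].
pose D e k s := \int[lebesgue_measure]_(t in `[ae e, be e]) K e k s t.
have small_good : for_small good.
  apply: for_smallI (itv_le ab aae bbe) _.
  exact: (gitv_uniform aae bbe (itv_le ab aae bbe)).
have tGam e i : tower (U e) (Gam i e) := gtower_tower (gG i) (e:=e).
have tThe e i : tower (U e) (The i e) := gtower_tower (gH i) (e:=e).
have gamE e s t i : gam e s t 0 i = Gam i e 0%N t + s * The i e 0%N t by rewrite mxE.
have rep S s T t : represents S s -> gitv a b T -> represents T t ->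
    vrepresents (G T + S *: H T) (fun e => gam e (s e) (t e)).
  move=> Ss hT Tt; apply: (vrepresentsP _ _).2 => i; under eq_fun do rewrite gamE.
  rewrite !mxE; apply: representsD; first exact: (gtower_val (gG i) hT Tt).
  by apply: representsM => //; exact: (gtower_val (gH i) hT Tt).
have cgam2 e s t : U e t -> {for (s, t), continuous (fun z : R * R => gam e z.1 z.2)}.
  move=> Ut; apply: continuous_row => i.
  rewrite [X in {for _, continuous X}](_ : _ =
    fun z : R * R => Gam i e 0%N z.2 + z.1 * The i e 0%N z.2).
    2: by apply/funext => z; rewrite gamE.
  apply: continuousD.
    apply: (@continuous_comp _ _ _ snd (Gam i e 0%N)); first exact: cvg_snd.
    exact: tower_cont (tGam e i) Ut.
  apply: continuousM; first exact: cvg_fst.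
  apply: (@continuous_comp _ _ _ snd (The i e 0%N)); first exact: cvg_snd.
  exact: tower_cont (tThe e i) Ut.
have cc2 e s t i j : U e t -> {for (s, t), continuous (fun z : R * R => c e z.1 z.2 i j)}.
  move=> Ut; case: j => [|[|j]]; last exact: cst_continuous.
    rewrite [X in {for _, continuous X}](_ : _ = fun z : R * R => gam e z.1 z.2 0 i).
      apply: (@continuous_comp _ _ _ (fun z : R * R => gam e z.1 z.2) (fun y : 'rV[R]_n => y 0 i)).
        exact: cgam2.
      exact: coord_continuous.
    by apply/funext => z; rewrite gamE.
  apply: (@continuous_comp _ _ _ snd (The i e 0%N)); first exact: cvg_snd.
  exact: tower_cont (tThe e i) Ut.
have cK2 e k s t : U e t -> OmF e (gam e s t) ->
    {for (s, t), continuous (fun z : R * R => K e k z.1 z.2)}.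
  move=> Ut Ot.
  exact: (@continuous_comp_deriv R _ n (OmF e) (Fe e) (fun z : R * R => gam e z.1 z.2)
    (fun z => c e z.1 z.2) k (s, t) (oF e).2 Ot (cgam2 e s t Ut)
    (fun i j => cc2 e s t i j Ut)).
have cK e k s t : U e t -> OmF e (gam e s t) -> {for t, continuous (K e k s)}.
  move=> Ut Ot; apply: (@continuous_comp _ _ _ (fun t => (s, t)) (fun z : R * R => K e k z.1 z.2)).
    have h1 : s @[_ --> t] --> s by exact: cvg_cst.
    exact: (cvg_pair h1 (@cvg_id _ (nbhs t))).
  exact: cK2.
have dK e k s t : U e t -> OmF e (gam e s t) ->
    is_derive s (1 : R) (fun s => K e k s t) (K e k.+1 s t).
  move=> Ut Ot; apply: (is_derive_comp_deriv (x := fun s => gam e s t) (g := fun s => c e s t)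
    _ (oF e).1 (oF e).2 Ot) => [i|i [|[|j]]].
  - by under eq_fun do rewrite gamE; exact: is_derive_affine.
  - exact: is_derive_affine.
  - exact: is_derive_cst.
  - exact: is_derive_cst.
exists (fun e => interior (S0 e)), D; split.
- by move=> e; exact: open_interior.
- move=> e k s /nbhs_ballP[r /= r0 hr].
  have [[abe hU] _] : S0 e s by apply: hr; exact: ballxx.
  have hO s' t : `|s' - s| <= r / 2 -> ae e <= t <= be e -> OmF e (gam e s' t).
    move=> hs; have [_] : S0 e s'; last by apply.
    apply: hr; rewrite -ball_normE /ball_/= distrC (le_lt_trans hs)//.
    by rewrite ltr_pdivrMr// ltr_pMr// ltr1n.
  have r2 : 0 < r / 2 by rewrite divr_gt0.
  apply: (is_derive_Rintegral abe r2) => s' t hs ht.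
  + by apply: dK; [exact: hU|exact: hO].
  + by apply: cK; [exact: hU|exact: hO].
  + by apply: cK2; [exact: hU|exact: hO].
- move=> S s _ Ss.
  (* Bad choice over pairs of a parameter and a time: a parameter at distance at most 1 from [s] is
     again moderate, and [hZ] covers all generalized parameters. Hence the unit ball around [s e] is
     contained in [S0 e]. *)
  have H1 : for_small (fun e => forall z : R * R,
      `|z.1 - s e| <= 1 /\ ae e <= z.2 <= be e -> OmF e (gam e z.1 z.2)).
    apply: (for_small_choice ((0, 0) : R * R) (itv_le ab aae bbe)) => [e abe|z hz].
      by exists (s e, ae e); rewrite /= subrr normr0 lexx.
    have hz2 : for_small (fun e => ae e <= (z e).2 <= be e) by apply: for_smallW hz => e [].
    have mz1 : moderate rho (fun e => (z e).1).
      apply: (moderate_between (moderateD Ss.1 (moderate_cst rho (-1)))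
        (moderateD Ss.1 (moderate_cst rho 1))).
      by apply: for_smallW hz => e [+ _]; rewrite ler_distl.
    have Tt := represents_gclass (moderate_between aae.1 bbe.1 hz2).
    have hT := represents_gitv aae bbe Tt hz2.
    exact: inF (hZ _ _ hT) _ (rep _ _ _ _ (represents_gclass mz1) hT Tt).
  apply: for_smallW (for_smallI H1 small_good) => e [h hg].
  apply/nbhs_ballP; exists 1 => //= s'; rewrite -ball_normE /ball_/= distrC => hs.
  by split=> // t ht; apply: (h (s', t)); split=> //; exact: ltW.
- move=> S s k _ Ss.
  have H1 : for_small (fun e => forall t, ae e <= t <= be e -> OmF e (gam e (s e) t)).
    apply: (gitv_uniform aae bbe (itv_le ab aae bbe)) => T t hT Tt.
    exact: inF (hZ _ _ hT) _ (rep _ _ _ _ Ss hT Tt).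
  have hx e : exists x, good e /\ (forall t, ae e <= t <= be e -> OmF e (gam e (s e) t)) ->
      ae e <= x <= be e /\ `|D e k (s e)| <= (be e - ae e) * `|K e k (s e) x|.
    have [[[abe hU] hO]|] := pselect (good e /\
      (forall t, ae e <= t <= be e -> OmF e (gam e (s e) t))); last by exists 0.
    have [|x hx h] := @Rintegral_mean_bound _ (K e k (s e)) _ _ abe.
      by move=> t ht; apply: cK; [exact: hU|exact: hO].
    by exists x.
  have [x Hx] := choice hx.
  have hx1 : for_small (fun e => ae e <= x e <= be e).
    by apply: for_smallW (for_smallI small_good H1) => e /Hx[].
  have Tt := represents_gclass (moderate_between aae.1 bbe.1 hx1).
  have hT := represents_gitv aae bbe Tt hx1.
  have mK : moderate rho (fun e => K e k (s e) (x e)).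
    apply: moderate_pev => [l|i [|[|j]]].
    - have := modF _ _ l (hZ _ _ hT) (rep _ _ _ _ Ss hT Tt).
      by move/vmoderateP/(_ 0).
    - apply: moderateD; first exact: (gtower_moderate (gG i) 0 hT Tt).
      by apply: moderateM; [exact: Ss.1|exact: (gtower_moderate (gH i) 0 hT Tt)].
    - exact: (gtower_moderate (gH i) 0 hT Tt).
    - exact: moderate_cst.
  apply: moderate_small_le (moderateM (moderateD bbe.1 (moderateN aae.1)) mK).
  apply: for_smallW (for_smallI small_good H1) => e he.
  rewrite [in leRHS]normrM; apply: le_trans (Hx e he).2 _.
  by apply: ler_wpM2r => //; exact: ler_norm.
- move=> S s _ Ss.
  have gGS i : gtower (gitv a b) (fun t => (G t + S *: H t) 0 i) U
      (fun e k t => Gam i e k t + s e * The i e k t).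
    have := gtower_lin Ss (gG i) (gH i); under [X in gtower _ _ X]eq_fun do rewrite setIid.
    by apply: gtower_sub => // X _; rewrite !mxE.
  have gt := gtower_comp oU inU gGS dF (hZ S).
  exact: represents_gint ab aae bbe gt.
Qed.

End ParametricIntegral.

(** * Cutoff functions *)

Section SmoothClosure.
Variable R : realType.

Lemma is_derive_near (f g : R -> R) (t l : R) : (\forall x \near t, f x = g x) ->
  is_derive t (1 : R) g l -> is_derive t (1 : R) f l.
Proof. by move=> h; apply: near_eq_is_derive; apply: filterS h => x ->. Qed.

Lemma is_derive_near_cst (f : R -> R) (t c : R) : (\forall x \near t, f x = c) ->
  is_derive t (1 : R) f 0.
Proof. by move=> h; apply: (is_derive_near (g := fun=> c) h); exact: is_derive_cst. Qed.

Lemma tower_affine U (D : nat -> R -> R) (al be : R) : tower U D ->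
  tower [set x | U (al * x + be)] (fun k x => al ^+ k * D k (al * x + be)).
Proof.
move=> tD k x Ux.
have h1 : is_derive x (1 : R) (fun y => al * y + be) al.
  have := is_derive_affine be al x; congr is_derive.
  by apply/funext => y; rewrite addrC mulrC.
have h2 := @is_derive1_comp _ (D k) (fun y => al * y + be) x _ _ (tD k _ Ux) h1.
rewrite exprSr -mulrA (mulrC al).
by apply: (@is_deriveZ R R R (D k \o (fun y => al * y + be)) (al ^+ k)).
Qed.

Definition leibniz (X Y : nat -> R -> R) k x : R :=
  \sum_(i < k.+1) 'C(k, i)%:R * (X i x * Y (k - i)%N x).

Lemma tower_leibniz U (X Y : nat -> R -> R) : tower U X -> tower U Y -> tower U (leibniz X Y).
Proof.
move=> tX tY k x Ux.
have h (i : 'I_k.+1) : is_derive x (1 : R) (fun x => 'C(k, i)%:R * (X i x * Y (k - i)%N x))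
    ('C(k, i)%:R * (X i.+1 x * Y (k - i)%N x) + 'C(k, i)%:R * (X i x * Y (k - i).+1 x)).
  rewrite -mulrDr; apply: (@is_deriveZ R R R (fun x => X i x * Y (k - i)%N x) 'C(k, i)%:R).
  rewrite [X in is_derive _ _ _ X](_ : _ = X i x *: Y (k - i).+1 x + Y (k - i)%N x *: X i.+1 x).
    by apply: is_deriveM; [exact: tX|exact: tY].
  by rewrite /GRing.scale/= addrC (mulrC (Y _ _)).
have := is_derive_sum h; congr is_derive.
  by apply/funext => y; rewrite fct_sumE.
rewrite /leibniz big_split/= [RHS]big_ord_recl [in RHS]bin0 subn0.
(* Pascal's rule. *)
have -> : \sum_(i < k.+1) 'C(k.+1, lift ord0 i)%:R * (X (lift ord0 i) x * Y (k.+1 - lift ord0 i)%N x)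
  = \sum_(i < k.+1) 'C(k, i)%:R * (X i.+1 x * Y (k - i)%N x)
    + \sum_(i < k.+1) 'C(k, i.+1)%:R * (X i.+1 x * Y (k - i)%N x).
  rewrite -big_split/=; apply: eq_bigr => i _.
  by rewrite /bump leq0n add1n binS subSS natrD mulrDl addrC.
rewrite addrCA; congr (_ + _); rewrite big_ord_recl bin0 subn0.
congr (_ + _); rewrite big_ord_recr/= bin_small// mul0r addr0.
apply: eq_bigr => i _; rewrite /bump leq0n add1n.
by rewrite subnSK.
Qed.

(* A class of functions containing a derivative of each of its members consists of
   smooth functions; this one is moreover closed under inverses. *)
Inductive smooth_alg (U : set R) : (R -> R) -> Prop :=
  | Alg_base D k : tower U D -> smooth_alg U (D k)
  | Alg_add f g : smooth_alg U f -> smooth_alg U g -> smooth_alg U (fun x => f x + g x)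
  | Alg_mul f g : smooth_alg U f -> smooth_alg U g -> smooth_alg U (fun x => f x * g x)
  | Alg_inv f : smooth_alg U f -> (forall x, U x -> f x != 0) -> smooth_alg U (fun x => (f x)^-1).

Lemma smooth_alg_derive U f : smooth_alg U f ->
  exists2 f', smooth_alg U f' & forall x, U x -> is_derive x (1 : R) f (f' x).
Proof.
elim=> {f} [D k tD|f g _ [f' af' df] _ [g' ag' dg]|f g af [f' af' df] ag [g' ag' dg]|f af [f' af' df] f0].
- by exists (D k.+1); [exact: Alg_base|move=> x; exact: tD].
- exists (fun x => f' x + g' x); first exact: Alg_add.
  by move=> x Ux; apply: is_deriveD; [exact: df|exact: dg].
- exists (fun x => f x * g' x + g x * f' x).
    by apply: Alg_add; exact: Alg_mul.
  by move=> x Ux; apply: is_deriveM; [exact: df|exact: dg].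
- have cst_alg : smooth_alg U (fun=> -1).
    apply: (@Alg_base U (fun k => fun=> if k == 0%N then -1 else 0) 0) => k x _.
    by case: k => [|k] /=; exact: is_derive_cst.
  exists (fun x => (-1 * ((f x)^-1 * (f x)^-1)) * f' x).
    apply: Alg_mul => //; apply: Alg_mul => //.
    by apply: Alg_mul; exact: Alg_inv.
  move=> x Ux; have := is_deriveV (f0 x Ux) (df x Ux); congr is_derive.
  by rewrite /GRing.scale/= mulN1r expr2 invfM.
Qed.

Lemma smooth_alg_tower U f : smooth_alg U f -> exists2 D, tower U D & D 0%N = f.
Proof.
move=> af.
have hn (g : {f | smooth_alg U f}) : exists g' : {f | smooth_alg U f},
    forall x, U x -> is_derive x (1 : R) (sval g) (sval g' x).
  case: g => g ag; have [g' ag' dg] := smooth_alg_derive ag.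
  by exists (exist _ g' ag').
have [next Hnext] := choice hn.
exists (fun k => sval (iter k next (exist _ f af))) => // k x Ux.
exact: Hnext.
Qed.

(** With [y = 1 / x], the derivative of [P(y) exp(-y)] is [(P(y) - P'(y)) y^2 exp(-y)], so this
    family contains all derivatives of [exp(-1/x)]. *)
Definition flatexp (P : {poly R}) (x : R) : R :=
  if 0 < x then P.[x^-1] * expR (- x^-1) else 0.

(** This is the power [n] of the inequality [y / n <= exp (y / n)]. *)
Lemma pow_expRN_le n (y : R) : 0 < y -> y ^+ n * expR (- y) <= n%:R ^+ n.
Proof.
move=> y0; rewrite expRN ler_pdivrMr ?expR_gt0//.
case: n => [|n]; first by rewrite !expr0 mul1r (le_trans _ (expR_ge1Dx y))// lerDl ltW.
have n0 : 0 < n.+1%:R :> R by rewrite ltr0Sn.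
have -> : y = n.+1%:R * (y / n.+1%:R) by rewrite mulrCA mulfV ?mulr1// gt_eqF.
rewrite expRM_natl exprMn ler_wpM2l ?exprn_ge0 ?(ltW n0)//.
rewrite lerXn2r ?nnegrE ?expR_ge0 ?divr_ge0 ?(ltW y0) ?(ltW n0)//.
by apply: le_trans (expR_ge1Dx _); rewrite lerDr.
Qed.

(** Quadratic decay makes the derivative at the gluing point 0 vanish; the exponents [i + 2] pay for
    the factor [x ^ 2]. *)
Lemma flatexp_bound (P : {poly R}) : exists C, forall x, `|flatexp P x| <= C * x ^+ 2.
Proof.
exists (\sum_(i < size P) `|P`_i| * (i.+2%:R ^+ i.+2)) => x; rewrite /flatexp.
have [x0|x0] := ltP 0 x; last first.
  rewrite normr0; apply: mulr_ge0; last exact: sqr_ge0.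
  by apply: sumr_ge0 => i _; apply: mulr_ge0 => //; exact: exprn_ge0.
have y0 : 0 < x^-1 by rewrite invr_gt0.
rewrite horner_coef mulr_suml mulr_suml.
apply: le_trans (ler_norm_sum _ _ _) _; apply: ler_sum => i _.
have h : x^-1 ^+ (i + 2) * expR (- x^-1) <= i.+2%:R ^+ i.+2.
  by rewrite addn2; exact: pow_expRN_le.
move: (i.+2%:R ^+ i.+2) h => c h.
rewrite !normrM -!mulrA ler_wpM2l//.
rewrite (gtr0_norm (expR_gt0 _)) ger0_norm ?exprn_ge0 ?(ltW y0)//.
rewrite -ler_pdivrMr ?exprn_gt0//; apply: le_trans h.
by rewrite exprD [x^-1 ^+ 2]exprVn mulrAC.
Qed.

Lemma is_derive_quadratic (f : R -> R) (t C : R) :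
  (forall x, `|f x - f t| <= C * (x - t) ^+ 2) -> is_derive t (1 : R) f 0.
Proof.
move=> h; apply/is_derive_cvgP; apply/cvgrPdist_le => e e0.
have C0 : 0 < `|C| + 1 by rewrite ltr_wpDl.
apply/nbhs_ballP; exists (e / (`|C| + 1)) => /=; first by rewrite divr_gt0.
move=> y; rewrite -ball_normE /ball_/= sub0r normrN => hy y0.
rewrite sub0r normrN [_ *: _]/(y^-1 * _) [y *: _]mulr1 normrM normfV.
rewrite mulrC ler_pdivrMr ?normr_gt0//.
apply: le_trans (h _) _; rewrite addrK -real_normK ?num_real// expr2 mulrA.
apply: ler_wpM2r => //; apply: le_trans (_ : (`|C| + 1) * `|y| <= e).
  by apply: ler_wpM2r => //; rewrite ler_wpDr// ler_norm.
by move: hy; rewrite ltr_pdivlMr// mulrC => /ltW.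
Qed.

Definition flatexp_tower : nat -> R -> R :=
  fun k => flatexp (iter k (fun P => (P - P^`()) * 'X^2) 1).

Lemma flatexp_is_tower : tower [set: R] flatexp_tower.
Proof.
move=> k x _; rewrite /flatexp_tower iterS; move: (iter k _ _) => P.
have [x0|x0|x0] := ltgtP x 0.
- rewrite [flatexp ((_ - _) * _) _]/flatexp ltNge (ltW x0)/=.
  apply: (@is_derive_near_cst _ _ 0).
  have := open_nbhs_nbhs (conj (@open_lt _ 0) x0); apply: filterS => y y0.
  by rewrite /flatexp ltNge (ltW y0).
- have d1 : is_derive x (1 : R) (fun y : R => y^-1) (- x ^- 2 *: (1 : R)).
    by apply: (@is_deriveV R id x 1 1); rewrite gt_eqF.
  have d2 := is_derive1_comp (is_derive_poly P x^-1) d1.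
  have d3 := @is_derive1_comp _ expR (fun y => - y^-1) x _ _ (is_derive_expR _) (is_deriveN d1).
  have d4 := is_deriveM d2 d3.
  apply: (is_derive_near (g := (horner P \o (fun y => y^-1)) * (expR \o (fun y : R => - y^-1)))).
    by have := open_nbhs_nbhs (conj (@open_gt _ 0) x0); apply: filterS => y y0; rewrite /flatexp y0.
  move: d4; congr is_derive.
  rewrite /flatexp x0 /= /GRing.scale/= !hornerE/=.
  by field; rewrite gt_eqF.
- rewrite x0 [flatexp ((_ - _) * _) _]/flatexp ltxx.
  have [C hC] := flatexp_bound P; apply: (@is_derive_quadratic _ _ C) => y.
  by rewrite [flatexp P 0]/flatexp ltxx !subr0.
Qed.

Lemma tower_bounded (D : nat -> R -> R) k (p q : R) : p <= q -> tower [set: R] D ->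
  (forall x, x < p -> D k x = D k p) -> (forall x, q < x -> D k x = D k q) ->
  exists2 M, 0 <= M & forall x, `|D k x| <= M.
Proof.
move=> pq tD hp hq; have [|c _ mx] := @EVT_max _ (fun x => `|D k x|) p q pq.
  apply: within_itv_continuous => t _; apply: continuous_comp; last exact: norm_continuous.
  exact: (tower_cont tD).
exists `|D k c| => // x; have [xp|px] := ltP x p.
  by rewrite hp//; apply: mx; rewrite in_itv/= lexx.
have [qx|xq] := ltP q x; last by apply: mx; rewrite in_itv/= px.
by rewrite hq//; apply: mx; rewrite in_itv/= lexx andbT.
Qed.

Lemma tower_locally_cst (D : nat -> R -> R) (c : R) (U V : set R) : tower U D ->
  open V -> V `<=` U -> (forall x, V x -> D 0%N x = c) -> forall k x, V x -> D k.+1 x = 0.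
Proof.
move=> tD oV VU h k; elim: k => [|k IH] x Vx.
  have d1 := tD 0%N x (VU _ Vx).
  have d2 : is_derive x (1 : R) (D 0%N) 0.
    apply: (@is_derive_near_cst _ _ c).
    by apply: filterS (open_nbhs_nbhs (conj oV Vx)) => y /h.
  by rewrite -(derive_val (is_derive := d1)) (derive_val (is_derive := d2)).
have d1 := tD k.+1 x (VU _ Vx).
have d2 : is_derive x (1 : R) (D k.+1) 0.
  apply: (@is_derive_near_cst _ _ 0).
  by apply: filterS (open_nbhs_nbhs (conj oV Vx)) => y /IH.
by rewrite -(derive_val (is_derive := d1)) (derive_val (is_derive := d2)).
Qed.

(** The quotient [E (3/2 - 2x) / (E (2x - 1/2) + E (3/2 - 2x))]: replacing [x] by [1 - x] exchanges
    the two summands, whence the partition of unity. It is constant below 1/4 and above 3/4,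
    strictly inside the unit interval, so the derivatives vanish on the closed half-lines. *)
Lemma cutoff_exists : exists X : nat -> R -> R, tower [set: R] X /\
  [/\ (forall x, x <= 0 -> X 0%N x = 1), (forall k x, x <= 0 -> X k.+1 x = 0),
      (forall k x, 1 <= x -> X k x = 0), (forall x, X 0%N x + X 0%N (1 - x) = 1) &
      (forall k, exists2 M, 0 <= M & forall x, `|X k x| <= M)].
Proof.
pose E (x : R) := flatexp 1 x.
have E0 x : x <= 0 -> E x = 0 by move=> x0; rewrite /E /flatexp ltNge x0.
have Epos x : 0 < x -> 0 < E x by move=> x0; rewrite /E /flatexp x0 hornerE mul1r expR_gt0.
have Ege x : 0 <= E x.
  by have [/Epos/ltW //|/E0 ->] := ltP 0 x.
pose S x := E (2 * x + - (1/2)) + E (- 2 * x + (3/2)).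
have S0 x : S x != 0.
  rewrite gt_eqF// /S; have [h|h] := ltP (1/4) x.
    by rewrite ltr_pwDl ?Ege// Epos//; lra.
  by rewrite ltr_wpDl ?Ege// Epos//; lra.
have aE al be : smooth_alg [set: R] (fun x => E (al * x + be)).
  have := @Alg_base [set: R] _ 0%N (tower_affine (al := al) (be := be) flatexp_is_tower).
  by congr smooth_alg; apply/funext => x; rewrite expr0 mul1r.
have aX : smooth_alg [set: R] (fun x => E (- 2 * x + (3/2)) * (S x)^-1).
  by apply: Alg_mul => //; apply: Alg_inv => //; exact: Alg_add.
have [X tX X0] := smooth_alg_tower aX.
have XL x : x < 1/4 -> X 0%N x = 1.
  move=> hx; rewrite X0 /S (E0 (2 * x + - (1/2))) ?add0r; last by lra.
  by rewrite mulfV// gt_eqF// Epos//; lra.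
have XR x : 3/4 < x -> X 0%N x = 0.
  by move=> hx; rewrite X0 E0 ?mul0r//; lra.
have XL' k x : x < 1/4 -> X k.+1 x = 0.
  move=> hx; exact: (@tower_locally_cst X 1 [set: R] [set x | x < 1/4] tX
    (@open_lt _ _) (fun _ _ => I) XL k x hx).
have XR' k x : 3/4 < x -> X k x = 0.
  case: k => [|k]; first exact: XR.
  move=> hx; exact: (@tower_locally_cst X 0 [set: R] [set x | 3/4 < x] tX
    (@open_gt _ _) (fun _ _ => I) XR k x hx).
exists X; split=> //; split.
- by move=> x hx; apply: XL; lra.
- by move=> k x hx; apply: XL'; lra.
- by move=> k x hx; apply: XR'; lra.
- move=> x; rewrite X0 /S.
  have -> : - 2 * (1 - x) + 3/2 = 2 * x + - (1/2) by lra.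
  have -> : 2 * (1 - x) + - (1/2) = - 2 * x + 3/2 by lra.
  by rewrite (addrC (E (- 2 * x + 3/2))) -mulrDl addrC mulfV//; exact: S0.
- move=> k; apply: (@tower_bounded X k 0 1) => // x hx.
    by case: k => [|k]; rewrite ?XL ?XL'//; lra.
  by rewrite !XR'//; lra.
Qed.

End SmoothClosure.

(** * Extension of a smooth function from an interval *)

Section RealExtension.
Variable R : realType.

Lemma tower_sub (U V : set R) D : V `<=` U -> tower U D -> tower V D.
Proof. by move=> VU tD k x /VU; exact: tD. Qed.

Lemma tower_add (U : set R) D E : tower U D -> tower U E -> tower U (fun k x => D k x + E k x).
Proof. by move=> tD tE k x Ux; apply: is_deriveD; [exact: tD|exact: tE]. Qed.

Lemma tower_scale (U : set R) D (c : R) : tower U D -> tower U (fun k x => c * D k x).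
Proof. by move=> tD k x Ux; apply: (@is_deriveZ R R R (D k) c); exact: tD. Qed.

Lemma tower0 (U : set R) : tower U (fun=> fun=> 0 : R).
Proof. by move=> k x _; exact: is_derive_cst. Qed.

Lemma tower_sum (I : Type) (s : seq I) (U : set R) (D : I -> nat -> R -> R) :
  (forall i, tower U (D i)) -> tower U (fun k x => \sum_(i <- s) D i k x).
Proof.
move=> tD; elim: s => [|i s IH].
  have -> : (fun k x => \sum_(i <- [::]) D i k x) = fun=> fun=> 0.
    by apply/funext => k; apply/funext => x; rewrite big_nil.
  exact: tower0.
have -> : (fun k x => \sum_(j <- i :: s) D j k x) = fun k x => D i k x + \sum_(j <- s) D j k x.
  by apply/funext => k; apply/funext => x; rewrite big_cons.
exact: tower_add.
Qed.

Lemma tower_near (U V : set R) D E x k : tower U E -> U x -> open V -> V x ->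
  (forall k y, V y -> D k y = E k y) -> is_derive x (1 : R) (D k) (D k.+1 x).
Proof.
move=> tE Ux oV Vx h; rewrite h//; apply: is_derive_near (tE k x Ux).
by apply: filterS (open_nbhs_nbhs (conj oV Vx)) => y; exact: h.
Qed.

(** Reflecting at [c] with ratio [-1/(j+1)] multiplies the derivative of order [m] at [c] by the
    power [m] of the ratio; these equations make the combination match it. The ratios are distinct,
    so the Vandermonde matrix is invertible. *)
Lemma reflection_coefs n : exists c : 'I_n.+1 -> R, forall m, (m <= n)%N ->
  \sum_j c j * (- (j.+1%:R)^-1) ^+ m = 1.
Proof.
pose a : 'rV[R]_n.+1 := \row_j (- (j.+1%:R)^-1).
pose V := Vandermonde n.+1 a.
have uV : V \in unitmx.
  rewrite unitmxE det_Vandermonde unitfE; apply/prodf_neq0 => i _.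
  apply/prodf_neq0 => j ij; rewrite subr_eq0 !mxE eqr_opp (inj_eq invr_inj) eqr_nat.
  by rewrite eqSS gtn_eqF.
pose c := invmx V *m const_mx 1 : 'cV[R]_n.+1.
exists (fun j => c j 0) => m mn.
have E : (V *m c) (inord m) 0 = 1 by rewrite mulKVmx// mxE.
rewrite -[RHS]E mxE; apply: eq_bigr => j _.
by rewrite !mxE inordK// mulrC.
Qed.

(** Mean value theorem from the top order downwards, each order gaining a factor [x - c]. *)
Lemma flat_bound (phi : nat -> R -> R) (W : set R) (c d A : R) n : tower W phi ->
  (forall x, c <= x < c + d -> W x) -> (forall k, (k <= n)%N -> phi k c = 0) ->
  (forall x, c <= x < c + d -> `|phi n.+1 x| <= A) ->
  forall j, (j <= n.+1)%N -> forall x, c <= x < c + d -> `|phi (n.+1 - j)%N x| <= A * (x - c) ^+ j.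
Proof.
move=> tphi hW phi0 hA; elim=> [|j IH] jn x hx; first by rewrite subn0 expr0 mulr1 hA.
have /andP[cx xd] := hx.
have [|y hy E] := @MVT_between _ (phi (n.+1 - j.+1)%N) (phi (n.+1 - j.+1).+1) x c.
  move=> y; rewrite (min_idPr cx) (max_idPl cx) => /andP[h1 h2].
  by apply: tphi; apply: hW; rewrite h1 (le_lt_trans h2 xd).
move: hy; rewrite (min_idPr cx) (max_idPl cx) => /andP[cy yx].
rewrite phi0 ?subSS ?leq_subr// subr0 in E.
rewrite subSS E normrM (ger0_norm (_ : 0 <= x - c)) ?subr_ge0// exprSr mulrA.
rewrite -subSn//; apply: ler_wpM2r; first by rewrite subr_ge0.
have hyd : c <= y < c + d by rewrite cy (le_lt_trans yx xd).
apply: le_trans (IH (ltnW jn) y hyd) _.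
have A0 : 0 <= A by exact: le_trans (hA _ hx).
apply: ler_wpM2l => //; apply: lerXn2r; rewrite ?nnegrE ?subr_ge0//.
by rewrite lerD2r.
Qed.

Section Cutoff.
Variable X : nat -> R -> R.
Variable MX : nat -> R.
Hypothesis tX : tower [set: R] X.
Hypothesis XL : forall x : R, x <= 0 -> X 0%N x = 1.
Hypothesis XL' : forall k (x : R), x <= 0 -> X k.+1 x = 0.
Hypothesis XR : forall k (x : R), 1 <= x -> X k x = 0.
Hypothesis Xsym : forall x, X 0%N x + X 0%N (1 - x) = 1.
Hypothesis MX0 : forall k, 0 <= MX k.
Hypothesis XM : forall k x, `|X k x| <= MX k.

(* Beyond [c] the extension is [G + P]: [G] is a combination of reflections of [D] having
   the same derivatives as [D] at [c] up to order [n], and [P] is [D - G] cut off at a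
   distance [del] of [c]; the constant [K] does not depend on the size of [D - G], since
   [del] may be taken small in terms of the derivative of order [n + 1] of [D - G]. *)
Lemma half_line_extension n : exists2 K : R, 0 <= K & forall (c : R) (U : set R) (D : nat -> R -> R) (B : nat -> R),
  open U -> tower U D -> (forall t, t <= c -> U t) ->
  (forall k t, (k <= n)%N -> t <= c -> `|D k t| <= B k) ->
  exists D', [/\ tower [set: R] D', forall t, t <= c -> D' 0%N t = D 0%N t &
    forall k t, (k <= n)%N -> `|D' k t| <= K * B k + 1].
Proof.
have [cs hcs] := reflection_coefs n.
have K0 : 0 <= \sum_j `|cs j| by apply: sumr_ge0.
(* The 1 accounts for [D] itself before [c], the sum for the reflections after [c]; no ratio exceeds
   1, so none enlarges a derivative. *)
exists (1 + \sum_j `|cs j|); first by rewrite addr_ge0.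
move=> c U D B oU tD Uc hB.
have B0 k : (k <= n)%N -> 0 <= B k by move=> kn; exact: le_trans (hB k c kn (lexx _)).
pose lam (j : 'I_n.+1) : R := (j.+1%:R)^-1.
have lam01 j : 0 < lam j <= 1 by rewrite /lam invr_gt0 ltr0Sn/= invf_le1 ?ltr0Sn// ler1n.
pose arg j x := - lam j * x + (c + lam j * c).
pose V := [set x | forall j, U (arg j x)].
pose G k x := \sum_j cs j * ((- lam j) ^+ k * D k (arg j x)).
have tG : tower V G.
  apply: tower_sum => j; apply: tower_scale.
  by apply: tower_sub (tower_affine (al := - lam j) (be := c + lam j * c) tD) => x; exact.
have argc j : arg j c = c by rewrite /arg; ring.
have argle j x : c <= x -> arg j x <= c.
  move=> cx; have /andP[l0 _] := lam01 j.
  have : 0 <= lam j * (x - c) by apply: mulr_ge0; [exact: ltW|rewrite subr_ge0].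
  by rewrite /arg; lra.
have Vc x : c <= x -> V x by move=> cx j; apply: Uc; exact: argle.
have Gc k : (k <= n)%N -> G k c = D k c.
  move=> kn; rewrite -[RHS]mul1r -(hcs k kn) mulr_suml; apply: eq_bigr => j _.
  by rewrite argc mulrA.
have GB k x : (k <= n)%N -> c <= x -> `|G k x| <= (\sum_j `|cs j|) * B k.
  move=> kn cx; rewrite mulr_suml; apply: le_trans (ler_norm_sum _ _ _) _.
  apply: ler_sum => j _; rewrite normrM ler_wpM2l// normrM normrX normrN.
  have /andP[l0 l1] := lam01 j; rewrite (gtr0_norm l0).
  rewrite -[leRHS]mul1r ler_pM ?exprn_ge0 ?(ltW l0) ?exprn_ile1 ?(ltW l0)//.
  by apply: hB => //; exact: argle.
pose phi k x := D k x - G k x.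
have tphi : tower (U `&` V) phi.
  move=> k x [Ux Vx]; apply: is_deriveB; [exact: tD|exact: tG].
pose A := `|phi n.+1 c| + 1.
have [d /= d0 hd] : exists2 d : R, 0 < d & forall x : R, `|c - x| < d -> [/\ U x, V x & `|phi n.+1 x| <= A].
  have n1 : \forall x \near c, U x by exact: (open_nbhs_nbhs (conj oU (Uc c (lexx c)))).
  have n2 : \forall x \near c, forall j, U (arg j x).
    apply: (@filter_forall R 'I_n.+1 (fun j x => U (arg j x)) (nbhs c) _) => j.
    have ca : {for c, continuous (arg j)}.
      apply: (@is_derive_cont _ _ _ (- lam j)).
      have := is_derive_affine (c + lam j * c) (- lam j) c; congr is_derive.
      by apply/funext => y; rewrite /arg addrC mulrC.
    by apply: ca; rewrite argc; apply: open_nbhs_nbhs; split=> //; exact: Uc.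
  have n3 : \forall x \near c, `|phi n.+1 x| <= A.
    have cphi : {for c, continuous (phi n.+1)}.
      by apply: (tower_cont tphi); split; [exact: Uc|exact: Vc].
    have /cvgrPdist_le/(_ 1 ltr01) := cphi; apply: filterS => x h.
    have -> : phi n.+1 x = phi n.+1 c - (phi n.+1 c - phi n.+1 x) by ring.
    by apply: le_trans (ler_normB _ _) _; rewrite lerD2l.
  have [d /= d0 hd] := (nbhs_ballP _ _).1 (filterI n1 (filterI n2 n3)).
  by exists d => // x hx; have [|? []] := hd x; first by rewrite -ball_normE.
have inW x : c <= x < c + d -> (U `&` V) x.
  by move=> /andP[? ?]; have [|? ? _] := hd x; first by rewrite ltr_norml; apply/andP; split; lra.
have A0 : 0 <= A by rewrite addr_ge0.
have flat := @flat_bound phi (U `&` V) c d A n tphi inW _ _.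
have {}flat : forall j, (j <= n.+1)%N -> forall x, c <= x < c + d ->
    `|phi (n.+1 - j)%N x| <= A * (x - c) ^+ j.
  apply: flat => [k kn|x /andP[? ?]]; first by rewrite /phi Gc// subrr.
  by have [|_ _] := hd x; first by rewrite ltr_norml; apply/andP; split; lra.
pose C := \sum_(k < n.+1) \sum_(i < k.+1) 'C(k, i)%:R * MX i.
have Ck (k : nat) : (k <= n)%N -> \sum_(i < k.+1) 'C(k, i)%:R * MX i <= C.
  move=> kn; rewrite /C (bigD1 (Ordinal (n := n.+1) (m := k) kn))//= lerDl.
  by apply: sumr_ge0 => j _; apply: sumr_ge0 => i _; apply: mulr_ge0.
have C0 : 0 <= C by apply: sumr_ge0 => j _; apply: sumr_ge0 => i _; apply: mulr_ge0.
have CA0 : 0 <= C * A by exact: mulr_ge0.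
(* In Leibniz' formula at order [k], a derivative of order [i] of the cutoff costs [del ^- i], but
   [phi (k - i)] is at most [A * del ^ (n + 1 - k + i)]. What is left is at most [del], and
   [C * A * del <= 1] is the 1 of the final bound. *)
pose del := Num.min (d / 2) (Num.min 1 (C * A + 1)^-1).
have del0 : 0 < del by rewrite !lt_min divr_gt0//= ltr01/= invr_gt0 ltr_wpDl.
have deld : del < d by rewrite gt_min ltr_pdivrMr// ltr_pMr// ltr1n.
have del1 : del <= 1 by rewrite !ge_min lexx orbT.
have delC : C * A * del <= 1.
  have h : del <= (C * A + 1)^-1 by rewrite !ge_min lexx !orbT.
  have : (C * A + 1) * del <= 1 by rewrite -ler_pdivlMl ?mulr1// ltr_wpDl.
  by lra.
pose xd x := del^-1 * x + (- (del^-1 * c)).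
pose Xd k x := del^-1 ^+ k * X k (xd x).
have tXd : tower [set: R] Xd by apply: tower_sub (tower_affine tX).
have xdE x : xd x = (x - c) / del by rewrite /xd mulrBl mulrC (mulrC c).
have xdL x : x <= c -> xd x <= 0.
  by move=> xc; rewrite xdE pmulr_lle0 ?invr_gt0// subr_le0.
have xdR x : c + del <= x -> 1 <= xd x.
  by move=> xc; rewrite xdE ler_pdivlMr// mul1r; lra.
pose P := leibniz Xd phi.
have tP : tower (U `&` V) P by apply: tower_leibniz => //; exact: tower_sub tXd.
have PL k x : x <= c -> P k x = phi k x.
  move=> xc; rewrite /P /leibniz big_ord_recl bin0 subn0 /Xd expr0 XL ?xdL// !mul1r big1 ?addr0//.
  by move=> i _; rewrite XL' ?xdL// mulr0 mul0r mulr0.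
have PR k x : c + del <= x -> P k x = 0.
  move=> xc; rewrite /P /leibniz big1// => i _.
  by rewrite /Xd XR ?xdR// mulr0 mul0r mulr0.
have PB k x : (k <= n)%N -> c <= x < c + d -> `|P k x| <= 1.
  move=> kn hx; have /andP[cx xd'] := hx.
  have [xdel|delx] := leP (c + del) x; first by rewrite PR// normr0.
  apply: le_trans delC; apply: le_trans (_ : (\sum_(i < k.+1) 'C(k, i)%:R * MX i) * (A * del) <= _); last first.
    by rewrite -mulrA ler_wpM2r ?Ck// mulr_ge0// ltW.
  rewrite /P /leibniz mulr_suml; apply: le_trans (ler_norm_sum _ _ _) _.
  apply: ler_sum => i _; rewrite -mulrA normrM ger0_norm// ler_wpM2l//.
  rewrite normrM /Xd normrM ger0_norm ?exprn_ge0 ?invr_ge0 ?(ltW del0)//.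
  have ik : (i <= k)%N by rewrite -ltnS.
  have jn : (n.+1 - (k - i) <= n.+1)%N by rewrite leq_subr.
  have := flat _ jn x hx; rewrite subKn; last by rewrite (leq_trans (leq_subr _ _))// leqW.
  move=> hphi; rewrite -mulrA [leLHS]mulrCA; apply: ler_pM => //.
    by rewrite mulr_ge0 ?exprn_ge0 ?invr_ge0 ?(ltW del0).
  apply: le_trans (_ : del^-1 ^+ i * (A * del ^+ (n.+1 - (k - i))) <= _).
    apply: ler_wpM2l; first by rewrite exprn_ge0// invr_ge0 ltW.
    apply: le_trans hphi _; apply: ler_wpM2l => //.
    by apply: lerXn2r; rewrite ?nnegrE ?subr_ge0 ?(ltW del0)//; lra.
  rewrite mulrCA ler_wpM2l//.
  have -> : (n.+1 - (k - i) = i + (n - k).+1)%N.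
    by rewrite subnBA// -subSn// addnC addnBA// leqW.
  rewrite exprD mulrA -exprMn mulVf ?gt_eqF// expr1n mul1r exprS.
  by rewrite ler_piMr ?(ltW del0)// exprn_ile1// ltW.
(* The formulas agree on overlaps: [G + P] is [D] before [c] within the common domain, and [P]
   vanishes from [c + del] on, strictly before [c + d]. *)
pose D' k x := if x <= c then D k x else if x < c + d then G k x + P k x else G k x.
exists D'; split.
- move=> k x _.
  have [xc|cx] := ltP x c.
    have DE j y : y < c -> D' j y = D j y by move=> yc; rewrite /D' (ltW yc).
    exact: (@tower_near U [set y | y < c] D' D x k tD (Uc x (ltW xc)) (@open_lt _ _) xc DE).
  have [xd'|dx] := ltP x (c + d).
    have tGP : tower (U `&` V) (fun k x => G k x + P k x).
      by apply: tower_add => //; exact: tower_sub tG.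
    have DE j y : y < c + d -> D' j y = G j y + P j y.
      move=> yd; rewrite /D'; have [yc|yc] := leP y c; last by rewrite yd.
      by rewrite PL// /phi subrKC.
    have xW : (U `&` V) x by apply: inW; rewrite cx.
    exact: (@tower_near _ [set y | y < c + d] D' _ x k tGP xW (@open_lt _ _) xd' DE).
  have DE j y : c + del < y -> D' j y = G j y.
    move=> yd; rewrite /D'; have [yc|_] := leP y c; first by exfalso; lra.
    by case: ifP => // _; rewrite PR ?addr0// ltW.
  have xd' : c + del < x by rewrite (lt_le_trans _ dx)// ltrD2l.
  exact: (@tower_near _ [set y | c + del < y] D' _ x k tG (Vc x cx) (@open_gt _ _) xd' DE).
- by move=> t tc; rewrite /D' tc.
- move=> k t kn; have kB := B0 k kn; rewrite /D' mulrDl mul1r.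
  have SB : 0 <= (\sum_j `|cs j|) * B k by exact: mulr_ge0.
  have [tc|ct] := leP t c; first by have := hB k t kn tc; lra.
  have h1 := GB k t kn (ltW ct).
  have [td|dt] := ltP t (c + d); last by lra.
  apply: le_trans (ler_normD _ _) _.
  have := PB k t kn; rewrite (ltW ct) td => /(_ isT); lra.
Qed.

(** The cutoff is 0 on the left third of the interval and 1 on the right third. The product
    continues by 0 to the left, and the half-line extension applies at [q]. *)
Lemma right_extension n : exists2 K : R, 0 <= K & forall (p q : R) (U : set R) (D : nat -> R -> R)
    (B : nat -> R), p < q -> open U -> tower U D -> (forall t, p <= t <= q -> U t) ->
  (forall k t, (k <= n)%N -> p <= t <= q -> `|D k t| <= B k) ->
  exists D', [/\ tower [set: R] D',
    forall t, p <= t <= q -> D' 0%N t = X 0%N (3 * (q - t) / (q - p) - 1) * D 0%N t &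
    forall k t, (k <= n)%N ->
      `|D' k t| <= K * ((1 + (q - p)^-1) ^+ k * \sum_(j < k.+1) B j) + 1].
Proof.
have [K1 K10 hK1] := half_line_extension n.
pose C := \sum_(k < n.+1) \sum_(i < k.+1) 'C(k, i)%:R * (3 ^+ i * MX i).
have T0 (k i : nat) : 0 <= 'C(k, i)%:R * (3 ^+ i * MX i).
  by rewrite mulr_ge0// mulr_ge0// exprn_ge0.
have Ck (k : nat) : (k <= n)%N -> \sum_(i < k.+1) 'C(k, i)%:R * (3 ^+ i * MX i) <= C.
  move=> kn; rewrite /C (bigD1 (Ordinal (n := n.+1) (m := k) kn))//= lerDl.
  by apply: sumr_ge0 => j _; apply: sumr_ge0 => i _; exact: T0.
have C0 : 0 <= C by apply: sumr_ge0 => j _; apply: sumr_ge0 => i _; exact: T0.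
exists (K1 * C); first exact: mulr_ge0.
move=> p q U D B pq oU tD hU hB.
have qp0 : 0 < q - p by rewrite subr_gt0.
have B0 k : (k <= n)%N -> 0 <= B k.
  by move=> kn; apply: le_trans (hB k p kn _) => //; rewrite lexx ltW.
pose al := - (3 / (q - p)); pose be := 3 * q / (q - p) - 1.
pose Y k x := al ^+ k * X k (al * x + be).
have argE x : al * x + be = 3 * (q - x) / (q - p) - 1.
  by rewrite /al /be; field; rewrite gt_eqF.
have tY : tower [set: R] Y by apply: tower_sub (tower_affine tX).
(* Up to [thr] the argument of the cutoff is at least 1, so [Y] vanishes there at every order. *)
pose thr := p + (q - p) / 3.
have Y0 k x : x <= thr -> Y k x = 0.
  move=> hx; rewrite /Y XR ?mulr0// argE lerBrDr ler_pdivlMr//.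
  by rewrite /thr in hx; lra.
pose F k x := if x < thr then 0 else leibniz Y D k x.
have L0 k x : x <= thr -> leibniz Y D k x = 0.
  by move=> hx; rewrite /leibniz big1// => i _; rewrite Y0// mul0r mulr0.
pose U' := [set x | x < thr] `|` U.
have oU' : open U' by apply: openU => //; exact: open_lt.
have tF : tower U' F.
  move=> k x hx; have [Ux|nUx] := pselect (U x).
    have FE j y : U y -> F j y = leibniz Y D j y.
      by move=> _; rewrite /F; case: ifP => // /ltW h; rewrite L0.
    have tL : tower U (leibniz Y D) by apply: tower_leibniz => //; exact: tower_sub tY.
    exact: (@tower_near U U F _ x k tL Ux oU Ux FE).
  have xt : x < thr by case: hx.
  have FE j y : y < thr -> F j y = 0 by rewrite /F => ->.
  exact: (@tower_near setT [set y | y < thr] F _ x k (@tower0 _) I (@open_lt _ _) xt FE).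
have thrq : thr < q by rewrite /thr; lra.
have U'q t : t <= q -> U' t.
  move=> tq; have [h|h] := ltP t thr; first by left.
  by right; apply: hU; rewrite tq andbT (le_trans _ h)// /thr lerDl divr_ge0// ltW.
pose S k := \sum_(j < k.+1) B j.
have S0 k : (k <= n)%N -> 0 <= S k.
  by move=> kn; apply: sumr_ge0 => j _; apply: B0; rewrite (leq_trans _ kn)// -ltnS.
(* A derivative of the cutoff brings a factor [3 / (q - p)]; the 3 goes into [C]. Since [w >= 1],
   the power [w ^ k] dominates all lower ones. *)
pose w := 1 + (q - p)^-1.
have w1 : 1 <= w by rewrite lerDl invr_ge0 ltW.
have hF k t : (k <= n)%N -> t <= q -> `|F k t| <= C * (w ^+ k * S k).
  move=> kn tq; have wS : 0 <= w ^+ k * S k.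
    by rewrite mulr_ge0 ?S0// exprn_ge0// (le_trans _ w1).
  rewrite /F; have [h|h] := ltP t thr; first by rewrite normr0 mulr_ge0.
  apply: le_trans (_ : (\sum_(i < k.+1) 'C(k, i)%:R * (3 ^+ i * MX i)) * (w ^+ k * S k) <= _); last first.
    by apply: ler_wpM2r => //; exact: Ck.
  rewrite /leibniz mulr_suml; apply: le_trans (ler_norm_sum _ _ _) _.
  apply: ler_sum => i _; rewrite -mulrA normrM ger0_norm// ler_wpM2l//.
  have ik : (i <= k)%N by rewrite -ltnS.
  have kin : (k - i <= n)%N by rewrite (leq_trans (leq_subr _ _)).
  have ptq : p <= t <= q by rewrite tq andbT (le_trans _ h)// /thr lerDl divr_ge0// ltW.
  rewrite normrM mulrA; apply: ler_pM => //; last first.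
    apply: le_trans (hB _ _ kin ptq) _.
    have hki : (k - i < k.+1)%N by rewrite ltnS leq_subr.
    rewrite /S (bigD1 (Ordinal hki))//= lerDl; apply: sumr_ge0 => j _.
    by apply: B0; rewrite (leq_trans _ kn)// -ltnS.
  have al3 : `|al| = 3 / (q - p) by rewrite /al normrN ger0_norm// divr_ge0// ltW.
  rewrite /Y normrM normrX al3.
  rewrite exprMn -!mulrA ler_wpM2l ?exprn_ge0//.
  rewrite (mulrC (MX i)); apply: ler_pM => //; first by rewrite exprn_ge0// invr_ge0 ltW.
  apply: le_trans (_ : w ^+ i <= _).
    have i0 : 0 <= (q - p)^-1 by rewrite invr_ge0 ltW.
    by apply: lerXn2r; rewrite ?nnegrE /w ?addr_ge0 ?lerDr.
  exact: ler_weXn2l.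
have [D' [tD' D'0 D'B]] := hK1 q U' F (fun k => C * (w ^+ k * S k)) oU' tF U'q hF.
exists D'; split=> // [t /andP[pt tq]|k t kn]; last by rewrite -mulrA; exact: D'B.
rewrite D'0// /F -argE.
have L00 : leibniz Y D 0 t = X 0%N (al * t + be) * D 0%N t.
  by rewrite /leibniz big_ord1 bin0 mul1r subnn /Y expr0 mul1r.
by case: ifP => [/ltW h|_]; rewrite -L00// L0.
Qed.

(** The right extension of [D] is added to the mirror image of the right extension of the reflected
    function. Their cutoffs at a point are [X 0 y] and [X 0 (1 - y)], with sum 1 by [Xsym], so [D]
    is recovered on the interval. *)
Lemma interval_extension n : exists2 K : R, 0 <= K & forall (p q : R) (U : set R) (D : nat -> R -> R)
    (B : nat -> R), p < q -> open U -> tower U D -> (forall t, p <= t <= q -> U t) ->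
  (forall k t, (k <= n)%N -> p <= t <= q -> `|D k t| <= B k) ->
  exists D', [/\ tower [set: R] D', forall t, p <= t <= q -> D' 0%N t = D 0%N t &
    forall k t, (k <= n)%N ->
      `|D' k t| <= K * ((1 + (q - p)^-1) ^+ k * \sum_(j < k.+1) B j) + 2].
Proof.
have [K K0 hK] := right_extension n; exists (K + K); first by rewrite addr_ge0.
move=> p q U D B pq oU tD hU hB.
have [D1 [tD1 D10 D1B]] := hK p q U D B pq oU tD hU hB.
pose U2 := [set x | U (-1 * x + 0)]; pose E k x := (-1) ^+ k * D k (-1 * x + 0).
have tE : tower U2 E by exact: tower_affine.
have oU2 : open U2.
  apply: (open_comp _ oU) => x _; apply: (@is_derive_cont _ _ _ (-1)).
  have := is_derive_affine 0 (-1) x; congr is_derive.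
  by apply/funext => y; rewrite addrC mulrC.
have pq' : - q < - p by rewrite ltrN2.
have refl t : - q <= t <= - p -> p <= -1 * t + 0 <= q.
  by move=> /andP[? ?]; apply/andP; split; lra.
have hU2 t : - q <= t <= - p -> U2 t by move=> /refl; exact: hU.
have hB2 k t : (k <= n)%N -> - q <= t <= - p -> `|E k t| <= B k.
  by move=> kn /refl ht; rewrite /E normrM normrX normrN1 expr1n mul1r hB.
have [D2 [tD2 D20 D2B]] := hK (- q) (- p) U2 E B pq' oU2 tE hU2 hB2.
exists (fun k x => D1 k x + (-1) ^+ k * D2 k (-1 * x + 0)); split.
- by apply: tower_add => //; exact: (tower_affine (al := -1) (be := 0) tD2).
- move=> t /andP[pt tq]; rewrite D10 ?pt// expr0 mul1r D20; last by apply/andP; split; lra.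
  have -> : E 0%N (-1 * t + 0) = D 0%N t by rewrite /E expr0 mul1r; congr D; ring.
  rewrite -mulrDl.
  have -> : 3 * (- p - (-1 * t + 0)) / (- p - - q) - 1 = 1 - (3 * (q - t) / (q - p) - 1).
    by field; rewrite subr_eq0 gt_eqF.
  by rewrite Xsym mul1r.
- move=> k t kn; apply: le_trans (ler_normD _ _) _.
  rewrite [X in _ + X]normrM normrX normrN1 expr1n mul1r.
  have h1 := D1B k t kn; have := D2B k (-1 * t + 0) kn.
  have -> : - p - - q = q - p by rewrite opprK addrC.
  by move: h1; set Z := (_ ^+ k * _); lra.
Qed.

End Cutoff.

End RealExtension.

(** * Extension of a generalized smooth function *)

Section Extension.
Variables (R : realType) (rho : gauge R).
Local Notation RT := (gnum rho).

Lemma moderate_powV n : moderate rho (fun e => (rho e ^+ n)^-1).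
Proof.
apply/moderate_netP; exists n; apply: for_smallW (gauge_small rho) => e /andP[r0 _].
by rewrite ger0_norm// invr_ge0 exprn_ge0// ltW.
Qed.

Lemma moderateX x n : moderate rho x -> moderate rho (fun e => x e ^+ n).
Proof.
move=> mx; elim: n => [|n IH]; first exact: moderate_cst.
have -> : (fun e => x e ^+ n.+1) = (fun e => x e * x e ^+ n) by apply/funext => e; rewrite exprS.
exact: moderateM.
Qed.

(* The order up to which the derivatives of the extension are controlled tends to infinity
   as [e] goes to 0, slowly enough for the constants [K] of [interval_extension]. *)
Lemma gtower_extend a b g Om D : a <~ b -> gtower (gitv a b) g Om D ->
  exists g' Om' D', gtower [set: RT] g' Om' D' /\ forall X, gitv a b X -> g' X = g X.
Proof.
move=> ab gt; have [ae aae] := represents_exists a; have [be bbe] := represents_exists b.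
have [n0 gap] := itv_gap ab aae bbe.
have [M hM] := choice (fun k => gtower_itv_moderate ab aae bbe k gt).
have [X [tX [XL XL' XR Xsym XM]]] := cutoff_exists R.
have XM' k : exists M, 0 <= M /\ forall x, `|X k x| <= M by have [C C0 hC] := XM k; exists C.
have [MX hMX] := choice XM'.
have hK n := interval_extension tX XL XL' XR Xsym (fun k => (hMX k).1) (fun k => (hMX k).2) n.
have hK' n : exists K, 0 <= K /\ forall (p q : R) (U : set R) (D : nat -> R -> R)
    (B : nat -> R), p < q -> open U -> tower U D -> (forall t, p <= t <= q -> U t) ->
    (forall k t, (k <= n)%N -> p <= t <= q -> `|D k t| <= B k) ->
    exists D', [/\ tower [set: R] D', forall t, p <= t <= q -> D' 0%N t = D 0%N t &
    forall k t, (k <= n)%N ->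
      `|D' k t| <= K * ((1 + (q - p)^-1) ^+ k * \sum_(j < k.+1) B j) + 2].
  by have [K K0 H] := hK n; exists K.
have [K HK] := choice hK'.
(* The clause on [K n] decides how slowly the controlled order grows. *)
pose P n e := [/\ 0 < rho e < 1, K n <= (rho e)^-1, ae e + rho e ^+ n0 <= be e,
  forall t, ae e <= t <= be e -> Om e t &
  forall (i : 'I_n.+1) t, ae e <= t <= be e -> `|D e i t| <= (rho e ^+ M i)^-1].
have smallP n : for_small (P n).
  have K0 : 0 < (K n + 1)^-1 by rewrite invr_gt0 ltr_wpDl// (HK n).1.
  have s1 := for_small_forall (fun i : 'I_n.+1 => hM i).
  apply: for_smallW (for_smallI (gauge_lt rho K0) (for_smallI gap
    (for_smallI (gtower_itv_in ab aae bbe gt) s1))) => e [[/andP[r0 r1] rK] [gp [inO hB]]].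
  split=> //; first by rewrite r0.
  have K1 : 0 < K n + 1 by rewrite ltr_wpDl// (HK n).1.
  apply: le_trans (_ : K n + 1 <= _); first by rewrite lerDl.
  by rewrite -[leLHS]invrK lef_pV2 ?posrE ?ltW.
have [N [PN Ninf]] := for_small_diagonal smallP.
have hD e : exists D', tower [set: R] D' /\ (P (N e) e ->
    (forall t, ae e <= t <= be e -> D' 0%N t = D e 0%N t) /\
    forall k t, (k <= N e)%N -> `|D' k t| <= K (N e) *
      ((1 + (be e - ae e)^-1) ^+ k * \sum_(j < k.+1) (rho e ^+ M j)^-1) + 2).
  have [[/andP[r0 r1] _ gp inO hB]|nP] := pselect (P (N e) e); last first.
    by exists (fun=> fun=> 0); split=> //; exact: tower0.
  have abe : ae e < be e by apply: lt_le_trans gp; rewrite ltrDl exprn_gt0.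
  have hB' k t : (k <= N e)%N -> ae e <= t <= be e -> `|D e k t| <= (rho e ^+ M k)^-1.
    by move=> kN; exact: (hB (Ordinal (n := (N e).+1) (m := k) kN)).
  have oe : open (Om e) by exact: (gtower_open gt).
  have [D' [tD' D'0 D'B]] := (HK (N e)).2 _ _ _ _ (fun k => (rho e ^+ M k)^-1) abe
    oe (gtower_tower gt (e := e)) inO hB'.
  by exists D'.
have [D' HD'] := choice hD.
have gt' : gtower [set: RT] (fun X => gclass rho (fun e => D' e 0%N (gnet X e)))
    (fun=> [set: R]) D'.
  apply: gtower_of_net.
  - by move=> e; exact: openT.
  - by move=> e; have [] := HD' e.
  - by move=> Y y _ _; exact: for_smallT.
  - move=> Y y k _ _.
    (* Bounding [K (N e)] by [1 / rho e] leaves a bound that depends on [k] and no longer on [N e],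
       hence is moderate. *)
    pose B e := (rho e ^+ 1)^-1 * ((1 + (rho e ^+ n0)^-1) ^+ k *
      \sum_(j < k.+1) (rho e ^+ M j)^-1) + 2.
    have mB : moderate rho B.
      apply: moderateD; last exact: moderate_cst.
      apply: moderateM; first exact: moderate_powV.
      apply: moderateM; last by apply: moderate_sum => j; exact: moderate_powV.
      by apply: moderateX; apply: moderateD; [exact: moderate_cst|exact: moderate_powV].
    apply: moderate_small_le mB.
    apply: for_smallW (for_smallI PN (Ninf k)) => e [Pe kN].
    have [_ /(_ Pe)[_ /(_ k (y e) kN) /le_trans]] := HD' e; apply.
    have [/andP[r0 r1] Ke gp _ _] := Pe.
    have S0 : 0 <= \sum_(j < k.+1) (rho e ^+ M j)^-1.
      by apply: sumr_ge0 => j _; rewrite invr_ge0 exprn_ge0// ltW.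
    have p0 : 0 < rho e ^+ n0 by rewrite exprn_gt0.
    have d0 : 0 < be e - ae e by lra.
    have i0 : 0 <= (be e - ae e)^-1 by rewrite invr_ge0 ltW.
    have i1 : 0 <= (rho e ^+ n0)^-1 by rewrite invr_ge0 ltW.
    apply: le_trans (ler_norm _); rewrite lerD2r; apply: ler_pM.
    + exact: (HK _).1.
    + by rewrite mulr_ge0 ?exprn_ge0 ?addr_ge0.
    + by rewrite expr1.
    + apply: ler_wpM2r => //; apply: lerXn2r; rewrite ?nnegrE ?addr_ge0//.
      by rewrite lerD2l lef_pV2 ?posrE//; lra.
eexists; eexists; eexists; split; first exact: gt'.
move=> Y hY; have [y Yy hy] := gitv_represents aae bbe (itv_le ab aae bbe) hY.
apply: (represents_uniq (gtower_val gt' I Yy)).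
apply: (represents_eq_small (gtower_val gt hY Yy)).
apply: for_smallW (for_smallI PN hy) => e [Pe ye].
by have [_ /(_ Pe)[-> //]] := HD' e.
Qed.

End Extension.

(** * Norms and locality *)

Section Ext.
Variables (R : realType) (rho : gauge R).
Local Notation RT := (gnum rho).

Lemma defines_ext n k (A : set 'rV[RT]_n) (f f' : 'rV[RT]_n -> 'rV[RT]_k) Om fe :
  (forall x, A x -> f x = f' x) -> defines A f Om fe -> defines A f' Om fe.
Proof.
by move=> ff' [h1 h2 h3 h4]; split=> // x xe Ax xxe; rewrite -ff'//; exact: h3.
Qed.

Lemma net_derivative_ext (A : set RT) n g g' X Y : (forall x, A x -> g x = g' x) ->
  net_derivative A n g X Y -> net_derivative A n g' X Y.
Proof.
move=> gg' [Om [fe [dfe H]]]; exists Om, fe; split=> //.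
by apply: defines_ext dfe => x Ax; rewrite /Defs.scalar gg'.
Qed.

(** The extension [eta] and [v - u] agree only on the interval; this lets one replace the other
    inside norms and functionals. *)
Lemma gderiv_ext (A : set RT) n g g' : (forall x, A x -> g x = g' x) ->
  gderiv A n g = gderiv A n g'.
Proof.
have sub h h' X Y : (forall x, A x -> h x = h' x) -> is_gderiv A n h X Y -> is_gderiv A n h' X Y.
  move=> hh' [[iX nd]|[niX H]]; [left|right]; split=> //; first exact: net_derivative_ext nd.
  move=> r r0; have [s s0 hs] := H r r0; exists s => // x' y' ix bx nd.
  by apply: hs ix bx _; apply: net_derivative_ext nd => x /hh'.
move=> gg'; apply/funext => X; rewrite /gderiv; congr xget; apply/seteqP; split=> Y.
  exact: sub.
by apply: sub => x /gg'.
Qed.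

Lemma gint_ext (a b : RT) g g' : (forall t, gitv a b t -> g t = g' t) -> gint a b g = gint a b g'.
Proof.
have sub h h' J : (forall x, gitv a b x -> h x = h' x) -> is_gint a b h J -> is_gint a b h' J.
  move=> hh' [Om [fe [dfe H]]]; exists Om, fe; split=> //.
  by apply: defines_ext dfe => x Ax; rewrite /Defs.scalar hh'.
move=> gg'; rewrite /gint; congr xget; apply/seteqP; split=> J; first exact: sub.
by apply: sub => x /gg'.
Qed.

Section Interval.
Variables (a b : RT).
Hypothesis ab : a <~ b.
Local Notation A := (gitv a b).

Lemma gitv_left : A a.
Proof. by split; [exact: gle_refl|exact: glt_le]. Qed.

Lemma gitv_right : A b.
Proof. by split; [exact: glt_le|exact: gle_refl]. Qed.

Lemma gderiv_lin n g g' Om Om' D D' c t : gtower A g Om D -> gtower A g' Om' D' -> A t ->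
  gderiv A n (fun x => g x + c * g' x) t = gderiv A n g t + c * gderiv A n g' t.
Proof.
move=> gt gt' At; have [ae aae] := represents_exists a; have [be bbe] := represents_exists b.
have [x Tx] := represents_exists t; have [ce cc] := represents_exists c.
apply: (represents_uniq (represents_gderiv_itv ab aae bbe n (gtower_lin cc gt gt') At Tx)).
apply: representsD; first exact: (represents_gderiv_itv ab aae bbe n gt At Tx).
by apply: representsM => //; exact: (represents_gderiv_itv ab aae bbe n gt' At Tx).
Qed.

Lemma gtower_gderiv1 g Om D : gtower A g Om D ->
  gtower A (gderiv A 1 g) Om (fun e k => D e k.+1).
Proof.
move=> gt; have [ae aae] := represents_exists a; have [be bbe] := represents_exists b.
have [h1 h2 h3 h4 h5] := gt; split=> //.
- by move=> e k t Ut; exact: h2.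
- by move=> X x k; exact: h4.
- by move=> X x AX Xx; exact: (represents_gderiv_itv ab aae bbe 1 gt AX Xx).
Qed.

Lemma gtower_id (B : set RT) : gtower B id (fun=> [set: R])
  (fun _ k t => match k with 0%N => t | 1%N => 1 | _ => 0 end).
Proof.
split=> //.
- by move=> e; exact: openT.
- by move=> e [|[|k]] t _; [exact: is_derive_id|exact: is_derive_cst|exact: is_derive_cst].
- by move=> X x _ _; exact: for_smallT.
- move=> X x [|[|k]] _ Xx; [exact: Xx.1|exact: moderate_cst|exact: moderate_cst].
Qed.

Lemma gtower_cst0 (B : set RT) : gtower B (fun=> 0) (fun=> [set: R]) (fun _ _ _ => 0).
Proof.
split=> //.
- by move=> e; exact: openT.
- by move=> e k t _; exact: is_derive_cst.
- by move=> X x _ _; exact: for_smallT.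
- by move=> X x k _ _; exact: moderate_cst.
- by move=> X x _ _; exact: represents0.
Qed.

Lemma gderiv_max n g Om D : gtower A g Om D ->
  exists t, A t /\ forall t', A t' -> gderiv A n g t' <=~ gderiv A n g t.
Proof.
move=> gt; have [ae aae] := represents_exists a; have [be bbe] := represents_exists b.
have [x hx] := gtower_itv_max ab aae bbe n gt.
have hx1 : for_small (fun e => ae e <= x e <= be e) by apply: for_smallW hx => e [].
have Tx := represents_gclass (moderate_between aae.1 bbe.1 hx1).
have At := represents_gitv aae bbe Tx hx1.
exists (gclass rho x); split=> // t' At'.
have [y Ty hy] := gitv_represents aae bbe (itv_le ab aae bbe) At'.
apply: (gle_small (represents_gderiv_itv ab aae bbe n gt At' Ty)
  (represents_gderiv_itv ab aae bbe n gt At Tx)).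
by apply: for_smallW (for_smallI hx hy) => e [[_ h]]; exact: h.
Qed.

Lemma gderiv_min n g Om D : gtower A g Om D ->
  exists t, A t /\ forall t', A t' -> gderiv A n g t <=~ gderiv A n g t'.
Proof.
move=> gt; have [ae aae] := represents_exists a; have [be bbe] := represents_exists b.
have gt' := gtower_opp gt.
have [t [At h]] := gderiv_max n gt'; exists t; split=> // t' At'.
have [x Tx] := represents_exists t; have [y Ty] := represents_exists t'.
have r1 := represents_gderiv_itv ab aae bbe n gt At Tx.
have r2 := represents_gderiv_itv ab aae bbe n gt At' Ty.
have r1' := represents_gderiv_itv ab aae bbe n gt' At Tx.
have r2' := represents_gderiv_itv ab aae bbe n gt' At' Ty.
apply/(gleP r1 r2) => k; have := (gleP r2' r1').1 (h _ At') k.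
by apply: for_smallW => e; lra.
Qed.

End Interval.

Lemma gmax_le (X Y X' Y' : RT) : X <=~ X' -> Y <=~ Y' -> gmax X Y <=~ gmax X' Y'.
Proof.
have [x Xx] := represents_exists X; have [y Yy] := represents_exists Y.
have [x' Xx'] := represents_exists X'; have [y' Yy'] := represents_exists Y'.
move=> /(gleP Xx Xx') h1 /(gleP Yy Yy') h2.
apply/(gleP (gmax_represents Xx Yy) (gmax_represents Xx' Yy')) => n.
apply: for_smallW (for_smallI (h1 n) (h2 n)) => e [k1 k2].
rewrite ge_max; apply/andP; split.
  by apply: le_trans k1 _; rewrite lerD2r le_max lexx.
by apply: le_trans k2 _; rewrite lerD2r le_max lexx orbT.
Qed.

Lemma gabs_scale_le (s X : RT) : gitv 0 1 s -> gabs (s * X) <=~ gabs X.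
Proof.
move=> hs; have [x Xx] := represents_exists X.
have le01 : for_small (fun _ : I0 R => 0 <= 1 :> R) by apply: for_smallT => e.
have [z Sz hz] := gitv_represents (represents0 rho) (represents1 rho) le01 hs.
apply: (gle_small (gabs_represents (representsM Sz Xx)) (gabs_represents Xx)).
apply: for_smallW hz => e /andP[z0 z1].
by rewrite normrM ger0_norm// ler_piMl.
Qed.

Lemma gscale_le (s X Y : RT) : 0 <=~ s -> X <=~ Y -> s * X <=~ s * Y.
Proof.
have [z Sz] := represents_exists s; have [x Xx] := represents_exists X.
have [y Yy] := represents_exists Y.
move=> [z1 [z2 [r1 r2 h12]]] [x1 [y1 [rX rY hxy]]].
(* A representative of [s] that is nonnegative at every [e]. *)
have r3 : represents s (fun e => z2 e - z1 e).
  by have := representsB r2 r1; rewrite subr0.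
apply: (gle_small (representsM r3 rX) (representsM r3 rY)).
by apply: for_smallT => e; rewrite ler_wpM2l// subr_ge0.
Qed.

End Ext.

Section Norms.
Variables (R : realType) (rho : gauge R) (d : nat).
Local Notation RT := (gnum rho).
Variables (a b : RT).
Hypothesis ab : a <~ b.
Local Notation A := (gitv a b).
Implicit Types (u v w eta : RT -> 'rV[RT]_d).

Lemma GC_itvP v : GC_itv a b v <-> forall i, exists Om D, gtower A (fun t => v t 0 i) Om D.
Proof. exact: GSF_curveP. Qed.

Lemma GC_itv_lin u v (c : RT) : GC_itv a b u -> GC_itv a b v ->
  GC_itv a b (fun t => u t + c *: v t).
Proof.
move=> /GC_itvP hu /GC_itvP hv; apply/GC_itvP => i.
have [Om [D gt]] := hu i; have [Om' [D' gt']] := hv i; have [ce cc] := represents_exists c.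
eexists; eexists; apply: (gtower_sub (fun _ h => h) _ (gtower_lin cc gt gt')) => X _.
by rewrite !mxE.
Qed.

Lemma GC_itv_ext u v : (forall t, A t -> u t = v t) -> GC_itv a b u -> GC_itv a b v.
Proof.
move=> uv /GC_itvP hu; apply/GC_itvP => i; have [Om [D gt]] := hu i.
by exists Om, D; apply: gtower_sub gt => // X AX; rewrite uv.
Qed.

Lemma gcurve_deriv_ext u v n t : (forall t, A t -> u t = v t) ->
  gcurve_deriv A n u t = gcurve_deriv A n v t.
Proof.
by move=> uv; apply/rowP => i; rewrite !mxE (@gderiv_ext _ _ A n _ (fun s => v s 0 i))// => x /uv ->.
Qed.

Lemma gcurve_deriv_lin u v (c : RT) n t : GC_itv a b u -> GC_itv a b v -> A t ->
  gcurve_deriv A n (fun t => u t + c *: v t) t = gcurve_deriv A n u t + c *: gcurve_deriv A n v t.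
Proof.
move=> /GC_itvP hu /GC_itvP hv At; apply/rowP => i; rewrite !mxE.
have [Om [D gt]] := hu i; have [Om' [D' gt']] := hv i.
rewrite -(gderiv_lin ab n c gt gt' At); congr gderiv.
by apply/funext => x; rewrite !mxE.
Qed.

Lemma GCnorm_ext m u v : (forall t, A t -> u t = v t) -> GCnorm a b m u = GCnorm a b m v.
Proof.
move=> uv; apply: eq_bigr => n _; apply: eq_bigr => i _.
by rewrite (@gderiv_ext _ _ A n _ (fun t => v t 0 i))// => x /uv ->.
Qed.

Lemma argmax_ptP (w : RT -> RT) : (exists t, A t /\ forall t', A t' -> w t' <=~ w t) ->
  A (argmax_pt a b w) /\ forall t', A t' -> w t' <=~ w (argmax_pt a b w).
Proof. by move=> [t Ht]; rewrite /argmax_pt; case: xgetP => [y _ //|/(_ t)]. Qed.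

Lemma argmin_ptP (w : RT -> RT) : (exists t, A t /\ forall t', A t' -> w t <=~ w t') ->
  A (argmin_pt a b w) /\ forall t', A t' -> w (argmin_pt a b w) <=~ w t'.
Proof. by move=> [t Ht]; rewrite /argmin_pt; case: xgetP => [y _ //|/(_ t)]. Qed.

(** Keeps the intermediate curve of Taylor's formula in the ball. The norm is read off at chosen
    extremal points, which may differ for [w] and [s *: w]; the extremal values nevertheless
    correspond. *)
Lemma GCnorm_scale m (s : RT) w : gitv 0 1 s -> GC_itv a b w ->
  GCnorm a b m (fun t => s *: w t) <=~ GCnorm a b m w.
Proof.
move=> hs /GC_itvP hw; have [s0 s1] := hs.
apply: (big_ind2 (fun X Y : RT => X <=~ Y)) => [|X1 X2 Y1 Y2|n _]; [exact: gle_refl|exact: gmax_le|].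
apply: (big_ind2 (fun X Y : RT => X <=~ Y)) => [|X1 X2 Y1 Y2|i _]; [exact: gle_refl|exact: gmax_le|].
have [Om [D gt]] := hw i.
have gt0 := gtower_cst0 A.
set w' := gderiv A n (fun t => (s *: w t) 0 i); set w0 := gderiv A n (fun t => w t 0 i).
have E t : A t -> w' t = s * w0 t.
  move=> At; have := gderiv_lin ab n s gt0 gt At.
  have z0 : gderiv A n (fun=> 0) t = 0.
    have [ae aae] := represents_exists a; have [be bbe] := represents_exists b.
    have [x Tx] := represents_exists t.
    exact: (represents_uniq (represents_gderiv_itv ab aae bbe n gt0 At Tx) (represents0 rho)).
  rewrite z0 add0r => <-; rewrite /w'; congr gderiv.
  by apply/funext => x; rewrite mxE add0r.
have [AM hM] := argmax_ptP (gderiv_max ab n gt).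
have [Am hm] := argmin_ptP (gderiv_min ab n gt).
rewrite -/w0 in AM hM Am hm.
have exM : exists t, A t /\ forall t', A t' -> w' t' <=~ w' t.
  by exists (argmax_pt a b w0); split=> // t' At'; rewrite !E//; apply: gscale_le => //; exact: hM.
have exm : exists t, A t /\ forall t', A t' -> w' t <=~ w' t'.
  by exists (argmin_pt a b w0); split=> // t' At'; rewrite !E//; apply: gscale_le => //; exact: hm.
have [AM' hM'] := argmax_ptP exM; have [Am' hm'] := argmin_ptP exm.
(* As [s >= 0], each of the two points maximizes [w'], and antisymmetry identifies the values. *)
have EM : w' (argmax_pt a b w') = s * w0 (argmax_pt a b w0).
  by apply: gle_anti; rewrite -?E; [rewrite !E//; apply: gscale_le => //; exact: hM| |exact: hM'|].
have Em : w' (argmin_pt a b w') = s * w0 (argmin_pt a b w0).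
  by apply: gle_anti; rewrite -?E; [exact: hm'| |rewrite !E//; apply: gscale_le => //; exact: hm|].
by rewrite /= EM Em; apply: gmax_le; exact: gabs_scale_le.
Qed.

End Norms.

(** * Taylor's formula of order two *)

Section Taylor.
Variable R : realType.

(** The constant [c] makes [g] take the value [D 0 1] at both ends. At an interior zero of its
    derivative [(1 - t) * (D 2 t - 2 * c)] the factor [1 - t] cancels. *)
Lemma taylor2 U (D : nat -> R -> R) : tower U D -> (forall t : R, 0 <= t <= 1 -> U t) ->
  exists2 xi : R, 0 <= xi <= 1 & D 0%N 1 - D 0%N 0 = D 1%N 0 + D 2 xi / 2.
Proof.
move=> tD hU; pose c := D 0%N 1 - D 0%N 0 - D 1%N 0.
pose g t := D 0%N t + ((1 - t) * D 1%N t + (1 - t) ^+ 2 * c).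
pose dg t := (1 - t) * D 2 t - 2 * (1 - t) * c.
have dgP (t : R) : 0 <= t <= 1 -> is_derive t (1 : R) g (dg t).
  move=> ht; have h0 := tD 0%N t (hU t ht); have h1 := tD 1%N t (hU t ht).
  have hl : is_derive t (1 : R) (fun t => 1 - t) (-1).
    have := is_derive_affine 1 (-1) t; congr is_derive.
    by apply/funext => y; rewrite mulrN1.
  have hc : is_derive t (1 : R) (fun=> c) 0 by exact: is_derive_cst.
  have := is_deriveD h0 (is_deriveD (is_deriveM hl h1)
    (is_deriveM (is_deriveM hl hl) hc)).
  congr is_derive; rewrite /dg /GRing.scale/=; ring.
have [||xi hxi] := @MVT _ g dg 0 1 ltr01.
- by move=> t; rewrite in_itv/= => /andP[/ltW h1 /ltW h2]; apply: dgP; rewrite h1.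
- by apply: within_itv_continuous => t /dgP /is_derive_cont.
rewrite in_itv/= in hxi; have /andP[x0 x1] := hxi.
have g1 : g 1 = D 0%N 1 by rewrite /g; ring.
have g0 : g 0 = D 0%N 1 by rewrite /g /c; ring.
rewrite g1 g0 !subrr => /esym; rewrite subr0 mulr1 /dg => H.
have : (1 - xi) * (D 2 xi - 2 * c) = 0 by rewrite -H; ring.
move/eqP; rewrite mulf_eq0 subr_eq0 gt_eqF//= subr_eq0 => /eqP E.
exists xi; first by rewrite !ltW.
by rewrite E /c; field.
Qed.

End Taylor.

(** * The functional along a segment *)

Section Functional.
Variables (R : realType) (rho : gauge R) (d : nat).
Local Notation RT := (gnum rho).
Variables (a b : RT).
Hypothesis ab : a <~ b.
Local Notation A := (gitv a b).
Variable F : RT -> 'rV[RT]_d -> 'rV[RT]_d -> RT.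
Hypothesis hF : lagrangian_GSF a b F.
Implicit Types (u v w eta : RT -> 'rV[RT]_d).

Definition jet u t : 'rV[RT]_(1 + (d + d)) :=
  row_mx (const_mx t) (row_mx (u t) (gcurve_deriv A 1 u t)).

Definition jet_direction eta t : 'rV[RT]_(1 + (d + d)) :=
  row_mx 0 (row_mx (eta t) (gcurve_deriv A 1 eta t)).

Lemma gtower_row3 (g : RT -> RT) (v w : RT -> 'rV[RT]_d) :
  (exists Om D, gtower A g Om D) ->
  (forall i, exists Om D, gtower A (fun t => v t 0 i) Om D) ->
  (forall i, exists Om D, gtower A (fun t => w t 0 i) Om D) ->
  forall i, exists Om D, gtower A
    (fun t => (row_mx (const_mx (g t) : 'rV[RT]_1) (row_mx (v t) (w t))) 0 i) Om D.
Proof.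
move=> [Om [D gt]] hv hw i; case: (split_ordP i) => j ->.
  exists Om, D; apply: gtower_sub gt => // X _; by rewrite row_mxEl mxE.
case: (split_ordP j) => k ->.
  have [Om1 [D1 gt1]] := hv k; exists Om1, D1; apply: gtower_sub gt1 => // X _.
  by rewrite row_mxEr row_mxEl.
have [Om1 [D1 gt1]] := hw k; exists Om1, D1; apply: gtower_sub gt1 => // X _.
by rewrite row_mxEr row_mxEr.
Qed.

Lemma gtower_gcurve_deriv v : GC_itv a b v -> forall i, exists Om D,
  gtower A (fun t => gcurve_deriv A 1 v t 0 i) Om D.
Proof.
move=> /GC_itvP hv i; have [Om [D gt]] := hv i; exists Om, (fun e k => D e k.+1).
by apply: gtower_sub (gtower_gderiv1 ab gt) => // X _; rewrite mxE.
Qed.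

(** Differentiation in [t] is linear, so the jet of [u + s *: eta] is affine in [s] and the
    functional is a parametric integral as above. *)
Lemma gtower_functional u eta : GC_itv a b u -> GC_itv a b eta ->
  exists Om D, gtower [set: RT] (fun s => gfunctional a b F (fun t => u t + s *: eta t)) Om D.
Proof.
move=> hu heta.
have gid : exists Om D, gtower A id Om D by eexists; eexists; exact: gtower_id.
have g0 : exists Om D, gtower A (fun=> 0) Om D by eexists; eexists; exact: gtower_cst0.
have hG := gtower_row3 gid ((GC_itvP a b u).1 hu) (gtower_gcurve_deriv hu).
have hH := gtower_row3 g0 ((GC_itvP a b eta).1 heta) (gtower_gcurve_deriv heta).
(* Indexing by a sum type yields one domain shared by the jet and its direction. *)
have hGH (i : 'I_(1 + (d + d)) + 'I_(1 + (d + d))) : exists Om D, gtower A (fun t =>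
    match i with inl j => jet u t 0 j | inr j => jet_direction eta t 0 j end) Om D.
  case: i => j; first exact: hG.
  have [Om [D gt]] := hH j; exists Om, D; exact: gtower_sub gt.
have [U [D [oU inU gt]]] := gtower_common hGH.
have [_ [OmF [Fe dF]]] := hF.
have jetE s t : A t -> jet u t + s *: jet_direction eta t = jet (fun t => u t + s *: eta t) t.
  move=> At; rewrite /jet /jet_direction !scale_row_mx !add_row_mx scaler0 addr0.
  by rewrite gcurve_deriv_lin.
have hZ (s : RT) t : A t -> A (lsubmx (jet u t + s *: jet_direction eta t) 0 0).
  by move=> At; rewrite jetE// /jet row_mxKl mxE.
have [Om' [D' gt']] := gtower_parametric_integral ab oU inU (fun i => gt (inl i))
  (fun i => gt (inr i)) dF hZ.
exists Om', D'; apply: gtower_sub gt' => // s _; apply: gint_ext => t At.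
by rewrite jetE// mxE /jet !(row_mxKl, row_mxKr) mxE.
Qed.

Lemma gfunctional_ext u v : (forall t, A t -> u t = v t) ->
  gfunctional a b F u = gfunctional a b F v.
Proof.
move=> uv; apply: gint_ext => t At; rewrite uv//; congr F.
exact: gcurve_deriv_ext.
Qed.

End Functional.

(** * Variations along a segment, and the minimizer *)

Section Variations.
Variables (R : realType) (rho : gauge R).
Local Notation RT := (gnum rho).

Lemma gle_double (X : RT) : 0 <~ X -> X <=~ X *+ 2.
Proof.
have [x Xx] := represents_exists X; move=> /(glt0P Xx)[n hn].
rewrite mulr2n; apply: (gle_small Xx (representsD Xx Xx)).
apply: for_smallW (for_smallI (gauge_small rho) hn) => e [/andP[q0 _] h].
by rewrite lerDl; apply: le_trans h; rewrite exprn_ge0// ltW.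
Qed.

(** A variation at [u + xi *: eta] is a derivative at 0; the shift identifies it with a derivative
    of [psi] at [xi]. *)
Lemma gtower_shift psi Om D (x : RT) xe : represents x xe -> gtower [set: RT] psi Om D ->
  gtower [set: RT] (fun s => psi (x + s)) (fun e => [set t | Om e (xe e + t)])
    (fun e k t => D e k (xe e + t)).
Proof.
move=> Xx [h1 h2 h3 h4 h5].
split.
- move=> e; apply: (open_comp _ (h1 e)) => t _; apply: (@is_derive_cont _ _ _ 1).
  have := is_derive_affine (xe e) 1 t; congr is_derive.
  by apply/funext => y; rewrite mulr1.
- move=> e k t Ut; have := tower_affine (al := 1) (be := xe e) (h2 e).
  move=> /(_ k t); rewrite /= mul1r addrC => /(_ Ut).
  rewrite (expr1n _ k.+1) mul1r; congr is_derive.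
  by apply/funext => y; rewrite expr1n !mul1r addrC.
- by move=> X y _ Yy; exact: (h3 _ _ I (representsD Xx Yy)).
- by move=> X y k _ Yy; exact: (h4 _ _ k I (representsD Xx Yy)).
- by move=> X y _ Yy; exact: (h5 _ _ I (representsD Xx Yy)).
Qed.

(** Stationarity makes the first derivative of the net at 0 negligible, not zero, so it enters both
    comparisons as an error term. *)
Lemma gtower_taylor2 psi Om D : gtower [set: RT] psi Om D ->
  exists xi : RT, gitv 0 1 xi /\ forall (Q : RT) (x : I0 R -> R), represents xi x ->
    (represents Q (fun e => D e 2 (x e)) -> gderiv [set: RT] 1 psi 0 = 0 ->
     (0 <=~ Q -> psi 0 <=~ psi 1) /\ (0 <~ Q -> psi 0 <~ psi 1)).
Proof.
move=> gt; have r0 := represents0 rho; have r1 := represents1 rho.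
have le01 : for_small (fun _ : I0 R => 0 <= 1 :> R) by apply: for_smallT => e.
have inOm : for_small (fun e => forall t, 0 <= t <= 1 -> Om e t).
  by apply: (gitv_uniform r0 r1 le01) => X x _ Xx; exact: (gtower_in gt I Xx).
have hx e : exists x, (forall t, 0 <= t <= 1 -> Om e t) -> 0 <= x <= 1 /\
    D e 0%N 1 - D e 0%N 0 = D e 1%N 0 + D e 2 x / 2.
  have [H|] := pselect (forall t, 0 <= t <= 1 -> Om e t); last by exists 0.
  by have [x x01 E] := taylor2 (gtower_tower gt (e := e)) H; exists x.
have [x Hx] := choice hx.
have hx1 : for_small (fun e => 0 <= x e <= 1) by apply: for_smallW inOm => e /Hx[].
have Xx := represents_gclass (moderate_between r0.1 r1.1 hx1).
exists (gclass rho x); split; first exact: (represents_gitv r0 r1 Xx hx1).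
move=> Q y Xy Qy d0.
have Qx : represents Q (fun e => D e 2 (x e)).
  exact: (represents_close Qy (gtower_eq_point 2 gt I Xy Xx)).
have p0 := gtower_val gt I r0; have p1 := gtower_val gt I r1.
have D1 : represents (0 : RT) (fun e => D e 1%N 0).
  by rewrite -d0; exact: (represents_gderiv_setT 1 gt r0).
have /negligible_netP nD1 := represents_negligible D1 r0.
split=> hQ.
  apply/(gleP p0 p1) => n; have := (gleP r0 Qx).1 hQ n.+1 => hn.
  apply: for_smallW (for_smallI (gauge_powM_le rho 2 n) (for_smallI hn
    (for_smallI (nD1 n.+1) inOm))) => e [[_ h1] [h2 [h3 /Hx[_ h4]]]].
  move: h3; rewrite fctBE subr0 ler_norml => /andP[? ?]; lra.
(* For [e] small, half of [rho ^ n] exceeds [2 * rho ^ n.+2]: one copy pays for the first-order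
   term, the other is the gap. *)
have [n hn] := (glt0P Qx).1 hQ; apply/(gltP p0 p1); exists n.+2.
apply: for_smallW (for_smallI (gauge_powM_le rho 4 n) (for_smallI (gauge_powM_le rho 4 n.+1)
  (for_smallI hn (for_smallI (nD1 n.+2) inOm)))) => e.
move=> [[/andP[q0 _] h0] [[_ h1] [h2 [h3 /Hx[_ h4]]]]].
by move: h3; rewrite fctBE subr0 ler_norml => /andP[? ?];
  have := exprn_gt0 n.+2 q0; lra.
Qed.

End Variations.

Lemma GC0_extension (R : realType) (rho : gauge R) d (a b : gnum rho) p q
    (u v : gnum rho -> 'rV[gnum rho]_d) : a <~ b -> GCbd a b p q u -> GCbd a b p q v ->
  exists2 eta, GC0 a b eta & forall t, gitv a b t -> eta t = v t - u t.
Proof.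
move=> ab [/GC_itvP hu ua ub] [/GC_itvP hv va vb].
have h i : exists g, (exists Om D, gtower [set: gnum rho] g Om D) /\
    forall t, gitv a b t -> g t = v t 0 i + -1 * u t 0 i.
  have [Om [D gt]] := hu i; have [Om' [D' gt']] := hv i.
  have gvu := gtower_lin (representsN (represents1 rho)) gt' gt.
  have [g [Om1 [D1 [gt1 E]]]] := gtower_extend ab gvu.
  by exists g; split=> //; exists Om1, D1.
have [g Hg] := choice h.
pose eta t : 'rV[gnum rho]_d := \row_i g i t.
have E t : gitv a b t -> eta t = v t - u t.
  by move=> At; apply/rowP => i; rewrite !mxE (Hg i).2// mulN1r.
exists eta => //; split.
- apply/GSF_curveP => i; have [[Om [D gt]] _] := Hg i; exists Om, D.
  by apply: gtower_sub gt => // X _; rewrite mxE.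
- by rewrite E ?ua ?va ?subrr//; exact: gitv_left.
- by rewrite E ?ub ?vb ?subrr//; exact: gitv_right.
Qed.

Theorem theorem44 (R : realType) (rho : gauge R) (d : nat)
    (a b : gnum rho)
    (F : gnum rho -> 'rV[gnum rho]_d -> 'rV[gnum rho]_d -> gnum rho)
    (p q : 'rV[gnum rho]_d) (r : gnum rho) (m : nat)
    (u : gnum rho -> 'rV[gnum rho]_d)
    (hab : a <~ b) (hF : lagrangian_GSF a b F) (hr : 0 <~ r)
    (hu : GCbd a b p q u)
    (hi : forall eta : gnum rho -> 'rV[gnum rho]_d, GC0 a b eta -> gvariation 1 (gfunctional a b F) u eta = 0)
    (hii : forall eta v : gnum rho -> 'rV[gnum rho]_d, GC0 a b eta -> GCball a b m r u v -> GCbd a b p q v ->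
       0 <=~ gvariation 2 (gfunctional a b F) v eta) :
  local_minimizer a b p q (gfunctional a b F) u /\
  ((forall eta v : gnum rho -> 'rV[gnum rho]_d, GC0 a b eta -> 0 <~ GCnorm a b m eta ->
      GCball a b m (r *+ 2) u v -> GCbd a b p q v ->
      0 <~ gvariation 2 (gfunctional a b F) v eta) ->
   forall v : gnum rho -> 'rV[gnum rho]_d, GCball a b m r u v -> GCbd a b p q v ->
     0 <~ GCnorm a b m (v - u) ->
     gfunctional a b F u <~ gfunctional a b F v).
Proof.
have [hub ua ubq] := hu.
(* A single intermediate curve [w] decides both the weak and the strict comparison. *)
have main v : GCball a b m r u v -> GCbd a b p q v -> exists eta w,
    [/\ GC0 a b eta, GCnorm a b m eta = GCnorm a b m (v - u), GCball a b m r u w, GCbd a b p q w &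
    (0 <=~ gvariation 2 (gfunctional a b F) w eta -> gfunctional a b F u <=~ gfunctional a b F v) /\
    (0 <~ gvariation 2 (gfunctional a b F) w eta -> gfunctional a b F u <~ gfunctional a b F v)].
  move=> [hvi hvr] hv; have [eta h0 etaE] := GC0_extension hab hu hv.
  have [heta eta_a eta_b] := h0.
  have heta' : GC_itv a b eta.
    apply/GC_itvP => i; have [Om [D gt]] := (GSF_curveP _ _).1 heta i.
    by exists Om, D; apply: gtower_sub gt.
  pose psi s := gfunctional a b F (fun t => u t + s *: eta t).
  have [Om [D gt]] := gtower_functional hab hF hub heta'.
  have [xi [hxi H]] := gtower_taylor2 gt.
  have psi0 : psi 0 = gfunctional a b F u.
    by rewrite /psi; congr gfunctional; apply/funext => t; rewrite scale0r addr0.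
  have psi1 : psi 1 = gfunctional a b F v.
    by apply: gfunctional_ext => t At; rewrite scale1r etaE// addrC subrK.
  exists eta, (fun t => u t + xi *: eta t); split.
  - exact: h0.
  - by apply: GCnorm_ext => t At; rewrite etaE.
  - split; first exact: GC_itv_lin.
    (* On the interval [w - u] is [xi *: (v - u)], and [xi] lies between 0 and 1. *)
    have -> : GCnorm a b m ((fun t => u t + xi *: eta t) - u) =
        GCnorm a b m (fun t => xi *: (v - u) t).
      apply: GCnorm_ext => t At; change (u t + xi *: eta t - u t = xi *: (v t - u t)).
      by rewrite -(etaE _ At) addrC addKr.
    apply: gle_lt_trans hvr; apply: (GCnorm_scale hab m hxi).
    by apply: GC_itv_ext heta' => t At; exact: etaE.
  - split; first exact: GC_itv_lin.
      by rewrite eta_a scaler0 addr0.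
    by rewrite eta_b scaler0 addr0.
  have [x Xx] := represents_exists xi.
  have E : (fun s => gfunctional a b F (fun t => (u t + xi *: eta t) + s *: eta t)) =
      (fun s => psi (xi + s)).
    apply/funext => s; rewrite /psi; congr gfunctional; apply/funext => t.
    by rewrite scalerDl addrA.
  have GE : gvariation 2 (gfunctional a b F) (fun t => u t + xi *: eta t) eta =
      gderiv [set: gnum rho] 2 (fun s => psi (xi + s)) 0.
    exact: (congr1 (fun h => gderiv [set: gnum rho] 2 h 0) E).
  have Q0 := represents_gderiv_setT 2 (gtower_shift Xx gt) (represents0 rho).
  rewrite GE -psi0 -psi1; apply: (H _ x Xx) (hi eta h0).
  by apply: (represents_eq_small Q0); apply: for_smallT => e; rewrite addr0.
split.
  split; first exact: hu.
  exists r, m; split; first exact: hr.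
  move=> v hv hvb.
  have [eta [w [h0 _ hw hwb [H _]]]] := main v hv hvb.
  by apply: H; exact: hii.
(* The curve [w] lies in the ball of radius [r], hence in that of radius [2r], and [eta] has the
   norm of [v - u]. *)
move=> hpos v hv hvb hn; have [eta [w [h0 En [hw1 hw2] hwb [_ H]]]] := main v hv hvb.
apply: H; apply: (hpos _ _ h0 _ _ hwb); first by rewrite En.
split; first exact: hw1.
exact: glt_le_trans hw2 (gle_double hr).
Qed.
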